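(* Let $n\ge1$, $\alpha=(\alpha_1,\dots,\alpha_n)\in(0,2]^n$, $\beta=(\beta_1,\dots,\beta_n)\in(0,\infty)^n$, and let $S^{\#}_{\alpha,\beta}(\omega)$ be the spectral density of the centered stationary Gaussian field on $\mathbb{R}^n$ with covariance $C^{\#}_{\alpha,\beta}(\tau)=\prod_{i=1}^n(1+|\tau_i|^{\alpha_i})^{-\beta_i}$. Then, as $\Vert\omega\Vert\to0^+$ (with all $\omega_i\ne0$), $$S^{\#}_{\alpha,\beta}(\omega)\sim\prod_{i=1}^n\mathcal{L}_i(\alpha_i,\beta_i;\omega_i),$$ where $$\mathcal{L}_i(\alpha_i,\beta_i;\omega_i)=\frac{\Gamma(1-\alpha_i\beta_i)}{\pi}\sin\frac{\pi\alpha_i\beta_i}{2}\,|\omega_i|^{\alpha_i\beta_i-1}\quad\text{if }\alpha_i\beta_i<1,$$ $$\mathcal{L}_i(\alpha_i,\beta_i;\omega_i)=\frac1\pi\left\{\ln\frac{1}{|\omega_i|}-\beta_i\left(\psi(\beta_i)+\gamma\right)-\gamma\right\}\quad\text{if }\alpha_i\beta_i=1,$$ $$\mathcal{L}_i(\alpha_i,\beta_i;\omega_i)=\frac1\pi\frac{\Gamma\left(\frac{1}{\alpha_i}\right)\Gamma\left(\beta_i-\frac{1}{\alpha_i}\right)}{\alpha_i\Gamma(\beta_i)}\quad\text{if }\alpha_i\beta_i>1.$$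
   Context: $\Vert\cdot\Vert$ is the Euclidean norm, $\psi=\Gamma'/\Gamma$, $\gamma$ is the Euler constant, and $f\sim g$ means $f/g\to1$. The spectral density of a stationary field with covariance $C(t)$ is the Fourier transform $S(\omega)=\frac{1}{(2\pi)^n}\int_{\mathbb{R}^n}e^{-i\omega\cdot t}C(t)\,d^nt$ if this integral converges, and otherwise the Fourier transform (same normalization) of $C$ as a generalized function on Schwartz space; alternatively, it is the function $S$ satisfying $C(t)=\int_{\mathbb{R}^n}e^{i\omega\cdot t}S(\omega)\,d^n\omega$. *)

(* Defs.v *)
From HB Require Import structures.
From mathcomp Require Import all_boot all_order all_algebra.
From mathcomp Require Import all_classical all_reals all_analysis.
From mathcomp Require Import complex.

Set Implicit Arguments.
Unset Strict Implicit.
Unset Printing Implicit Defensive.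

Import Order.TTheory GRing.Theory Num.Theory.
Import numFieldNormedType.Exports.

Local Open Scope classical_set_scope.
Local Open Scope ring_scope.

Definition rV_display : measure_display.
Proof. exact: default_measure_display. Qed.

Definition rV_coord {R : realType} n (i : 'I_n) (x : 'rV[R]_n) : R := x ord0 i.

(* The Borel sigma-algebra of R^n, generated by the coordinates (as for the
   library's instance on tuples). *)
Section measurable_rV.
Context {R : realType} (n : nat).

Let rV_set0 : g_sigma_preimage (@rV_coord R n) set0.
Proof. exact: sigma_algebra0. Qed.

Let rV_setC A :
  g_sigma_preimage (@rV_coord R n) A -> g_sigma_preimage (@rV_coord R n) (~` A).
Proof. exact: sigma_algebraC. Qed.

Let rV_bigcup (F : _^nat) :
  (forall i, g_sigma_preimage (@rV_coord R n) (F i)) ->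
  g_sigma_preimage (@rV_coord R n) (\bigcup_i (F i)).
Proof. exact: sigma_algebra_bigcup. Qed.

HB.instance Definition _ := @isMeasurable.Build rV_display
  'rV[R]_n (g_sigma_preimage (@rV_coord R n)) rV_set0 rV_setC rV_bigcup.

End measurable_rV.

Lemma measurable_rV_coord (R : realType) n (i : 'I_n) :
  measurable_fun [set: 'rV[R]_n] (rV_coord i).
Proof.
move=> _ A mA; apply: sub_sigma_algebra.
case: n i => [[] []//|m i].
rewrite -bigcup_mkord_ord; exists i; first exact: ltn_ord.
by exists A => //; rewrite inord_val.
Qed.

Lemma measurable_fun_rV (R : realType) n d (T : measurableType d)
    (f : T -> 'rV[R]_n) :
  (forall i, measurable_fun [set: T] (rV_coord i \o f)) ->
  measurable_fun [set: T] f.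
Proof.
move=> mf _ A mA; rewrite setTI.
have : preimage_set_system [set: T] f (g_sigma_preimage (@rV_coord R n))
    `<=` measurable.
  rewrite -(g_sigma_preimage_comp (@rV_coord R n)).
  apply: smallest_sub; first exact: sigma_algebra_measurable.
  case: n f mf {mA A} => [|m] f mf; first by rewrite big_ord0.
  rewrite -bigcup_mkord_ord; apply: bigcup_sub => i Ii.
  by move=> _ [B mB <-]; exact: mf.
by apply; exists A => //; rewrite setTI.
Qed.

Definition rV_cons {R : realType} n (p : R * 'rV[R]_n) : 'rV[R]_n.+1 :=
  row_mx (p.1%:M : 'rV_1) p.2.

Lemma rV_cons_head (R : realType) n (p : R * 'rV[R]_n) (j : 'I_1) :
  rV_coord (lshift n j : 'I_n.+1) (rV_cons p) = p.1.
Proof.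
by rewrite /rV_coord; apply: etrans (row_mxEl _ _ _ _) _; rewrite mxE !ord1.
Qed.

Lemma rV_cons_tail (R : realType) n (p : R * 'rV[R]_n) (j : 'I_n) :
  rV_coord (rshift 1 j : 'I_n.+1) (rV_cons p) = rV_coord j p.2.
Proof. by rewrite /rV_coord; apply: etrans (row_mxEr _ _ _ _) _. Qed.

Lemma measurable_rV_cons (R : realType) n :
  measurable_fun [set: (R * 'rV[R]_n)%type] (@rV_cons R n).
Proof.
apply: measurable_fun_rV => i.
case: (split_ordP (i : 'I_(1 + n))) => j ->.
- rewrite (_ : _ \o _ = fst); first exact: measurable_fst.
  by apply/funext => p; exact: rV_cons_head.
- rewrite (_ : _ \o _ = rV_coord j \o snd).
    exact: measurableT_comp (measurable_rV_coord _) measurable_snd.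
  by apply/funext => p; exact: rV_cons_tail.
Qed.

Lemma measurable_rV_uncons (R : realType) n :
  measurable_fun [set: 'rV[R]_n.+1]
    (fun x : 'rV[R]_(1 + n) => (x ord0 (lshift n ord0), rsubmx x)).
Proof.
apply/measurable_fun_pairP; split; first exact: measurable_rV_coord.
apply: measurable_fun_rV => i.
rewrite (_ : _ \o _ = rV_coord (rshift 1 i)); first exact: measurable_rV_coord.
by apply/funext => x; rewrite /= /rV_coord mxE.
Qed.

Section lebesgue_rV_step.
Context {R : realType} (n : nat).
Variable mu : {sigma_finite_measure set 'rV[R]_n -> \bar R}.

Definition lebesgue_rV_step : set 'rV[R]_n.+1 -> \bar R :=
  pushforward (@lebesgue_measure R \x mu)%E (@rV_cons R n).

Let step0 : lebesgue_rV_step set0 = 0%E.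
Proof. by rewrite /lebesgue_rV_step /pushforward preimage_set0 measure0. Qed.

Let step_ge0 A : (0 <= lebesgue_rV_step A)%E.
Proof. by rewrite /lebesgue_rV_step /pushforward measure_ge0. Qed.

Let mpre (A : set 'rV[R]_n.+1) : measurable A ->
  measurable (@rV_cons R n @^-1` A).
Proof. by move=> mA; rewrite -[X in measurable X]setTI; exact: measurable_rV_cons. Qed.

Let step_sigma_additive : semi_sigma_additive lebesgue_rV_step.
Proof.
move=> F mF tF mUF; rewrite /lebesgue_rV_step /pushforward preimage_bigcup.
apply: measure_semi_sigma_additive.
- by move=> k; exact: mpre.
- apply/trivIsetP => /= i j _ _ ij; rewrite -preimage_setI.
  by move/trivIsetP : tF => /(_ _ _ _ _ ij) ->//; rewrite preimage_set0.
- by rewrite -preimage_bigcup; exact: mpre.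
Qed.

HB.instance Definition _ := isMeasure.Build _ _ _ lebesgue_rV_step
  step0 step_ge0 step_sigma_additive.

Let step_sigma_finite : sigma_finite setT lebesgue_rV_step.
Proof.
pose un (x : 'rV[R]_(1 + n)) := (x ord0 (lshift n ord0), rsubmx x).
have unK p : un (rV_cons p) = p.
  case: p => a v; congr pair; first exact: (rV_cons_head (a, v)).
  exact: row_mxKr.
have /sigma_finiteP[F [FT ndF Foo]] := sigma_finiteT (@lebesgue_measure R).
have /sigma_finiteP[G [GT ndG Goo]] := sigma_finiteT mu.
exists (fun k => un @^-1` (F k `*` G k)) => [|k].
  rewrite -preimage_bigcup [X in _ @^-1` X](_ : _ = setT) ?preimage_setT//.
  apply/seteqP; split => // -[a v] _.
  have [i _ Fa] : (\bigcup_i F i) a by rewrite -FT.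
  have [j _ Gv] : (\bigcup_i G i) v by rewrite -GT.
  exists (maxn i j) => //; split.
  - by move: a Fa; exact/subsetPset/ndF/leq_maxl.
  - by move: v Gv; exact/subsetPset/ndG/leq_maxr.
have [mF Fk] := Foo k; have [mG Gk] := Goo k; split.
  rewrite -[X in measurable X]setTI; apply: measurable_rV_uncons => //.
  exact: measurableX.
rewrite /lebesgue_rV_step /pushforward.
rewrite (_ : _ @^-1` _ = F k `*` G k); last first.
  by rewrite -comp_preimage (_ : un \o _ = id)//; apply/funext => p; exact: unK.
by rewrite product_measure1E// lte_mul_pinfty// ge0_fin_numE.
Qed.

HB.instance Definition _ := Measure_isSigmaFinite.Build _ _ _ lebesgue_rV_step
  step_sigma_finite.

End lebesgue_rV_step.

(* n-fold product of the one-dimensional Lebesgue measure. *)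
Fixpoint lebesgue_rV {R : realType} (n : nat) :
    {sigma_finite_measure set 'rV[R]_n -> \bar R} :=
  match n with
  | 0 => \d_(0 : 'rV[R]_0)
  | m.+1 => lebesgue_rV_step (lebesgue_rV m)
  end.

Section fourier.
Context {R : realType} (n : nat).
Local Notation mu := (lebesgue_rV n : {measure set 'rV[R]_n -> \bar R}).

Definition dotp (x y : 'rV[R]_n) : R := \sum_i x ord0 i * y ord0 i.

Definition cexpi (x : R) : R[i] := (cos x +i* sin x)%C.

Definition cintegral (f : 'rV[R]_n -> R[i]) : R[i] :=
  ((\int[mu]_x complex.Re (f x)) +i* (\int[mu]_x complex.Im (f x)))%C.

Definition fourier (f : 'rV[R]_n -> R[i]) (w : 'rV[R]_n) : R[i] :=
  (((2 * pi) ^- n)%:C)%C * cintegral (fun t => cexpi (- dotp w t) * f t).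

(* [iter_partial [:: i1; ...; ik] f] is the iterated partial derivative
   d_i1 ... d_ik f. *)
Definition iter_partial (s : seq 'I_n) (f : 'rV[R]_n -> R) : 'rV[R]_n -> R :=
  foldr (fun i (g : 'rV[R]_n -> R) => 'D_(delta_mx ord0 i) g) f s.

Definition schwartz_real (f : 'rV[R]_n -> R) : Prop :=
  (forall (s : seq 'I_n) (i : 'I_n) (x : 'rV[R]_n),
     derivable (iter_partial s f) x (delta_mx ord0 i)) /\
  (forall s r : seq 'I_n, exists M : R, forall x : 'rV[R]_n,
     `|(\prod_(j <- r) x ord0 j) * iter_partial s f x| <= M).

Definition schwartz (phi : 'rV[R]_n -> R[i]) : Prop :=
  schwartz_real (fun x => complex.Re (phi x)) /\
  schwartz_real (fun x => complex.Im (phi x)).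

(* The functions f for which phi |-> \int f phi is a well-defined generalized
   function on the Schwartz space. *)
Definition tempered (f : 'rV[R]_n -> R) : Prop :=
  measurable_fun setT f /\
  forall g, schwartz_real g ->
    mu.-integrable setT (fun x => (f x * g x)%:E).

(* <F f, phi> = <f, F phi>, the transpose definition of the Fourier transform
   of a generalized function; [fourier] has the same normalization on both
   sides. *)
Definition generalized_fourier (C S : 'rV[R]_n -> R) : Prop :=
  [/\ tempered C, tempered S &
   forall phi, schwartz phi ->
     cintegral (fun w => ((S w)%:C)%C * phi w) =
     cintegral (fun t => ((C t)%:C)%C * fourier phi t)].

(* A generalized function only determines S almost everywhere; this fixes its
   values at every point near which S has a continuous version. *)
Definition continuous_where_possible (S : 'rV[R]_n -> R) : Prop :=
  forall (U : set 'rV[R]_n) (g : 'rV[R]_n -> R),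
    open U -> (forall w, U w -> {for w, continuous g}) ->
    {ae mu, forall w, U w -> S w = g w} ->
    forall w, U w -> S w = g w.

Definition spectral_density (C S : 'rV[R]_n -> R) : Prop :=
  if `[< mu.-integrable setT (fun t => (C t)%:E) >]
  then forall w, ((S w)%:C)%C = fourier (fun t => ((C t)%:C)%C) w
  else generalized_fourier C S /\ continuous_where_possible S.

End fourier.

(* [normal_prob m 0] is not a probability, hence the degenerate case. *)
Definition gaussian_law {R : realType} (m s : R) (A : set R) : \bar R :=
  if s == 0 then \d_m A else normal_prob m s A.

Definition gaussian_field {R : realType} n d (T : measurableType d)
    (P : probability T R) (X : 'rV[R]_n -> {RV P >-> R}) : Prop :=
  forall (k : nat) (t : 'I_k -> 'rV[R]_n) (a : 'I_k -> R),
    exists m s : R, forall A : set R, measurable A ->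
      P ((fun z => \sum_j a j * X (t j) z) @^-1` A) = gaussian_law m s A.

(* For a Gaussian field, strict stationarity amounts to a constant mean and a
   covariance depending on the lag only. *)
Definition centered_stationary_gaussian_field {R : realType} n d
    (T : measurableType d) (P : probability T R)
    (X : 'rV[R]_n -> {RV P >-> R}) (C : 'rV[R]_n -> R) : Prop :=
  [/\ gaussian_field X,
   forall t, ('E_P[X t] = 0)%E &
   forall t tau, covariance P (X (t + tau)) (X t) = (C tau)%:E].

Definition Gamma {R : realType} (x : R) : R :=
  \int[lebesgue_measure]_(t in `]0, +oo[) (t `^ (x - 1) * expR (- t)).

Definition digamma {R : realType} (x : R) : R := derive1 Gamma x / Gamma x.

Definition euler_gamma {R : realType} : R :=
  limn (fun m : nat => series harmonic m - ln m%:R).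

Definition cauchy_sheet_cov {R : realType} n (alpha beta : 'I_n -> R)
    (tau : 'rV[R]_n) : R :=
  \prod_i (1 + `|tau ord0 i| `^ alpha i) `^ (- beta i).

Definition Lfactor {R : realType} (a b w : R) : R :=
  if a * b < 1 then
    Gamma (1 - a * b) / pi * sin (pi * a * b / 2) * `|w| `^ (a * b - 1)
  else if a * b == 1 then
    pi^-1 * (ln `|w|^-1 - b * (digamma b + euler_gamma) - euler_gamma)
  else
    pi^-1 * (Gamma a^-1 * Gamma (b - a^-1) / (a * Gamma b)).

(* Main.v *)
(* The covariance (1 + |t|^a)^(-b) is a mixture of indicators of intervals
   |t| < u^(1/a), u having density b (1 + u)^(-b-1). Integrating the Fourier
   transforms of these indicators gives, for all a, b > 0, the absolutely
   convergent integral

     s(w) = 1/pi \int_0^oo b (1 + u)^(-b-1) sin (w u^(1/a)) / w du   (w != 0),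

   and S is the product of these functions at all points with nonzero
   coordinates. If the covariance is integrable this is Fubini's theorem.
   Otherwise the generalized Fourier identity is tested against products of
   functions exp(-x^2 - k ((x - m)/r)^(2k)), for which both sides factor; as
   k -> oo these tend to a Gaussian times the indicator of a box, so the two
   functions agree almost everywhere, hence by continuity wherever no
   coordinate vanishes.

   It remains to compare s with L as w -> 0. If a b > 1, take the limit under
   the integral. If a b < 1, substitute u = (y/w)^a first; the limit is the
   integral of y^(-ab-1) sin y. If a b = 1, the same substitution shows that
   pi s(w) stays within bounded distance of ln (1/w), so the additive constants
   in L do not matter. *)
Require Import Defs.
From HB Require Import structures.
From mathcomp Require Import all_boot all_order all_algebra.
From mathcomp Require Import all_classical all_reals all_analysis.
From mathcomp Require Import measurable_realfun lebesgue_integral_under complex.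
From mathcomp Require Import ring lra.

Set Implicit Arguments.
Unset Strict Implicit.
Unset Printing Implicit Defensive.

Import Order.TTheory GRing.Theory Num.Theory.
Import numFieldNormedType.Exports.

Local Open Scope classical_set_scope.
Local Open Scope ring_scope.

(** The covariance fails to be integrable as soon as one product [alpha_i beta_i] is at most 1,
    while the other coordinates may still be integrable. Conditionally convergent integrals are
    avoided altogether: by [|sin y| <= y^r] with [0 < r < min (1, a b)], the formula for the
    one-dimensional density converges absolutely and is bounded by a multiple of [|w|^(r-1)]. This
    is locally integrable, which is what the pairing with test functions needs, and it treats all
    coordinates alike. The test functions are polynomials times exponentials of polynomials because
    this class is closed under partial derivatives and under multiplication by coordinates:
    membership in the Schwartz space becomes a bound on polynomials times a Gaussian. None of them
    has compact support, so boxes are reached only in the limit, with a Gaussian weight that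
    dominates the whole sequence and never vanishes. *)

Section measure_generic.
Context {R : realType} d (T : measurableType d) (mu : {measure set T -> \bar R}).
Implicit Types (D : set T) (f g : T -> R).

Lemma integrable_mf D f : mu.-integrable D (EFin \o f) -> measurable_fun D f.
Proof. by move=> /(measurable_int mu)/measurable_EFinP. Qed.

Lemma integrable_dom D f g : measurable D -> measurable_fun D f ->
  mu.-integrable D (EFin \o g) -> (forall x, D x -> `|f x| <= g x) ->
  mu.-integrable D (EFin \o f).
Proof.
move=> mD mf ig fg; apply: le_integrable ig => //.
- exact/measurable_EFinP.
- by move=> x Dx /=; rewrite lee_fin (le_trans (fg x Dx))// ler_norm.
Qed.

(** The limit inherits the bound [g], so its integral is finite and the extended-real theorem can be
    transported through [fine]. *)
Lemma Rdominated_cvg D (f_ : nat -> T -> R) f g : measurable D ->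
  (forall n, measurable_fun D (f_ n)) -> measurable_fun D f ->
  mu.-integrable D (EFin \o g) ->
  (forall x, D x -> f_ ^~ x @ \oo --> f x) ->
  (forall n x, D x -> `|f_ n x| <= g x) ->
  (\int[mu]_(x in D) f_ n x) @[n --> \oo] --> \int[mu]_(x in D) f x.
Proof.
move=> mD mf_ mf ig f_f fg.
have intf : mu.-integrable D (EFin \o f).
  apply: (integrable_dom mD mf ig) => x Dx.
  have /cvg_norm f_fx := f_f x Dx.
  rewrite -(cvg_lim _ f_fx)//; apply: limr_le.
    by apply/cvg_ex; eexists; exact: f_fx.
  by apply: nearW => n; exact: fg.
apply: fine_cvg; rewrite fineK; last exact: integrable_fin_num.
apply: (@dominated_cvg _ _ _ mu _ mD (fun n x => (f_ n x)%:E) (EFin \o f) (EFin \o g)) => //.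
- by move=> n; exact/measurable_EFinP.
- by move=> x Dx; apply: cvg_EFin; [exact: nearW|exact: f_f].
Qed.

End measure_generic.

(** * Fubini's theorem for real-valued integrals *)

Section fubini_real.
Context {R : realType} d1 d2 (T1 : measurableType d1) (T2 : measurableType d2).
Variables (m1 : {sigma_finite_measure set T1 -> \bar R})
  (m2 : {sigma_finite_measure set T2 -> \bar R}).
Variables (f : T1 -> T2 -> R) (G : T1 -> R).
Hypothesis mf : measurable_fun setT (fun z : T1 * T2 => f z.1 z.2).
Hypothesis iG : m1.-integrable setT (EFin \o G).
Hypothesis fG : forall x, (\int[m2]_y `|(f x y)%:E| <= (G x)%:E)%E.

Let mfE : measurable_fun setT (fun z : T1 * T2 => (f z.1 z.2)%:E).
Proof. exact/measurable_EFinP. Qed.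

Let mf1 x : measurable_fun setT (f x).
Proof.
exact: (measurableT_comp (f := fun z : T1 * T2 => f z.1 z.2) mf (measurable_pair1 x)).
Qed.

Lemma integrable_section x : m2.-integrable setT (EFin \o f x).
Proof.
apply/integrableP; split; first by apply/measurable_EFinP; exact: mf1.
exact: le_lt_trans (fG x) (ltry _).
Qed.

Lemma integrable_prod : (m1 \x m2)%E.-integrable setT
  (fun z : T1 * T2 => (f z.1 z.2)%:E).
Proof.
apply/integrable12ltyP => //=.
have := integrable_lty measurableT iG.
apply: le_lt_trans; apply: ge0_le_integral => //.
- by move=> x _; exact: integral_ge0.
- apply: (@measurable_fun_fubini_tonelli_F _ _ _ _ _ m2
    (fun z => `|(f z.1 z.2)%:E|%E)) => //=.
  by apply/measurable_EFinP; exact: measurableT_comp mf.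
- exact: measurable_int iG.
- by move=> x _; exact: fG.
Qed.

Let EFin1 x : (\int[m2]_y f x y)%R%:E = (\int[m2]_y (f x y)%:E)%E.
Proof.
by rewrite /Rintegral fineK//; apply: integrable_fin_num => //; exact: integrable_section.
Qed.

Lemma integrable_Rfubini1 : m1.-integrable setT (fun x => (\int[m2]_y f x y)%R%:E).
Proof.
under eq_fun do rewrite EFin1.
exact: (integrable_fubini_F integrable_prod).
Qed.

Lemma measurable_Rfubini2 : measurable_fun setT (fun y => \int[m1]_x f x y).
Proof.
apply: measurableT_comp => //.
exact: (measurable_fubini_G integrable_prod).
Qed.

Lemma Rfubini : \int[m1]_x \int[m2]_y f x y = \int[m2]_y \int[m1]_x f x y.
Proof.
rewrite /Rintegral; congr fine.
under eq_integral do rewrite -/(Rintegral _ _ _) EFin1.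
rewrite (Fubini integrable_prod).
have mG := measurable_fubini_G integrable_prod.
(* The sections in [x] are integrable only for almost every [y]; the extended integral and its
   [fine] can differ on a null set. *)
apply: ae_eq_integral => //.
  by apply/measurable_EFinP; apply: measurableT_comp.
have := ae_integrable2 integrable_prod.
apply: filterS => y iy _ /=.
by rewrite fineK//; exact: integrable_fin_num.
Qed.

End fubini_real.

Section fubini_real_prod.
Context {R : realType} d1 d2 (T1 : measurableType d1) (T2 : measurableType d2).
Variables (m1 : {sigma_finite_measure set T1 -> \bar R})
  (m2 : {sigma_finite_measure set T2 -> \bar R}).
Variables (f : T1 -> T2 -> R) (g : T1 -> R) (h : T2 -> R).
Hypothesis mf : measurable_fun setT (fun z : T1 * T2 => f z.1 z.2).
Hypothesis ig : m1.-integrable setT (EFin \o g).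
Hypothesis ih : m2.-integrable setT (EFin \o h).
Hypothesis fgh : forall x y, `|f x y| <= g x * h y.

Let G x := `|g x| * \int[m2]_y `|h y|.

Let iG : m1.-integrable setT (EFin \o G).
Proof.
rewrite /G; under eq_fun do rewrite mulrC.
rewrite (_ : _ \o _ = (fun x => (\int[m2]_y `|h y|)%:E * (`|g x|)%:E)%E)//.
by apply: integrableZl => //; exact: integrable_norm.
Qed.

Let fG x : (\int[m2]_y `|(f x y)%:E| <= (G x)%:E)%E.
Proof.
have ih' : m2.-integrable setT (fun y => `|h y|%:E) by exact: integrable_norm.
rewrite /G EFinM /Rintegral fineK; last exact: integrable_fin_num.
rewrite -integralZl//; apply: ge0_le_integral => //=.
- apply/measurable_EFinP/measurableT_comp => //.
  exact: (measurableT_comp (f := fun z : T1 * T2 => f z.1 z.2) mf (measurable_pair1 x)).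
- by apply: measurable_funeM; exact: measurable_int ih'.
- move=> y _; rewrite -EFinM lee_fin (le_trans (fgh x y))//.
  by rewrite (le_trans (ler_norm _))// normrM.
Qed.

Lemma integrable_prod_dom : (m1 \x m2)%E.-integrable setT
  (fun z : T1 * T2 => (f z.1 z.2)%:E).
Proof. exact: (integrable_prod mf iG fG). Qed.

Lemma Rfubini_prod :
  [/\ \int[m1]_x \int[m2]_y f x y = \int[m2]_y \int[m1]_x f x y,
     m1.-integrable setT (fun x => (\int[m2]_y f x y)%R%:E) &
     measurable_fun setT (fun y => \int[m1]_x f x y)].
Proof.
split; first exact: (Rfubini mf iG fG).
- exact: (integrable_Rfubini1 mf iG fG).
- exact: (measurable_Rfubini2 mf iG fG).
Qed.

End fubini_real_prod.

(** * Improper integrals on the line *)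

Section exhaustion.
Context {R : realType}.
Implicit Types (D E : set R) (al be : R^nat) (f g G F : R -> R).
Local Notation mu := (@lebesgue_measure R).

(* Open sets swept out by an increasing sequence of compact intervals: improper
   versions of the fundamental theorem and of substitution then follow from the
   library's statements on segments. *)
Definition exhausts D al be := [/\ open D, (forall n, al n < be n),
  nonincreasing_seq al, nondecreasing_seq be & D = \bigcup_n `[al n, be n]%classic].

Lemma exhausts_subset D al be n : exhausts D al be -> `[al n, be n]%classic `<=` D.
Proof. by move=> [_ _ _ _ ->]; exact: (@bigcup_sup _ _ n). Qed.

Lemma exhausts_measurable D al be : exhausts D al be -> measurable D.
Proof. by move=> [oD _ _ _ _]; exact: open_measurable. Qed.

Lemma exhausts_nd D al be : exhausts D al be ->
  nondecreasing_seq (fun n => `[al n, be n]%classic).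
Proof.
move=> [_ _ na nb _] m n mn; rewrite subsetEset => x /=.
rewrite !in_itv/= => /andP[ax xb]; rewrite (le_trans (na _ _ mn) ax)/=.
exact: le_trans xb (nb _ _ mn).
Qed.

Lemma exhausts_cvg_ge0 D al be f : exhausts D al be -> measurable_fun D f ->
  (forall x, D x -> 0 <= f x) ->
  (\int[mu]_(x in `[al n, be n]) (f x)%:E @[n --> \oo] -->
   \int[mu]_(x in D) (f x)%:E)%E.
Proof.
move=> eD mf f0; have [_ _ _ _ DE] := eD; rewrite [X in _ --> integral _ X _]DE.
apply: ge0_nondecreasing_set_cvg_integral => //.
- exact: exhausts_nd eD.
- move=> n; apply/measurable_EFinP; apply: measurable_funS mf.
    exact: exhausts_measurable eD.
  exact: exhausts_subset eD.
- by move=> n x /(exhausts_subset eD) Dx; rewrite lee_fin f0.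
Qed.

Lemma exhausts_cvg D al be f : exhausts D al be ->
  mu.-integrable D (EFin \o f) ->
  \int[mu]_(x in `[al n, be n]) f x @[n --> \oo] --> \int[mu]_(x in D) f x.
Proof.
move=> eD intf; have mD := exhausts_measurable eD.
have mf := integrable_mf intf.
under eq_fun => n.
  rewrite -(setIidr (exhausts_subset (n := n) eD)) Rintegral_mkcondr.
  over.
apply: (@Rdominated_cvg _ _ _ mu D (fun n => f \_ `[al n, be n]) f (fun x => `|f x|)) => //.
- by move=> n; apply/measurable_restrict => //; exact: measurable_funS mf.
- exact: integrable_norm.
- move=> x; have [_ _ na nb ->] := eD => -[N _ xN].
  apply: cvg_near_cst; near=> n; rewrite patchE mem_set//.
  have Nn : (N <= n)%N by near: n; exists N.
  by move: xN; apply/subsetPset/exhausts_nd; first exact: eD.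
- by move=> n x Dx; rewrite patchE; case: ifP => // _; rewrite normr0.
Unshelve. all: by end_near. Qed.

Lemma open_within_continuous D f a b : `[a, b]%classic `<=` D ->
  (forall x, D x -> {for x, continuous f}) -> {within `[a, b], continuous f}.
Proof.
move=> abD cf; apply: continuous_in_subspaceT => x.
by rewrite inE => xab; exact/cf/abD.
Qed.

Lemma open_cts_measurable D f : open D ->
  (forall x, D x -> {for x, continuous f}) -> measurable_fun D f.
Proof.
move=> oD cf; apply: open_continuous_measurable_fun => // x.
by rewrite inE; exact: cf.
Qed.

Lemma is_derive_cont f (x df : R) : is_derive x 1 f df -> {for x, continuous f}.
Proof.
by case=> df0 _; exact/differentiable_continuous/derivable1_diffP.
Qed.

Section FTC.
Variables (D : set R) (al be : R^nat) (G g : R -> R) (l0 l1 : R).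
Hypothesis eD : exhausts D al be.
Hypothesis dG : forall x, D x -> is_derive x 1 G (g x).
Hypothesis cg : forall x, D x -> {for x, continuous g}.
Hypothesis Gl0 : G (al n) @[n --> \oo] --> l0.
Hypothesis Gl1 : G (be n) @[n --> \oo] --> l1.

Let FTC_segment n :
  (\int[mu]_(x in `[al n, be n]) (g x)%:E = (G (be n))%:E - (G (al n))%:E)%E.
Proof.
have [_ ab _ _ _] := eD.
have abD := exhausts_subset (n := n) eD.
have Dab x : x \in `[al n, be n] -> D x by move=> xab; exact: abD.
have cG x : D x -> {for x, continuous G} by move=> /dG/is_derive_cont.
rewrite (@continuous_FTC2 _ _ G)//.
- exact: open_within_continuous abD cg.
- split => [x xab||].
  + by apply: ex_derive; exact: dG _ (Dab _ (subset_itv_oo_cc xab)).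
  + by apply: cvg_at_right_filter; apply: cG; apply: Dab; rewrite bound_itvE ltW.
  + by apply: cvg_at_left_filter; apply: cG; apply: Dab; rewrite bound_itvE ltW.
- move=> x xab; rewrite derive1E.
  exact: (@derive_val _ _ _ _ _ _ _ (dG (Dab _ (subset_itv_oo_cc xab)))).
Qed.

Lemma exhausts_FTC_ge0 : (forall x, D x -> 0 <= g x) ->
  (\int[mu]_(x in D) (g x)%:E = (l1 - l0)%:E)%E.
Proof.
move=> g0; have [oD _ _ _ _] := eD.
have mg : measurable_fun D g by exact: open_cts_measurable.
have := exhausts_cvg_ge0 eD mg g0 => /cvg_lim <-//.
apply/cvg_lim => //; under eq_fun do rewrite FTC_segment -EFinB.
by apply: cvg_EFin; [exact: nearW|exact: cvgB].
Qed.

(** For a nonnegative derivative, finite limits of the primitive at both ends already prove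
    integrability. The explicit majorants used later are obtained in this way. *)
Lemma exhausts_FTC_integrable : (forall x, D x -> 0 <= g x) ->
  mu.-integrable D (EFin \o g).
Proof.
move=> g0; have [oD _ _ _ _] := eD.
apply/integrableP; split.
  by apply/measurable_EFinP; exact: open_cts_measurable.
under eq_integral => x xD.
  rewrite /= ger0_norm; last by rewrite g0//; rewrite inE in xD.
  over.
by rewrite exhausts_FTC_ge0// ltry.
Qed.

Lemma exhausts_FTC : mu.-integrable D (EFin \o g) ->
  \int[mu]_(x in D) g x = l1 - l0.
Proof.
move=> ig; have := exhausts_cvg eD ig => /cvg_lim <-//.
apply/cvg_lim => //; under eq_fun do rewrite /Rintegral FTC_segment -EFinB/=.
exact: cvgB.
Qed.

End FTC.

Section substitution.
Variables (D E : set R) (al be : R^nat) (F dF G : R -> R).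
Hypothesis eD : exhausts D al be.
Hypothesis eE : exhausts E (F \o al) (F \o be).
Hypothesis dFE : forall x, D x -> is_derive x 1 F (dF x).
Hypothesis cdF : forall x, D x -> {for x, continuous dF}.
Hypothesis dF0 : forall x, D x -> 0 <= dF x.
Hypothesis incrF : {in D &, {homo F : x y / x < y}}.
Hypothesis FDE : forall x, D x -> E (F x).
Hypothesis cG : forall x, E x -> {for x, continuous G}.

Let near_dF x : D x -> \forall y \near x, dF y = (derive1 F) y.
Proof.
have [oD _ _ _ _] := eD; move=> Dx.
have : \forall y \near x, D y by exact: open_nbhs_nbhs.
by apply: filterS => y Dy; rewrite derive1E (@derive_val _ _ _ _ _ _ _ (dFE Dy)).
Qed.

Let cF' x : D x -> {for x, continuous (derive1 F)}.
Proof.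
move=> Dx; have dFx : (derive1 F) x = dF x by rewrite (nbhs_singleton (near_dF Dx)).
rewrite /prop_for /continuous_at dFx.
by apply: cvg_trans (cdF Dx); apply: near_eq_cvg; exact: near_dF.
Qed.

Let subst_segment n :
  (\int[mu]_(x in `[F (al n), F (be n)]) (G x)%:E =
   \int[mu]_(x in `[al n, be n]) (G (F x) * dF x)%:E)%E.
Proof.
have [_ ab _ _ _] := eD.
have abD := exhausts_subset (n := n) eD.
have Dab x : x \in `[al n, be n] -> D x by move=> xab; exact: abD.
have Da : D (al n) by apply: Dab; rewrite bound_itvE ltW.
have Db : D (be n) by apply: Dab; rewrite bound_itvE ltW.
have cF x : D x -> {for x, continuous F} by move=> /dFE/is_derive_cont.
rewrite integration_by_substitution_increasing//.
- apply: eq_integral => x; rewrite inE => xab.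
  by rewrite !fctE derive1E (@derive_val _ _ _ _ _ _ _ (dFE (Dab _ xab))).
- exact: ltW.
- by move=> x y xab yab; apply: incrF; rewrite inE; exact: Dab.
- by move=> x xab; apply: cF'; apply: Dab; exact: subset_itv_oo_cc.
- by apply/cvg_ex; exists ((derive1 F) (al n)); apply: cvg_at_right_filter; exact: cF'.
- by apply/cvg_ex; exists ((derive1 F) (be n)); apply: cvg_at_left_filter; exact: cF'.
- split => [x xab||].
  + by case: (dFE (Dab _ (subset_itv_oo_cc xab))).
  + by apply: cvg_at_right_filter; exact: cF.
  + by apply: cvg_at_left_filter; exact: cF.
- by apply: open_within_continuous cG; exact: (exhausts_subset (n := n) eE).
Qed.

Let cGF x : D x -> {for x, continuous (fun x => G (F x) * dF x)}.
Proof.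
move=> Dx; apply: cvgM; last exact: cdF.
by apply: continuous_comp; [exact: (is_derive_cont (dFE Dx))|exact/cG/FDE].
Qed.

Lemma exhausts_subst_ge0 : (forall x, E x -> 0 <= G x) ->
  (\int[mu]_(x in E) (G x)%:E = \int[mu]_(x in D) (G (F x) * dF x)%:E)%E.
Proof.
move=> G0; have [oD _ _ _ _] := eD; have [oE _ _ _ _] := eE.
have mG : measurable_fun E G by exact: open_cts_measurable.
have := exhausts_cvg_ge0 eE mG G0 => /cvg_lim <-//.
apply/cvg_lim => //=; under eq_fun do rewrite subst_segment.
apply: exhausts_cvg_ge0 => //.
- by apply: open_cts_measurable => // x; exact: cGF.
- by move=> x Dx; rewrite mulr_ge0 ?dF0// G0//; exact: FDE.
Qed.

End substitution.

(** Positive and negative parts are substituted separately: multiplication by [dF >= 0] commutes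
    with both. The two sides thus agree part by part, even when an integral diverges. *)
Lemma exhausts_subst D E al be F dF G : exhausts D al be ->
  exhausts E (F \o al) (F \o be) ->
  (forall x, D x -> is_derive x 1 F (dF x)) ->
  (forall x, D x -> {for x, continuous dF}) ->
  (forall x, D x -> 0 <= dF x) -> {in D &, {homo F : x y / x < y}} ->
  (forall x, D x -> E (F x)) -> (forall x, E x -> {for x, continuous G}) ->
  \int[mu]_(x in E) G x = \int[mu]_(x in D) (G (F x) * dF x).
Proof.
move=> eD eE dFE cdF dF0 incrF FDE cG.
rewrite /Rintegral [in LHS]integralE [in RHS]integralE.
have maxcts (H : R -> R) x : {for x, continuous H} ->
    {for x, continuous (fun x => Num.max (H x) 0)}.
  by move=> cH; apply: continuous_max => //; exact: cst_continuous.
have posE (H : R -> R) x : ((fun y => (H y)%:E)^\+ x = (Num.max (H x) 0)%:E)%E.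
  by rewrite funeposE EFin_max.
have negE (H : R -> R) x : ((fun y => (H y)%:E)^\- x = (Num.max (- H x) 0)%:E)%E.
  by rewrite funenegE EFin_max.
congr (fine (_ - _)).
- under eq_integral do rewrite posE; under [in RHS]eq_integral do rewrite posE.
  rewrite (exhausts_subst_ge0 eD eE dFE)//.
  + apply: eq_integral => x; rewrite inE => Dx.
    by rewrite maxr_pMl ?dF0// mul0r.
  + by move=> x Ex; apply: maxcts; exact: cG.
  + by move=> x _; rewrite le_max lexx orbT.
- under eq_integral do rewrite negE; under [in RHS]eq_integral do rewrite negE.
  rewrite (exhausts_subst_ge0 eD eE dFE)//.
  + apply: eq_integral => x; rewrite inE => Dx.
    by rewrite maxr_pMl ?dF0// mul0r mulNr.
  + by move=> x Ex; apply: maxcts; apply: cvgN; exact: cG.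
  + by move=> x _; rewrite le_max lexx orbT.
Qed.

Lemma exhausts_posreal (u v : R^nat) : (forall n, 0 < u n) -> (forall n, u n < v n) ->
  nonincreasing_seq u -> nondecreasing_seq v ->
  u @ \oo --> 0 -> v @ \oo --> +oo ->
  exhausts `]0, +oo[%classic u v.
Proof.
move=> u0 uv nu nv u_0 v_y; split => //.
apply/seteqP; split => [x|x [n _]] /=; rewrite !in_itv/= ?andbT.
  move=> x0; have H : \forall n \near \oo, u n <= x /\ x <= v n.
    near=> n; split; last by near: n; move/cvgryPge: v_y; exact.
    by near: n; apply: (cvgr_le 0).
  by case: H => n _ /(_ n (leqnn n)) [ux xv]; exists n => //=; rewrite in_itv/= ux.
by move=> /andP[ux _]; exact: lt_le_trans (u0 n) ux.
Unshelve. all: by end_near. Qed.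

(** Starting at 2 gives [invn n < 1 < natn n] for every [n], so that no interval of the exhaustion
    is degenerate. *)
Definition invn (n : nat) : R := n.+2%:R^-1.
Definition natn (n : nat) : R := n.+2%:R.

Lemma invn_gt0 n : 0 < invn n. Proof. by rewrite invr_gt0. Qed.

Lemma invn_lt_natn n : invn n < natn n.
Proof.
apply: (@lt_trans _ _ 1); first by rewrite invf_lt1 // ltr1n.
by rewrite ltr1n.
Qed.

Lemma cvg_natn : natn @ \oo --> +oo.
Proof.
have := @cvgr_idn R; rewrite -(cvg_shiftn 2).
by apply: cvg_trans; apply: near_eq_cvg; apply: nearW => n; rewrite /= /natn addn2.
Qed.

Lemma cvg_invn : invn @ \oo --> 0.
Proof. by apply/gtr0_cvgV0; [exact: nearW|exact: cvg_natn]. Qed.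

Lemma cvg_invn_right : invn @ \oo --> 0^'+.
Proof.
move=> A /cvg_invn[N _ HN]; exists N => // n /= Nn; exact: HN n Nn (invn_gt0 n).
Qed.

Lemma nonincreasing_invn : nonincreasing_seq invn.
Proof. by move=> m n mn; rewrite lef_pV2 ?posrE// ler_nat. Qed.

Lemma nondecreasing_natn : nondecreasing_seq natn.
Proof. by move=> m n mn; rewrite ler_nat. Qed.

Lemma cvg_natn_comp (f : R -> R) (l : R) : f x @[x --> +oo] --> l ->
  f (natn n) @[n --> \oo] --> l.
Proof. by move=> fl; apply: cvg_comp fl; exact: cvg_natn. Qed.

Lemma cvg_invn_comp (f : R -> R) (l : R) : f x @[x --> 0^'+] --> l ->
  f (invn n) @[n --> \oo] --> l.
Proof. by move=> fl; apply: cvg_comp fl; exact: cvg_invn_right. Qed.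

Lemma exhausts_pos : exhausts `]0, +oo[%classic invn natn.
Proof.
apply: exhausts_posreal.
- exact: invn_gt0.
- exact: invn_lt_natn.
- exact: nonincreasing_invn.
- exact: nondecreasing_natn.
- exact: cvg_invn.
- exact: cvg_natn.
Qed.

Lemma exhausts_gt c :
  exhausts `]c, +oo[%classic (fun n => c + invn n) (fun n => c + natn n).
Proof.
split.
- by apply: interval_open.
- by move=> n; rewrite ltrD2l invn_lt_natn.
- by move=> m n mn; rewrite lerD2l; exact: nonincreasing_invn.
- by move=> m n mn; rewrite lerD2l; exact: nondecreasing_natn.
- have [_ _ _ _ E] := exhausts_pos; apply/seteqP; split => [x /=|x [n _]] /=.
    rewrite in_itv/= andbT => cx.
    have [n _] : (\bigcup_n `[invn n, natn n]%classic) (x - c).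
      by rewrite -E /= in_itv/= subr_gt0 cx.
    by rewrite /= in_itv/= => xn; exists n => //=; rewrite in_itv/= -lerBrDl -[X in _ && X]lerBlDl.
  by rewrite !in_itv/= andbT => /andP[cx _]; rewrite (lt_le_trans _ cx)// ltrDl invn_gt0.
Qed.

Lemma exhausts_neg : exhausts `]-oo, 0[%classic (fun n => - natn n) (fun n => - invn n).
Proof.
split.
- by apply: interval_open.
- by move=> n; rewrite ltrN2 invn_lt_natn.
- by move=> m n mn; rewrite lerN2; exact: nondecreasing_natn.
- by move=> m n mn; rewrite lerN2; exact: nonincreasing_invn.
- have [_ _ _ _ E] := exhausts_pos; apply/seteqP; split => [x /=|x [n _]] /=.
    rewrite in_itv/= => x0.
    have [n _] : (\bigcup_n `[invn n, natn n]%classic) (- x).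
      by rewrite -E /= in_itv/= oppr_gt0 x0.
    by rewrite /= in_itv/= => /andP[nx xn]; exists n => //=; rewrite in_itv/= lerNl xn lerNr.
  by rewrite !in_itv/= => /andP[_ xn]; rewrite (le_lt_trans xn)// oppr_lt0 invn_gt0.
Qed.

Lemma exhausts_setT : exhausts setT (fun n => - natn n) natn.
Proof.
split.
- exact: openT.
- by move=> n; rewrite gtrN// ltr0n.
- by move=> m n mn; rewrite lerN2; exact: nondecreasing_natn.
- exact: nondecreasing_natn.
- apply/esym; rewrite -subTset => x _.
  have [N _ HN] : \forall n \near \oo, `|x| <= natn n.
    by have /cvgryPge := cvg_natn; exact.
  by exists N => //=; rewrite in_itv/= -ler_norml HN/=.
Qed.

End exhaustion.

(** * Measurability and elementary inequalities *)

Section real_facts.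
Context {R : realType}.
Implicit Types x y z w s c : R.
Local Notation mu := (@lebesgue_measure R).

Lemma measurable_invr : measurable_fun setT (@GRing.inv R).
Proof.
rewrite -(setvU [set (0:R)]); apply/measurable_funU => //.
  exact: measurableC.
split; last exact: measurable_fun_set1.
apply: open_cts_measurable; first by apply/closed_openC; apply: accessible_closed_set1; exact/hausdorff_accessible/order_hausdorff.
by move=> x /= /eqP x0; exact: inv_continuous.
Qed.

Lemma measurable_sin : measurable_fun setT (@sin R).
Proof. by apply: continuous_measurable_fun; exact: continuous_sin. Qed.

Lemma measurable_cos : measurable_fun setT (@cos R).
Proof. by apply: continuous_measurable_fun; exact: continuous_cos. Qed.

(** Meant for formulas with a division by [w]: [sker z 0] is 0 by convention, whereas the cosine
    integral that it represents elsewhere is not, so the equality is available only off 0. *)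
Lemma Rintegral_neq0 (f g : R -> R) : measurable_fun setT f -> measurable_fun setT g ->
  (forall x, x != 0 -> f x = g x) -> \int[mu]_x f x = \int[mu]_x g x.
Proof.
move=> mf mg fg; rewrite /Rintegral; congr fine; apply: ae_eq_integral => //.
- exact/measurable_EFinP.
- exact/measurable_EFinP.
exists [set 0]; split => //; first exact: lebesgue_measure_set1.
move=> x /= H; apply: contrapT => /eqP x0; apply: H => _.
by rewrite fg.
Qed.

Lemma sin_diff_le x y : `|sin x - sin y| <= `|x - y|.
Proof.
wlog xy : x y / x <= y.
  by move=> H; case: (leP x y) => [/H//|/ltW/H]; rewrite distrC [leRHS]distrC.
have [c _] := @MVT_segment R sin cos x y xy (fun z _ => is_derive_sin z)
  (continuous_subspaceT (@continuous_sin R)).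
rewrite distrC => ->; rewrite normrM [leRHS]distrC ler_piMl//.
exact: cos_max.
Qed.

Lemma cos_diff_le x y : `|cos x - cos y| <= `|x - y|.
Proof.
wlog xy : x y / x <= y.
  by move=> H; case: (leP x y) => [/H//|/ltW/H]; rewrite distrC [leRHS]distrC.
have [c _] := @MVT_segment R cos (fun x => - sin x) x y xy (fun z _ => is_derive_cos z)
  (continuous_subspaceT (@continuous_cos R)).
rewrite distrC => ->; rewrite normrM [leRHS]distrC ler_piMl//.
by rewrite normrN; exact: sin_max.
Qed.

Lemma abs_sin_le x : `|sin x| <= `|x|.
Proof. by have := sin_diff_le x 0; rewrite sin0 !subr0. Qed.

(** The mean value theorem produces the factor [cos c - 1], bounded by [c <= x]. The quadratic order
    is what cancels a factor [y^(-2)] in the logarithmic case. *)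
Lemma abs_sin_sub_le x : `|sin x - x| <= x ^+ 2.
Proof.
wlog x0 : x / 0 <= x.
  move=> H; case: (leP 0 x) => [/H//|/ltW x0].
  have := H (- x); rewrite oppr_ge0 sinN sqrrN => /(_ x0).
  by rewrite -opprD normrN.
have df z : is_derive z 1 (fun z => sin z - z) (cos z - 1).
  exact: is_deriveB.
have [c] := @MVT_segment R (fun z => sin z - z) (fun z => cos z - 1) 0 x x0 (fun z _ => df z)
  (continuous_subspaceT (fun z => is_derive_cont (df z))).
rewrite in_itv/= => /andP[c0 cx]; rewrite sin0 !subr0 => ->.
rewrite normrM expr2 (ger0_norm x0) ler_wpM2r//.
rewrite -(@cos0 R) (le_trans (cos_diff_le _ _))// subr0 ger0_norm//.
Qed.

(** Interpolates between [|sin y| <= y] for [y <= 1] and [|sin y| <= 1] beyond. A smaller exponent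
    [s] costs integrability at [w = 0] and gains integrability in the mixing variable. *)
Lemma abs_sin_le_powR y s : 0 <= y -> 0 <= s <= 1 -> `|sin y| <= y `^ s.
Proof.
rewrite le_eqVlt => /orP[/eqP<- _|y0 /andP[s0 s1]].
  by rewrite sin0 normr0 powR_ge0.
have [y1|y1] := leP y 1.
  rewrite (le_trans (abs_sin_le _))// gtr0_norm//.
  by apply: ger1_powR; rewrite ?y0.
rewrite (le_trans (sin_max _))// -(_ : 1 `^ s = 1); last by rewrite powR1.
by apply: ge0_ler_powR; rewrite ?nnegrE// ltW.
Qed.

Lemma abs_sin_div_le w z s : 0 <= z -> 0 <= s <= 1 -> s != 1 ->
  `|sin (w * z) / w| <= z `^ s * `|w| `^ (s - 1).
Proof.
move=> z0 s01 s1; have [->|w0] := eqVneq w 0.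
  by rewrite mul0r sin0 mul0r normr0 mulr_ge0 ?powR_ge0.
have aw : 0 < `|w| by rewrite normr_gt0.
have sE : `|sin (w * z)| = `|sin (`|w| * z)|.
  by have [w1|w1] := ger0P w; rewrite // mulNr sinN normrN.
rewrite normrM sE normfV powRB ?aw ?implybT//.
rewrite powRr1 ?normr_ge0// mulrA ler_pM2r ?invr_gt0//.
rewrite mulrC -powRM// abs_sin_le_powR// mulr_ge0//.
by rewrite lt0r_neq0 ?implybT.
Qed.

Lemma is_derive_powRD c x : 0 < 1 + x ->
  is_derive x 1 (fun u => (1 + u) `^ c) (c * (1 + x) `^ (c - 1)).
Proof.
move=> x0; have d1 : is_derive x 1 (fun u : R => 1 + u) 1.
  by rewrite -[X in is_derive _ _ _ X]add0r; apply: is_deriveD.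
rewrite -[X in is_derive _ _ _ X]mulr1.
exact: (@is_derive1_comp R (@powR R ^~ c) (fun u => 1 + u) x _ _ (is_derive1_powR c x0) d1).
Qed.

Lemma cvg_powRN c : 0 < c -> x `^ (- c) @[x --> +oo] --> (0 : R).
Proof.
move=> c0; apply/cvgrPdist_le => e e0; near=> x.
rewrite sub0r normrN ger0_norm ?powR_ge0//.
have x0 : 0 < x by near: x; exact: nbhs_pinfty_gt.
rewrite powRN invf_ple ?posrE ?powR_gt0//.
have -> : e^-1 = ((e^-1) `^ (c^-1)) `^ c.
  by rewrite -powRrM mulVf ?gt_eqF// powRr1// invr_ge0 ltW.
apply: ge0_ler_powR; rewrite ?nnegrE ?powR_ge0 ?ltW//.
Unshelve. all: by end_near. Qed.

Lemma measurable_fun_powRl d (T : measurableType d) (D : set T) (f : T -> R) (c : R) :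
  measurable_fun D f -> measurable_fun D (fun v => f v `^ c).
Proof.
move=> mf; exact: (measurableT_comp (f := @powR R ^~ c) (measurable_powR c) mf).
Qed.

End real_facts.

(** * The one-dimensional spectral density *)

Section pareto.
Context {R : realType}.
Implicit Types a b r s t u w x z : R.
Local Notation mu := (@lebesgue_measure R).

(* Density of a law with tail (1 + x)^(-b), so that (1 + |t|^a)^(-b) is the
   mixture over u of the indicators of |t| < u^(1/a). *)
Definition pdens b u : R := b * (1 + u) `^ (- b - 1) * \1_(`]0, +oo[%classic) u.

Lemma pdensE b u : 0 < u -> pdens b u = b * (1 + u) `^ (- b - 1).
Proof.
by move=> u0; rewrite /pdens indicE mem_set ?mulr1//= in_itv/= u0.
Qed.

Lemma pdens0 b u : u <= 0 -> pdens b u = 0.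
Proof.
by move=> u0; rewrite /pdens indicE memNset ?mulr0//= in_itv/= andbT; apply/negP; rewrite -leNgt.
Qed.

Lemma pdens_ge0 b u : 0 <= b -> 0 <= pdens b u.
Proof. by move=> b0; rewrite !mulr_ge0 ?powR_ge0. Qed.

Lemma measurable_pdens b : measurable_fun setT (pdens b).
Proof.
apply: measurable_funM; last exact: measurable_indic.
apply: measurable_funM => //.
apply: measurable_fun_powRl.
exact: measurable_funD.
Qed.

Lemma cvg_pdens_tail b : 0 < b -> - (1 + u) `^ (- b) @[u --> +oo] --> (0 : R).
Proof.
move=> b0; rewrite -oppr0; apply: cvgN.
apply: (@cvg_comp _ _ _ (fun u => 1 + u) (@powR R ^~ (- b)) _ +oo); last exact: cvg_powRN.
apply/cvgryPge => A; near=> u; rewrite -lerBlDl.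
near: u; apply: nbhs_pinfty_ge; exact: num_real.
Unshelve. all: by end_near. Qed.

Lemma pdens_tail b x : 0 < b -> 0 <= x ->
  (\int[mu]_u (pdens b u * \1_(`]x, +oo[%classic) u)%:E = ((1 + x) `^ (- b))%:E)%E.
Proof.
move=> b0 x0.
transitivity (\int[mu]_(u in `]x, +oo[) (b * (1 + u) `^ (- b - 1))%:E)%E.
  rewrite [RHS]integral_mkcond; apply: eq_integral => u _.
  rewrite patchE indicE; case: ifPn => [|_]; last by rewrite mulr0.
  rewrite inE/= in_itv/= andbT => xu; rewrite mulr1 pdensE//.
  exact: le_lt_trans xu.
have eD : exhausts `]x, +oo[%classic (fun n => x + invn n) (fun n => x + natn n).
  exact: exhausts_gt.
have dG u : `]x, +oo[%classic u ->
    is_derive u 1 (fun u => - (1 + u) `^ (- b)) (b * (1 + u) `^ (- b - 1)).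
  rewrite /= in_itv/= andbT => xu.
  have u1 : 0 < 1 + u by rewrite ltr_pwDl// ltW// (le_lt_trans x0).
  by have := is_deriveN (is_derive_powRD (- b) u1); rewrite mulNr opprK.
have cg u : `]x, +oo[%classic u -> {for u, continuous (fun u => b * (1 + u) `^ (- b - 1))}.
  rewrite /= in_itv/= andbT => xu.
  have u1 : 0 < 1 + u by rewrite ltr_pwDl// ltW// (le_lt_trans x0).
  apply: cvgM; first exact: cvg_cst.
  exact: (is_derive_cont (is_derive_powRD (- b - 1) u1)).
have Gl0 : (fun u => - (1 + u) `^ (- b)) (x + invn n) @[n --> \oo] --> - (1 + x) `^ (- b).
  have x1 : 0 < 1 + x by rewrite ltr_pwDl.
  apply: (@continuous_cvg _ _ _ _ _ (fun n => x + invn n) (fun u => - (1 + u) `^ (- b))).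
    by apply: cvgN; exact: (is_derive_cont (is_derive_powRD (- b) x1)).
  rewrite -[X in _ --> X]addr0; apply: cvgD; [exact: cvg_cst|exact: cvg_invn].
have Gl1 : (fun u => - (1 + u) `^ (- b)) (x + natn n) @[n --> \oo] --> (0 : R).
  apply: (@cvg_comp _ _ _ (fun n => x + natn n) (fun u => - (1 + u) `^ (- b)) _ +oo).
    apply/cvgryPge => A; near=> n; rewrite -lerBlDl.
    by near: n; have /cvgryPge := @cvg_natn R; exact.
  exact: cvg_pdens_tail.
rewrite (exhausts_FTC_ge0 eD dG cg Gl0 Gl1) ?sub0r ?opprK// => u.
rewrite /= in_itv/= andbT => xu.
by rewrite mulr_ge0 ?powR_ge0 // ltW.
Unshelve. all: by end_near. Qed.

Lemma integrable_pdens b : 0 < b -> mu.-integrable setT (EFin \o pdens b).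
Proof.
move=> b0; apply/integrableP; split; first by apply/measurable_EFinP; exact: measurable_pdens.
under eq_integral => u _.
  rewrite /= ger0_norm; last by rewrite pdens_ge0// ltW.
  rewrite (_ : pdens b u = pdens b u * \1_(`]0, +oo[%classic) u); last first.
    by rewrite /pdens -mulrA indicE; case: (u \in _); rewrite ?mulr1 ?mulr0.
  over.
by rewrite pdens_tail// ltry.
Qed.

Lemma measurable_powRT r : measurable_fun setT (@powR R ^~ r).
Proof. exact: measurable_powR. Qed.

(** From [u^r <= (1 + u)^r], the weighted density is below a density of the same family with
    parameter [b - r]; the constant restores the normalisation. *)
Lemma pdens_moment_le b r u : 0 <= b -> 0 <= r < b ->
  pdens b u * u `^ r <= b / (b - r) * pdens (b - r) u.
Proof.
move=> b0 /andP[r0 rb].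
have [u0|u0] := leP u 0; first by rewrite !pdens0// mulr0 mul0r.
rewrite !pdensE// mulrA -[X in _ <= X * _]mulrA mulVf ?subr_eq0 ?gt_eqF// mulr1.
rewrite -mulrA ler_wpM2l//.
have -> : - (b - r) - 1 = (- b - 1) + r by ring.
rewrite [leRHS]powRD; last by rewrite (@gt_eqF _ _ (1 + u) 0) ?implybT// addr_gt0.
rewrite ler_wpM2l ?powR_ge0//; apply: ge0_ler_powR => //; rewrite ?nnegrE.
- exact: ltW.
- by rewrite addr_ge0// ltW.
- by rewrite lerDr.
Qed.

Lemma integrable_pdens_moment b r : 0 <= r < b ->
  mu.-integrable setT (EFin \o (fun u => pdens b u * u `^ r)).
Proof.
move=> /andP[r0 rb]; have b0 : 0 < b := le_lt_trans r0 rb.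
apply: (@integrable_dom _ _ _ mu setT (fun u => pdens b u * u `^ r) (fun u => b / (b - r) * pdens (b - r) u)) => //.
- by apply: measurable_funM; [exact: measurable_pdens|exact: measurable_powRT].
- under [X in integrable _ _ X]eq_fun do rewrite /= EFinM.
  by apply: integrableZl => //; apply: integrable_pdens; rewrite subr_gt0.
- move=> u _; rewrite ger0_norm; last by rewrite mulr_ge0 ?powR_ge0// pdens_ge0// ltW.
  by rewrite pdens_moment_le ?r0// ltW.
Qed.

End pareto.

Section spec1.
Context {R : realType}.
Implicit Types a b r s t u w x z : R.
Local Notation mu := (@lebesgue_measure R).

Definition cauchy_cov a b t : R := (1 + `|t| `^ a) `^ (- b).

Definition sker z w : R := sin (w * z) / w.

(* The Fourier transform of the indicator of |t| < z is 2 sin (w z) / w; mixing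
   over z = u^(1/a) gives a formula for the spectral density which converges
   absolutely even when the covariance is not integrable. *)
Definition spec1 a b w : R := pi^-1 * \int[mu]_u (pdens b u * sker (u `^ a^-1) w).

Lemma measurable_cauchy_cov a b : measurable_fun setT (cauchy_cov a b).
Proof.
apply: measurable_fun_powRl; apply: measurable_funD => //.
by apply: measurable_fun_powRl; exact: normr_measurable.
Qed.

Lemma cauchy_cov_ge0 a b t : 0 <= cauchy_cov a b t.
Proof. exact: powR_ge0. Qed.

Lemma cauchy_cov_le1 a b t : 0 < b -> cauchy_cov a b t <= 1.
Proof.
move=> b0; have t1 : 0 < 1 + `|t| `^ a by rewrite ltr_pwDl ?powR_ge0.
rewrite /cauchy_cov powRN invf_le1 ?powR_gt0//.
rewrite -[X in X <= _](powRr0 (1 + `|t| `^ a)); apply: ler_powR => //.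
  by rewrite lerDl powR_ge0.
exact: ltW.
Qed.

Lemma measurable_sker2 : measurable_fun setT (fun p : R * R => sker p.1 p.2).
Proof.
apply: measurable_funM.
  apply: (measurableT_comp measurable_sin).
  by apply: measurable_funM; [exact: measurable_snd|exact: measurable_fst].
by apply: (measurableT_comp measurable_invr); exact: measurable_snd.
Qed.

Lemma measurable_sker_powR a :
  measurable_fun setT (fun p : R * R => sker (p.1 `^ a) p.2).
Proof.
apply: (@measurableT_comp _ _ _ _ _ _ (fun p : R * R => sker p.1 p.2) _
  (fun p : R * R => (p.1 `^ a, p.2)) measurable_sker2).
apply: measurable_fun_pair; last exact: measurable_snd.
by apply: measurable_fun_powRl; exact: measurable_fst.
Qed.

Lemma sker_le z w s : 0 <= z -> 0 <= s <= 1 -> s != 1 ->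
  `|sker z w| <= z `^ s * `|w| `^ (s - 1).
Proof. exact: abs_sin_div_le. Qed.

Section fixed_parameters.
Variables a b : R.
Hypotheses (a0 : 0 < a) (b0 : 0 < b).

(* The exponents for which |sin y| <= |y|^s makes u^(s/a) integrable against
   pdens, while |w|^(s-1) remains locally integrable. *)
Definition sub_exponent s := [&& 0 < s, s < 1 & s < a * b].

Lemma sub_exponentP : exists s, sub_exponent s.
Proof.
exists (Num.min 1 (a * b) / 2); rewrite /sub_exponent.
have m0 : 0 < Num.min 1 (a * b) by rewrite lt_min ltr01 mulr_gt0.
have mm : Num.min 1 (a * b) / 2 < Num.min 1 (a * b).
  by rewrite ltr_pdivrMr// ltr_pMr// ltr1n.
rewrite divr_gt0//=; move: mm; rewrite [X in _ < X -> _]minEle.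
by case: (leP 1 (a * b)) => [h mm|h mm]; rewrite mm/=; [exact: lt_le_trans mm h|rewrite andbT; exact: lt_trans mm h].
Qed.

Lemma integrable_powRa s : sub_exponent s ->
  mu.-integrable setT (EFin \o (fun u => pdens b u * u `^ (a^-1 * s))).
Proof.
move=> /and3P[s0 s1 sab]; apply: integrable_pdens_moment.
by rewrite mulr_ge0 ?invr_ge0 ?ltW//= mulrC ltr_pdivrMr// mulrC.
Qed.

Lemma spec1_ker_le s u w : sub_exponent s ->
  `|pdens b u * sker (u `^ a^-1) w| <= (pdens b u * u `^ (a^-1 * s)) * `|w| `^ (s - 1).
Proof.
move=> /and3P[s0 s1 sab].
rewrite normrM (ger0_norm (pdens_ge0 u (ltW b0))) -mulrA.
rewrite ler_wpM2l ?(pdens_ge0 u (ltW b0))// powRrM.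
by apply: sker_le; [exact: powR_ge0|rewrite !ltW|rewrite lt_eqF].
Qed.

Lemma measurable_spec1_ker w : measurable_fun setT (fun u => pdens b u * sker (u `^ a^-1) w).
Proof.
apply: measurable_funM; first exact: measurable_pdens.
apply: measurable_funM => //; apply: (measurableT_comp measurable_sin).
by apply: measurable_funM => //; exact: measurable_powRT.
Qed.

Lemma integrable_spec1_ker w :
  mu.-integrable setT (EFin \o (fun u => pdens b u * sker (u `^ a^-1) w)).
Proof.
have [s hs] := sub_exponentP.
apply: (@integrable_dom _ _ _ mu setT _ (fun u => (pdens b u * u `^ (a^-1 * s)) * `|w| `^ (s - 1))) => //.
- exact: measurable_spec1_ker.
- under [X in integrable _ _ X]eq_fun do rewrite /= mulrC EFinM.
  by apply: integrableZl => //; exact: integrable_powRa.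
- by move=> u _; exact: spec1_ker_le.
Qed.

(** Since [s - 1 > -1], the bound is integrable near 0, so that products with rapidly decreasing
    functions are integrable. *)
Lemma spec1_le s : sub_exponent s ->
  exists2 M, 0 <= M & forall w, `|spec1 a b w| <= M * `|w| `^ (s - 1).
Proof.
move=> hs; exists (pi^-1 * \int[mu]_u (pdens b u * u `^ (a^-1 * s))).
  rewrite mulr_ge0 ?invr_ge0 ?pi_ge0//; apply: Rintegral_ge0 => u _.
  by rewrite mulr_ge0 ?powR_ge0// pdens_ge0// ltW.
move=> w; rewrite /spec1 normrM ger0_norm ?invr_ge0 ?pi_ge0//.
rewrite -mulrA ler_wpM2l ?invr_ge0 ?pi_ge0//.
apply: (le_trans (le_normr_Rintegral _ (integrable_spec1_ker w))) => //.
rewrite -RintegralZr//; last exact: integrable_powRa.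
apply: le_Rintegral => //.
- exact: integrable_norm (integrable_spec1_ker w).
- under [X in integrable _ _ X]eq_fun do rewrite /= mulrC EFinM.
  by apply: integrableZl => //; exact: integrable_powRa.
- by move=> u _; exact: spec1_ker_le.
Qed.

Lemma spec1N w : spec1 a b (- w) = spec1 a b w.
Proof.
rewrite /spec1; congr (_ * _); apply: eq_Rintegral => u _.
by rewrite /sker mulNr sinN invrN mulrNN.
Qed.

Lemma continuous_spec1 w : w != 0 -> {for w, continuous (spec1 a b)}.
Proof.
move=> w0; apply: cvgM; first exact: cvg_cst.
(* Points within [|w| / 2] of [w] have absolute value at least [|w| / 2], which bounds the kernel by
   [(|w| / 2)^-1] uniformly in [u]. *)
have aw : 0 < `|w| / 2 by rewrite divr_gt0// normr_gt0.
have Iw x : `]w - `|w| / 2, w + `|w| / 2[%classic x -> `|w| / 2 <= `|x|.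
  rewrite /= in_itv/= -ltr_distl => xw.
  have : `|w| <= `|x| + `|x - w| by rewrite -[X in `|X| <= _](subKr x) (le_trans (ler_normB _ _)).
  by move: xw; lra.
have I0 : w \in `]w - `|w| / 2, w + `|w| / 2[%classic.
  by rewrite inE/= in_itv/= ltrBlDr ltrDl aw.
apply: (@continuity_under_integral R _ _ mu
  (fun w u => pdens b u * sker (u `^ a^-1) w) setT _ (w - `|w| / 2) (w + `|w| / 2)
  _ _ (fun u => pdens b u * (`|w| / 2)^-1)) => //.
- by move=> x _; exact: integrable_spec1_ker.
- apply: aeW => u _ x; rewrite inE => /Iw xw.
  have x0 : x != 0 by rewrite -normr_gt0 (lt_le_trans aw).
  apply: cvgM; first exact: cvg_cst.
  apply: cvgM; last exact: inv_continuous.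
  apply: continuous_comp; last exact: continuous_sin.
  by apply: cvgM; [exact: cvg_id|exact: cvg_cst].
- under [X in integrable _ _ X]eq_fun do rewrite /= mulrC EFinM.
  by apply: integrableZl => //; exact: integrable_pdens.
- move=> x /Iw xw; apply: aeW => u _; rewrite normrM (ger0_norm (pdens_ge0 u (ltW b0))).
  rewrite ler_wpM2l ?(pdens_ge0 u (ltW b0))// /sker normrM normfV.
  have x0 : 0 < `|x| := lt_le_trans aw xw.
  rewrite (@le_trans _ _ (`|x|^-1))//.
    by rewrite ler_piMl ?invr_ge0// sin_max.
  by rewrite lef_pV2.
Qed.

Lemma measurable_spec1 : measurable_fun setT (spec1 a b).
Proof.
rewrite -(setvU [set (0:R)]); apply/measurable_funU => //.
  exact: measurableC.
split; last exact: measurable_fun_set1.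
apply: open_cts_measurable; first by apply/closed_openC; apply: accessible_closed_set1; exact/hausdorff_accessible/order_hausdorff.
by move=> x /= /eqP x0; exact: continuous_spec1.
Qed.

End fixed_parameters.
End spec1.

(** * Fourier transforms of symmetric windows *)

Section sinc.
Context {R : realType}.
Implicit Types a b r s t u w x z : R.
Local Notation mu := (@lebesgue_measure R).

Definition wdw z t : R := \1_(`]- z, z[%classic) t.

Lemma wdwE z t : wdw z t = (`|t| < z)%R%:R.
Proof. by rewrite /wdw indicE mem_setE in_itv/= ltr_norml. Qed.

Lemma measurable_wdw z : measurable_fun setT (wdw z).
Proof. exact: measurable_indic. Qed.

Lemma measurable_wdw2 : measurable_fun setT (fun p : R * R => wdw p.1 p.2).
Proof.
under eq_fun do rewrite wdwE.
rewrite (_ : (fun _ => _) = \1_[set p : R * R | `|p.2| < p.1]); last first.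
  by apply/funext => p; rewrite indicE mem_setE.
apply: measurable_indic.
have : measurable_fun setT (fun p : R * R => `|p.2| < p.1).
  apply: measurable_fun_ltr; last exact: measurable_fst.
  by apply: (measurableT_comp (@normr_measurable R setT)); exact: measurable_snd.
by move=> /(_ measurableT [set true] I); rewrite setTI.
Qed.

Lemma integrable_wdw z : mu.-integrable setT (EFin \o wdw z).
Proof. exact: integrable_indic_itv. Qed.

Let FTC_wdw (G g : R -> R) z : 0 < z -> (forall x, is_derive x 1 G (g x)) ->
  (forall x, {for x, continuous g}) ->
  \int[mu]_t (wdw z t * g t) = G z - G (- z).
Proof.
move=> z0 dG cg.
transitivity (\int[mu]_(t in `]- z, z[) g t).
  rewrite [RHS]Rintegral_mkcond; apply: eq_Rintegral => t _.
  by rewrite patchE /wdw indicE; case: (t \in _); rewrite ?mul1r ?mul0r.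
rewrite /Rintegral -(@integral_itv_bndoo _ _ _ _ true false); last first.
  apply/measurable_EFinP; apply: measurable_funS measurableT _ _ => //.
  exact: continuous_measurable_fun.
rewrite (@continuous_FTC2 _ _ G)//.
- by rewrite gtrN.
- exact: continuous_subspaceT.
- have cG x : {for x, continuous G} := is_derive_cont (dG x).
  split.
  + by move=> x _; case: (dG x).
  + by apply: cvg_at_right_filter; exact: cG.
  + by apply: cvg_at_left_filter; exact: cG.
- by move=> x _; rewrite derive1E (@derive_val _ _ _ _ _ _ _ (dG x)).
Qed.

Let derive_scale (F dF : R -> R) w x : (forall x, is_derive x 1 F (dF x)) ->
  is_derive x 1 (fun t => F (w * t)) (w * dF (w * x)).
Proof.
move=> hF; rewrite mulrC.
have d1 : is_derive x 1 (fun t : R => w * t) w.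
  rewrite -[X in is_derive _ _ _ X]mulr1.
  exact: is_deriveZ.
exact: (@is_derive1_comp R F (fun t => w * t) x _ _ (hF _) d1).
Qed.

Lemma integral_wdw_cos z w : 0 <= z -> w != 0 ->
  \int[mu]_t (wdw z t * cos (w * t)) = 2 * sker z w.
Proof.
rewrite le_eqVlt => /orP[/eqP<- w0|z0 w0].
  rewrite /sker mulr0 sin0 mul0r mulr0.
  rewrite (_ : (fun t => _) = cst 0) ?Rintegral_cst ?mul0r//.
  by apply/funext => t; rewrite wdwE ltNge normr_ge0 mul0r.
have dG x : is_derive x 1 (fun t => w^-1 * sin (w * t)) (cos (w * x)).
  have := is_deriveZ (w^-1) (derive_scale w x (@is_derive_sin R)).
  by rewrite scalerA mulVf// scale1r.
rewrite (FTC_wdw z0 dG)//.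
- by rewrite /sker (mulrN w z) sinN; ring.
- move=> x; apply: continuous_comp; last exact: continuous_cos.
  by apply: cvgM; [exact: cvg_cst|exact: cvg_id].
Qed.

Lemma integral_wdw_sin z w : \int[mu]_t (wdw z t * sin (w * t)) = 0.
Proof.
have [z0|z0] := leP z 0.
  rewrite (_ : (fun t => _) = cst 0) ?Rintegral_cst ?mul0r//.
  by apply/funext => t; rewrite wdwE ltNge (le_trans z0) ?normr_ge0 ?mul0r.
have [->|w0] := eqVneq w 0.
  rewrite (_ : (fun t => _) = cst 0) ?Rintegral_cst ?mul0r//.
  by apply/funext => t; rewrite mul0r sin0 mulr0.
have dG x : is_derive x 1 (fun t => (- w^-1) * cos (w * t)) (sin (w * x)).
  have := is_deriveZ (- w^-1) (derive_scale w x (@is_derive_cos R)).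
  by rewrite scalerA mulNr mulVf// scaleN1r opprK.
rewrite (FTC_wdw z0 dG)//.
- by rewrite mulrN cosN subrr.
- move=> x; apply: continuous_comp; last exact: continuous_sin.
  by apply: cvgM; [exact: cvg_cst|exact: cvg_id].
Qed.

End sinc.

(** * Transfer of the Fourier transform from the covariance to the density *)

Section parseval.
Context {R : realType}.
Implicit Types s t u w x z : R.
Local Notation mu := (@lebesgue_measure R).
Variables a b : R.
Hypotheses (a0 : 0 < a) (b0 : 0 < b).

Lemma lt_powRV x u : 0 <= x -> 0 < u -> (x < u `^ a^-1) = (x `^ a < u).
Proof.
move=> x0 u0.
have uE : (u `^ a^-1) `^ a = u by rewrite -powRrM mulVf ?gt_eqF// powRr1// ltW.
rewrite -[in RHS]uE; apply/idP/idP => h.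
  by apply: gt0_ltr_powR; rewrite ?nnegrE ?powR_ge0.
rewrite ltNge; apply/negP => h'; move: h; apply/negP; rewrite -leNgt.
by apply: ge0_ler_powR; rewrite ?nnegrE ?powR_ge0// ltW.
Qed.

Let mixker t u := pdens b u * wdw (u `^ a^-1) t.

Let mixker_ge0 t u : 0 <= mixker t u.
Proof. by rewrite mulr_ge0 ?wdwE// pdens_ge0// ltW. Qed.

Let measurable_mixker : measurable_fun setT (fun p : R * R => mixker p.1 p.2).
Proof.
apply: measurable_funM.
  by apply: (measurableT_comp (@measurable_pdens R b)); exact: measurable_snd.
apply: (@measurableT_comp _ _ _ _ _ _ (fun p : R * R => wdw p.1 p.2) _
  (fun p : R * R => (p.2 `^ a^-1, p.1)) (@measurable_wdw2 R)).
apply: measurable_fun_pair; last exact: measurable_fst.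
by apply: measurable_fun_powRl; exact: measurable_snd.
Qed.

(** For [u > 0] the condition [|t| < u^(1/a)] reads [|t|^a < u], so the mixture is the tail of
    [pdens b] at [|t|^a]. *)
Lemma cauchy_cov_mixE t : (\int[mu]_u (mixker t u)%:E = (cauchy_cov a b t)%:E)%E.
Proof.
rewrite /cauchy_cov -pdens_tail// ?powR_ge0//; apply: eq_integral => u _.
congr EFin; have [u0|u0] := leP u 0; first by rewrite /mixker !pdens0 ?mul0r.
by rewrite /mixker; congr (_ * _); rewrite wdwE lt_powRV// indicE mem_setE in_itv/= andbT.
Qed.

Let integrable_mixker t : mu.-integrable setT (EFin \o mixker t).
Proof.
apply/integrableP; split.
  apply/measurable_EFinP; exact: (measurableT_comp (f := fun p : R * R => mixker p.1 p.2) measurable_mixker (measurable_pair1 t)).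
under eq_integral do rewrite /= ger0_norm ?mixker_ge0//.
by rewrite cauchy_cov_mixE ltry.
Qed.

(** The integral over [u] of the absolute value of the joint integrand is exactly
    [cauchy_cov a b t * |h t|], so the integrability assumed of the left-hand side is the condition
    of Fubini's theorem. *)
Lemma integral_cauchy_mix (h : R -> R) : measurable_fun setT h ->
  mu.-integrable setT (EFin \o (fun t => cauchy_cov a b t * h t)) ->
  (forall z, mu.-integrable setT (EFin \o (fun t => wdw z t * h t))) ->
  \int[mu]_t (cauchy_cov a b t * h t) =
  \int[mu]_u (pdens b u * \int[mu]_t (wdw (u `^ a^-1) t * h t)).
Proof.
move=> mh ich iwh.
transitivity (\int[mu]_t \int[mu]_u (mixker t u * h t)).
  apply: eq_Rintegral => t _; rewrite RintegralZr//; congr (_ * _).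
  by rewrite /Rintegral cauchy_cov_mixE.
rewrite (@Rfubini _ _ _ _ _ mu mu _ (fun t => `|cauchy_cov a b t * h t|)).
- apply: eq_Rintegral => u _; rewrite -RintegralZl//.
  by apply: eq_Rintegral => t _; rewrite /mixker mulrA.
- apply: measurable_funM; first exact: measurable_mixker.
  by apply: (measurableT_comp mh); exact: measurable_fst.
- exact: integrable_norm ich.
- move=> t; rewrite normrM EFinM (ger0_norm (cauchy_cov_ge0 _ _ _)) -cauchy_cov_mixE.
  under eq_integral do rewrite /= normrM (ger0_norm (mixker_ge0 _ _)) EFinM.
  rewrite integralZr//; exact: integrable_mixker.
Qed.

Section bounded_integrand.
Hypothesis ic : mu.-integrable setT (EFin \o cauchy_cov a b).

Let step (h : R -> R) (mh : measurable_fun setT h) (h1 : forall t, `|h t| <= 1) :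
  \int[mu]_t (cauchy_cov a b t * h t) =
  \int[mu]_u (pdens b u * \int[mu]_t (wdw (u `^ a^-1) t * h t)).
Proof.
apply: integral_cauchy_mix => //.
- apply: (@integrable_dom _ _ _ mu setT _ (cauchy_cov a b)) => //.
    by apply: measurable_funM => //; exact: measurable_cauchy_cov.
  move=> t _; rewrite normrM (ger0_norm (cauchy_cov_ge0 _ _ _)).
  by rewrite ler_piMr// cauchy_cov_ge0.
- move=> z; apply: (@integrable_dom _ _ _ mu setT _ (wdw z)) => //.
  + by apply: measurable_funM => //; exact: measurable_wdw.
  + exact: integrable_wdw.
  + by move=> t _; rewrite normrM (@ger0_norm _ (wdw z t)) ?wdwE// ler_piMr.
Qed.

Lemma cauchy_cov_cos w : w != 0 ->
  \int[mu]_t (cauchy_cov a b t * cos (w * t)) = 2 * pi * spec1 a b w.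
Proof.
move=> w0; rewrite step.
- under eq_Rintegral do rewrite integral_wdw_cos ?powR_ge0// mulrCA.
  rewrite RintegralZl//; last exact: integrable_spec1_ker.
  by rewrite /spec1 mulrA mulfK// gt_eqF// pi_gt0.
- by apply: (measurableT_comp measurable_cos); exact: measurable_funM.
- by move=> t; exact: cos_max.
Qed.

Lemma cauchy_cov_sin w : \int[mu]_t (cauchy_cov a b t * sin (w * t)) = 0.
Proof.
rewrite step.
- under eq_Rintegral do rewrite integral_wdw_sin mulr0.
  by rewrite Rintegral_cst// mul0r.
- by apply: (measurableT_comp measurable_sin); exact: measurable_funM.
- by move=> t; exact: sin_max.
Qed.

End bounded_integrand.

Section schwartz_integrand.
Variable phi : R -> R.
Hypothesis iphi : mu.-integrable setT (EFin \o phi).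

Let mphi := integrable_mf iphi.

(** For one fixed window, moves the transform with kernel [tr] (cosine or sine) from [phi] to the
    window. The joint integrand is dominated by [wdw z t * |phi w|], a product of integrable
    functions. *)
Let inner (tr : R -> R) (mtr : measurable_fun setT tr) (tr1 : forall t, `|tr t| <= 1) z :
  \int[mu]_t (wdw z t * \int[mu]_w (tr (w * t) * phi w)) =
  \int[mu]_w (phi w * \int[mu]_t (wdw z t * tr (w * t))) /\
  measurable_fun setT (fun w => phi w * \int[mu]_t (wdw z t * tr (w * t))).
Proof.
have itr t : mu.-integrable setT (EFin \o (fun w => tr (w * t) * phi w)).
  apply: (@integrable_dom _ _ _ mu setT _ (fun w => `|phi w|)) => //.
  - apply: measurable_funM => //; apply: (measurableT_comp mtr).
    exact: measurable_funM.
  - exact: integrable_norm.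
  - by move=> w _; rewrite normrM ler_piMl.
have itr2 w : mu.-integrable setT (EFin \o (fun t => wdw z t * tr (w * t))).
  apply: (@integrable_dom _ _ _ mu setT _ (wdw z)) => //.
  + apply: measurable_funM => //; first exact: measurable_wdw.
    by apply: (measurableT_comp mtr); exact: measurable_funM.
  + exact: integrable_wdw.
  + by move=> t _; rewrite normrM (@ger0_norm _ (wdw z t)) ?wdwE// ler_piMr.
have mf : measurable_fun setT (fun p : R * R => wdw z p.1 * (tr (p.2 * p.1) * phi p.2)).
  apply: measurable_funM.
    by apply: (measurableT_comp (measurable_wdw z)); exact: measurable_fst.
  apply: measurable_funM.
    apply: (measurableT_comp mtr).
    by apply: measurable_funM; [exact: measurable_snd|exact: measurable_fst].
  by apply: (measurableT_comp mphi); exact: measurable_snd.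
have dom t w : `|wdw z t * (tr (w * t) * phi w)| <= wdw z t * `|phi w|.
  by rewrite normrM (@ger0_norm _ (wdw z t)) ?wdwE// ler_wpM2l// normrM ler_piMl.
have [H1 _ H3] := @Rfubini_prod _ _ _ _ _ mu mu (fun t w => wdw z t * (tr (w * t) * phi w))
  (wdw z) (fun w => `|phi w|) mf (integrable_wdw z) (integrable_norm iphi) dom.
have E w : \int[mu]_t (wdw z t * (tr (w * t) * phi w)) =
    phi w * \int[mu]_t (wdw z t * tr (w * t)).
  by rewrite -RintegralZl//; apply: eq_Rintegral => t _; ring.
split; last by move: H3; under eq_fun do rewrite E.
transitivity (\int[mu]_w \int[mu]_t (wdw z t * (tr (w * t) * phi w))); last first.
  by apply: eq_Rintegral => w _; exact: E.
by rewrite -H1; apply: eq_Rintegral => t _; rewrite -RintegralZl.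
Qed.

Let iwdw (h : R -> R) : mu.-integrable setT (EFin \o h) ->
  mu.-integrable setT (EFin \o (fun t => cauchy_cov a b t * h t)) /\
  forall z, mu.-integrable setT (EFin \o (fun t => wdw z t * h t)).
Proof.
move=> ih; have mh := integrable_mf ih; split=> [|z].
- apply: (@integrable_dom _ _ _ mu setT _ (fun t => `|h t|)) => //.
  + by apply: measurable_funM => //; exact: measurable_cauchy_cov.
  + exact: integrable_norm.
  + move=> t _; rewrite normrM (ger0_norm (cauchy_cov_ge0 _ _ _)).
    by rewrite ler_piMl// cauchy_cov_le1.
- apply: (@integrable_dom _ _ _ mu setT _ (fun t => `|h t|)) => //.
  + by apply: measurable_funM => //; exact: measurable_wdw.
  + exact: integrable_norm.
  + by move=> t _; rewrite normrM ler_piMl// wdwE; case: (_ < _); rewrite ?normr1 ?normr0.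
Qed.

Lemma parseval_sin :
  mu.-integrable setT (fun t => (\int[mu]_w (sin (w * t) * phi w))%:E) ->
  \int[mu]_t (cauchy_cov a b t * \int[mu]_w (sin (w * t) * phi w)) = 0.
Proof.
move=> ih; have [i1 i2] := iwdw ih; rewrite integral_cauchy_mix//; last exact: integrable_mf ih.
under eq_Rintegral => u _.
  rewrite (inner measurable_sin (@sin_max R) _).1.
  under eq_Rintegral do rewrite integral_wdw_sin mulr0.
  rewrite Rintegral_cst// mul0r mulr0.
  over.
by rewrite Rintegral_cst// mul0r.
Qed.

(** Three interchanges: [t] with [u] by the mixture, [t] with [w] inside each window, and finally
    [u] with [w]. The last one uses the bound [u^(s/a) |w|^(s-1)], which separates the variables and
    is integrable on both sides precisely for a [sub_exponent]. *)
Lemma parseval_cos s : sub_exponent a b s ->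
  mu.-integrable setT (EFin \o (fun w => `|phi w| * `|w| `^ (s - 1))) ->
  mu.-integrable setT (fun t => (\int[mu]_w (cos (w * t) * phi w))%:E) ->
  mu.-integrable setT (EFin \o (fun w => spec1 a b w * phi w)) /\
  \int[mu]_t (cauchy_cov a b t * \int[mu]_w (cos (w * t) * phi w)) =
  2 * pi * \int[mu]_w (spec1 a b w * phi w).
Proof.
move=> hs isphi ih; have [i1 i2] := iwdw ih.
have isp : mu.-integrable setT (EFin \o (fun w => spec1 a b w * phi w)).
  have [M M0 HM] := spec1_le a0 b0 hs.
  apply: (@integrable_dom _ _ _ mu setT _ (fun w => M * (`|phi w| * `|w| `^ (s - 1)))) => //.
  - by apply: measurable_funM => //; exact: measurable_spec1.
  - under [X in integrable _ _ X]eq_fun do rewrite /= EFinM.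
    exact: integrableZl.
  - move=> w _; rewrite normrM mulrCA mulrC ler_wpM2l//.
split => //; rewrite integral_cauchy_mix//; last exact: integrable_mf ih.
have mk u : measurable_fun setT (fun w => phi w * (2 * sker (u `^ a^-1) w)).
  apply: measurable_funM => //; apply: measurable_funM => //.
  exact: (measurableT_comp (f := fun p : R * R => sker (p.1 `^ a^-1) p.2)
    (@measurable_sker_powR R a^-1) (measurable_pair1 u)).
transitivity (\int[mu]_u \int[mu]_w (pdens b u * (phi w * (2 * sker (u `^ a^-1) w)))).
  apply: eq_Rintegral => u _.
  have [u0|u0] := leP u 0.
    rewrite pdens0// mul0r; under eq_Rintegral do rewrite mul0r.
    by rewrite Rintegral_cst// mul0r.
  rewrite RintegralZl//; last first.
    apply: (@integrable_dom _ _ _ mu setT _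
      (fun w => (2 * (u `^ a^-1) `^ s) * (`|phi w| * `|w| `^ (s - 1)))) => //.
      exact: mk.
      under [X in integrable _ _ X]eq_fun do rewrite /= EFinM.
      exact: integrableZl.
    move=> w _; rewrite !normrM (@ger0_norm _ 2)//.
    rewrite [leRHS](_ : _ = `|phi w| * (2 * ((u `^ a^-1) `^ s * `|w| `^ (s - 1)))); last by ring.
    rewrite ler_wpM2l// ler_wpM2l//.
    move/and3P : hs => [s0 s1 _].
    by rewrite -normrM; apply: sker_le; [exact: powR_ge0|rewrite !ltW|rewrite lt_eqF].
  congr (_ * _); have [H1 H2] := inner measurable_cos (@cos_max R) (u `^ a^-1).
  rewrite H1; apply: Rintegral_neq0 => // w w0.
  by rewrite integral_wdw_cos ?powR_ge0.
have mf : measurable_fun setT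
    (fun p : R * R => pdens b p.1 * (phi p.2 * (2 * sker (p.1 `^ a^-1) p.2))).
  apply: measurable_funM.
    by apply: (measurableT_comp (@measurable_pdens R b)); exact: measurable_fst.
  apply: measurable_funM.
    by apply: (measurableT_comp mphi); exact: measurable_snd.
  by apply: measurable_funM => //; exact: measurable_sker_powR.
have ig : mu.-integrable setT (EFin \o (fun w => 2 * (`|phi w| * `|w| `^ (s - 1)))).
  under [X in integrable _ _ X]eq_fun do rewrite /= EFinM.
  exact: integrableZl.
have dom u w : `|pdens b u * (phi w * (2 * sker (u `^ a^-1) w))| <=
    pdens b u * u `^ (a^-1 * s) * (2 * (`|phi w| * `|w| `^ (s - 1))).
  have := spec1_ker_le b0 u w hs; rewrite !(normrM (pdens b u)) !(normrM (phi w)).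
  rewrite (normrM 2) (@ger0_norm _ 2)// => H.
  rewrite [leLHS](_ : _ = (2 * `|phi w|) * (`|pdens b u| * `|sker (u `^ a^-1) w|)); last by ring.
  rewrite [leRHS](_ : _ = (2 * `|phi w|) * (pdens b u * u `^ (a^-1 * s) * `|w| `^ (s - 1))); last by ring.
  by rewrite ler_wpM2l// mulr_ge0.
have [-> _ _] := @Rfubini_prod _ _ _ _ _ mu mu
  (fun u w => pdens b u * (phi w * (2 * sker (u `^ a^-1) w)))
  _ _ mf (integrable_powRa a0 hs) ig dom.
rewrite -RintegralZl//; apply: eq_Rintegral => w _.
rewrite /spec1 [in RHS](_ : _ * _ = (2 * phi w) * \int[mu]_u (pdens b u * sker (u `^ a^-1) w)); last first.
  set I := Rintegral _ _ _.
  transitivity ((pi * pi^-1) * (2 * phi w * I)); first by ring.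
  by rewrite divff ?mul1r// gt_eqF// pi_gt0.
rewrite -RintegralZl//; last exact: integrable_spec1_ker.
by apply: eq_Rintegral => u _; ring.
Qed.

End schwartz_integrand.
End parseval.

(** * Polynomial-exponential test functions *)

Section beta_kernel.
Context {R : realType}.
Implicit Types r s t u w x z : R.
Local Notation mu := (@lebesgue_measure R).

(** The beta prime density with parameters [r] and 1, up to the factor [r]. It behaves like
    [x^(r-1)] at 0 and [x^(-2)] at infinity, and has the elementary primitive
    [(x / (1 + x))^r / r]. *)
Definition betaker r x : R := x `^ (r - 1) * (1 + x) `^ (- r - 1).

Lemma betaker_ge0 r x : 0 <= betaker r x.
Proof. by rewrite mulr_ge0 ?powR_ge0. Qed.

Let betaprim r x : R := r^-1 * (x / (1 + x)) `^ r.

Let derive_ratio x : 0 < x -> is_derive x 1 (fun u : R => u / (1 + u)) ((1 + x) ^- 2).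
Proof.
move=> x0; have x1 : 1 + x != 0 by rewrite gt_eqF// addr_gt0.
have d1 : is_derive x 1 (fun u : R => 1 + u) 1.
  by rewrite -[X in is_derive _ _ _ X]add0r; apply: is_deriveD.
have d2 : is_derive x 1 (fun u : R => (1 + u)^-1) (- (1 + x) ^- 2 *: 1).
  exact: is_deriveV.
have := is_deriveM (is_derive_id x (1 : R)) d2.
have -> : (id x *: (- (1 + x) ^- 2 *: (1 : R)) + (1 + x)^-1 *: 1) = (1 + x) ^- 2.
  by rewrite /GRing.scale/= !mulr1; field.
exact: id.
Qed.

Let derive_betaprim r x : 0 < r -> 0 < x -> is_derive x 1 (betaprim r) (betaker r x).
Proof.
move=> r0 x0; have x1 : 0 < 1 + x by rewrite addr_gt0.
have y0 : 0 < x / (1 + x) by rewrite divr_gt0.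
have := @is_derive1_comp R (@powR R ^~ r) (fun u => u / (1 + u)) x _ _
  (is_derive1_powR r y0) (derive_ratio x0).
move=> /(is_deriveZ r^-1).
suff -> : r^-1 *: (r * (x / (1 + x)) `^ (r - 1) * (1 + x) ^- 2) = betaker r x by [].
rewrite /GRing.scale/= !mulrA mulVf ?gt_eqF// mul1r /betaker.
rewrite powRM ?invr_ge0 ?ltW// -mulrA; congr (_ * _).
rewrite -powR_inv1 ?ltW// -powRrM -powR_invn ?ltW// -powRD; last first.
  by rewrite (@gt_eqF _ _ (1 + x)) ?implybT.
by congr (_ `^ _); rewrite /=; ring.
Qed.

Lemma cvg_powR0 r : 0 < r -> x `^ r @[x --> (0 : R)^'+] --> (0 : R).
Proof. exact: powR_cvg0. Qed.

Lemma continuous_betaker r x : 0 < x -> {for x, continuous (betaker r)}.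
Proof.
move=> x0; have x1 : 0 < 1 + x by rewrite addr_gt0.
apply: cvgM; first exact: (is_derive_cont (is_derive1_powR (r - 1) x0)).
exact: (is_derive_cont (is_derive_powRD (- r - 1) x1)).
Qed.

Let cvg_betaprim0 r : 0 < r -> betaprim r (invn n) @[n --> \oo] --> (0 : R).
Proof.
move=> r0; rewrite -(mulr0 r^-1); apply: cvgM; first exact: cvg_cst.
apply: (@squeeze_cvgr _ _ _ _ (fun=> 0) (fun n => @invn R n `^ r)); last 2 first.
- exact: cvg_cst.
- exact: (cvg_invn_comp (cvg_powR0 r0)).
apply: nearW => n; rewrite powR_ge0/=; have n0 := @invn_gt0 R n.
have n1 : 0 < 1 + @invn R n by rewrite addr_gt0.
apply: ge0_ler_powR; rewrite ?nnegrE ?(ltW r0) ?divr_ge0 ?ltW//.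
by rewrite ltr_pdivrMr// ltr_pMr// ltrDl.
Qed.

Let cvg_betaprimy r : 0 < r -> betaprim r (natn n) @[n --> \oo] --> r^-1.
Proof.
move=> r0; rewrite -[X in _ --> X]mulr1; apply: cvgM; first exact: cvg_cst.
have E n : @natn R n / (1 + natn n) = 1 - (1 + natn n)^-1.
  have : 0 < 1 + @natn R n by rewrite addr_gt0// ltr0n.
  by move=> /lt0r_neq0 n0; field.
under eq_fun do rewrite E.
have L : (1 - 0 : R) `^ r = 1 by rewrite subr0 powR1.
suff : (1 - (1 + @natn R n)^-1) `^ r @[n --> \oo] --> (1 - 0 : R) `^ r by rewrite L.
apply: (@continuous_cvg _ _ _ _ _ (fun n => 1 - (1 + natn n)^-1) (@powR R ^~ r)).
  by apply: (is_derive_cont (is_derive1_powR r _)); rewrite subr0.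
apply: cvgB; first exact: cvg_cst.
apply/gtr0_cvgV0; first by apply: nearW => n; rewrite addr_gt0// ltr0n.
apply/cvgryPge => A; near=> n; rewrite -lerBlDl.
by near: n; have /cvgryPge := @cvg_natn R; exact.
Unshelve. all: by end_near. Qed.

Lemma integrable_betaker r : 0 < r ->
  mu.-integrable `]0, +oo[%classic (EFin \o betaker r).
Proof.
move=> r0; apply: (exhausts_FTC_integrable (@exhausts_pos R) _ _
  (cvg_betaprim0 r0) (cvg_betaprimy r0)).
- by move=> x /=; rewrite in_itv/= andbT => x0; exact: derive_betaprim.
- by move=> x /=; rewrite in_itv/= andbT => x0; exact: continuous_betaker.
- by move=> x _; exact: betaker_ge0.
Qed.

Lemma integrable_betaker_neg r : 0 < r ->
  mu.-integrable `]-oo, 0[%classic (EFin \o (fun x => betaker r (- x))).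
Proof.
move=> r0.
pose G x := - betaprim r (- x).
have Gl0 : G (- natn n) @[n --> \oo] --> - r^-1.
  by rewrite /G; under eq_fun do rewrite opprK; apply: cvgN; exact: cvg_betaprimy.
have Gl1 : G (- invn n) @[n --> \oo] --> - 0.
  by rewrite /G; under eq_fun do rewrite opprK; apply: cvgN; exact: cvg_betaprim0.
apply: (@exhausts_FTC_integrable _ _ _ _ G _ _ _ (@exhausts_neg R) _ _ Gl0 Gl1).
- move=> x /=; rewrite in_itv/= -oppr_gt0 => x0.
  have d1 : is_derive x 1 (fun u : R => - u) (-1) by exact: is_deriveNid.
  have := is_deriveN (@is_derive1_comp R (betaprim r) (fun u => - u) x _ _
    (derive_betaprim r0 x0) d1).
  by rewrite mulrN1 opprK.
- move=> x /=; rewrite in_itv/= -oppr_gt0 => x0.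
  apply: (@continuous_comp _ _ _ (fun x => - x) (betaker r)).
    by apply: cvgN; exact: cvg_id.
  exact: continuous_betaker.
- by move=> x _; exact: betaker_ge0.
Qed.

Lemma betaker0 r : r != 1 -> betaker r 0 = 0.
Proof. by move=> r1; rewrite /betaker powR0 ?mul0r// subr_eq0. Qed.

Lemma integrable_betaker_abs r : 0 < r -> r != 1 ->
  mu.-integrable setT (EFin \o (fun x => betaker r `|x|)).
Proof.
move=> r0 r1.
(* Gluing the two open half-lines gives the value 0 at the origin, which is [betaker r 0] under the
   convention for [powR] because [r] is not 1. *)
have H : EFin \o (fun x => betaker r `|x|) =
    ((EFin \o betaker r) \_ `]0%R, +oo[) \+ ((EFin \o (fun x => betaker r (- x))) \_ `]-oo, 0%R[).
  apply/funext => x /=; rewrite !patchE !mem_setE !in_itv/= andbT.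
  have [x0|x0|->] := ltgtP x 0; rewrite ?adde0 ?add0e//.
  - by rewrite ltr0_norm.
  - by rewrite gtr0_norm.
  - by rewrite normr0 betaker0.
rewrite H; apply: integrableD => //; apply/(integrable_mkcond _ _).1 => //.
- exact: integrable_betaker.
- exact: integrable_betaker_neg.
Qed.

End beta_kernel.

Section test_function.
Context {R : realType}.
Implicit Types s t u w x z : R.
Implicit Types P Q : {poly R}.
Local Notation mu := (@lebesgue_measure R).

Lemma inv_oneDsqr_integrable :
  mu.-integrable setT (EFin \o (fun x : R => (1 + x ^+ 2)^-1)).
Proof.
have Gl1 : atan (natn n) @[n --> \oo] --> (pi / 2 : R).
  exact: (cvg_natn_comp (@cvgy_atan R)).
have Gl0 : atan (- natn n) @[n --> \oo] --> - (pi / 2 : R).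
  by under eq_fun do rewrite atanN; exact: cvgN.
apply: (@exhausts_FTC_integrable _ _ _ _ atan _ _ _ (@exhausts_setT R) _ _ Gl0 Gl1) => x _.
- apply: continuousV; first by rewrite gt_eqF// ltr_pwDl// sqr_ge0.
  by apply: cvgD; [exact: cvg_cst|exact: exprn_continuous].
- by rewrite invr_ge0 addr_ge0// sqr_ge0.
Qed.

Variable E : {poly R}.
Hypothesis hE : forall x, E.[x] <= - x ^+ 2.

(** For fixed [E] these functions are stable under differentiation, by [tderiv], and under
    multiplication by polynomials, by [tfunM]; every decay estimate then follows from boundedness of
    the whole class. *)
Definition tfun P x := P.[x] * expR E.[x].

Definition tderiv P := P^`() + P * E^`().

Lemma tfunM P Q x : tfun (P * Q) x = P.[x] * tfun Q x.
Proof. by rewrite /tfun hornerM mulrA. Qed.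

Lemma is_derive_tfun P x : is_derive x 1 (tfun P) (tfun (tderiv P) x).
Proof.
have d1 := @is_derive1_comp R expR (horner E) x _ _ (is_derive_expR E.[x]) (is_derive_poly E x).
have := is_deriveM (is_derive_poly P x) d1.
rewrite /tfun /tderiv !hornerE mulrDl.
rewrite /GRing.scale/= => H; apply: is_derive_eq H _.
by ring.
Qed.

Lemma continuous_tfun P : continuous (tfun P).
Proof. by move=> x; exact: (is_derive_cont (is_derive_tfun P x)). Qed.

Lemma tfun_bounded P : exists M, forall x, `|tfun P x| <= M.
Proof.
(* Combines [|x|^i <= 1 + x^(2i)] with the bound [x^(2i) <= i! exp (x^2)] given by a single term of
   the exponential series. *)
have mono i x : `|x| ^+ i * expR (- x ^+ 2) <= 1 + i`!%:R.
  case: i => [|i].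
    rewrite mul1r (@le_trans _ _ 1)//; first by rewrite -[leRHS]expR0 ler_expR lerNl oppr0 sqr_ge0.
    by rewrite lerDl.
  have f0 : 0 < (i.+1)`!%:R :> R by rewrite ltr0n fact_gt0.
  have := @expR_ge1Dxn R (x ^+ 2) i (sqr_ge0 x) => H.
  have {}H : x ^+ 2 ^+ i.+1 <= (i.+1)`!%:R * expR (x ^+ 2).
    rewrite mulrC -ler_pdivrMr// (le_trans _ H)// lerDr//.
  have le1 : `|x| ^+ i.+1 <= 1 + x ^+ 2 ^+ i.+1.
    rewrite -normrX -exprM mulnC exprM -[in leRHS]real_normK ?num_real//.
    by set y := `|x ^+ i.+1|; nra.
  rewrite expRN ler_pdivrMr ?expR_gt0// mulrDl mul1r (le_trans le1)// lerD//.
  by rewrite -[leLHS]expR0 ler_expR sqr_ge0.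
exists (\sum_(i < size P) `|P`_i| * (1 + i`!%:R)) => x.
rewrite /tfun normrM (ger0_norm (expR_ge0 _)) horner_coef.
have /ler_wpM2l : expR E.[x] <= expR (- x ^+ 2) by rewrite ler_expR.
move=> /(_ `|\sum_(i < size P) P`_i * x ^+ i| (normr_ge0 _)) /le_trans; apply.
rewrite (@le_trans _ _ ((\sum_(i < size P) `|P`_i * x ^+ i|) * expR (- x ^+ 2)))//.
  by rewrite ler_wpM2r ?expR_ge0// ler_norm_sum.
rewrite mulr_suml; apply: ler_sum => i _.
by rewrite normrM normrX -mulrA ler_wpM2l// mono.
Qed.

Lemma tfun_decay P : exists M, forall x, `|tfun P x| <= M * (1 + x ^+ 2)^-1.
Proof.
have [M HM] := tfun_bounded ((1 + 'X^2) * P); exists M => x.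
have x1 : 0 < 1 + x ^+ 2 by rewrite ltr_pwDl// sqr_ge0.
rewrite ler_pdivlMr// mulrC -[X in X * _]ger0_norm; last exact: ltW.
by rewrite -normrM; have := HM x; rewrite tfunM !hornerE.
Qed.

Lemma integrable_tfun P : mu.-integrable setT (EFin \o tfun P).
Proof.
have [M HM] := tfun_decay P.
apply: (@integrable_dom _ _ _ mu setT _ (fun x => M * (1 + x ^+ 2)^-1)) => //.
- by apply: continuous_measurable_fun; exact: continuous_tfun.
- under [X in integrable _ _ X]eq_fun do rewrite /= EFinM.
  by apply: integrableZl => //; exact: inv_oneDsqr_integrable.
Qed.

Lemma integrable_tfun_powR P s : 0 < s < 1 ->
  mu.-integrable setT (EFin \o (fun w => `|tfun P w| * `|w| `^ (s - 1))).
Proof.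
move=> /andP[s0 s1]; have [M HM] := tfun_decay P.
(* Since [s + 1 <= 2], one has [(1 + |x|)^(s+1) <= (1 + |x|)^2 <= 2 (1 + x^2)]; this is the origin
   of the factor 2. *)
apply: (@integrable_dom _ _ _ mu setT _ (fun x => (2 * M) * betaker s `|x|)) => //.
- apply: measurable_funM; last exact: measurable_fun_powRl.
  by apply: measurableT_comp => //; apply: continuous_measurable_fun; exact: continuous_tfun.
- under [X in integrable _ _ X]eq_fun do rewrite /= EFinM.
  by apply: integrableZl => //; apply: integrable_betaker_abs => //; rewrite lt_eqF.
- move=> x _; rewrite ger0_norm ?mulr_ge0 ?powR_ge0// /betaker mulrCA mulrC.
  rewrite ler_wpM2l ?powR_ge0// (le_trans (HM x))//.
  have M0 : 0 <= M.
    by have := le_trans (normr_ge0 _) (HM 0); rewrite expr0n addr0 invr1 mulr1.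
  rewrite -[in leRHS]mulrA mulrCA ler_wpM2l//.
  have x1 : 0 < 1 + x ^+ 2 by rewrite ltr_pwDl// sqr_ge0.
  have x2 : 0 < 1 + `|x| by rewrite ltr_pwDl.
  rewrite -lef_pV2 ?posrE ?invr_gt0// ?mulr_gt0 ?powR_gt0//.
  rewrite invrK invfM -powRN opprD !opprK.
  rewrite mulrC ler_pdivrMr//.
  apply: (@le_trans _ _ ((1 + `|x|) `^ 2%:R)).
    by apply: ler_powR; rewrite ?lerDl//; lra.
  rewrite powR_mulrn; last exact: ltW.
  have -> : x ^+ 2 = `|x| ^+ 2 by rewrite real_normK// num_real.
  rewrite -subr_ge0 [X in 0 <= X](_ : _ = (1 - `|x|) ^+ 2); last by ring.
  exact: sqr_ge0.
Qed.

Lemma cvg_tfun_natn P : tfun P (natn n) @[n --> \oo] --> (0 : R).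
Proof.
have [M HM] := tfun_bounded ('X * P).
apply: norm_cvg0.
apply: (@squeeze_cvgr _ _ _ _ (fun=> 0) (fun n => M * @invn R n)); last 2 first.
- exact: cvg_cst.
- by rewrite -(mulr0 M); apply: cvgM; [exact: cvg_cst|exact: cvg_invn].
apply: nearW => n; rewrite normr_ge0/= ler_pdivlMr ?ltr0n//.
have := HM (natn n); rewrite tfunM hornerX normrM mulrC.
by rewrite (@ger0_norm _ (natn n))// ler0n.
Qed.

Lemma cvg_tfun_Nnatn P : tfun P (- natn n) @[n --> \oo] --> (0 : R).
Proof.
have [M HM] := tfun_bounded ('X * P).
apply: norm_cvg0.
apply: (@squeeze_cvgr _ _ _ _ (fun=> 0) (fun n => M * @invn R n)); last 2 first.
- exact: cvg_cst.
- by rewrite -(mulr0 M); apply: cvgM; [exact: cvg_cst|exact: cvg_invn].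
apply: nearW => n; rewrite normr_ge0/= ler_pdivlMr ?ltr0n//.
have := HM (- natn n); rewrite tfunM hornerX normrM mulrC normrN.
by rewrite (@ger0_norm _ (natn n))// ler0n.
Qed.

Section fourier_decay.
Variables (S U : R -> R).
Hypothesis dS : forall x, is_derive x 1 S (U x).
Hypothesis dU : forall x, is_derive x 1 U (- S x).
Hypothesis S1 : forall x, `|S x| <= 1.
Hypothesis U1 : forall x, `|U x| <= 1.

Let mU : measurable_fun setT U.
Proof.
by apply: continuous_measurable_fun => x; exact: (is_derive_cont (dU x)).
Qed.

Let iU P t : mu.-integrable setT (EFin \o (fun w => U (w * t) * tfun P w)).
Proof.
apply: (@integrable_dom _ _ _ mu setT _ (fun w => `|tfun P w|)) => //.
- apply: measurable_funM; last exact: integrable_mf (integrable_tfun P).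
  by apply: (measurableT_comp mU); exact: measurable_funM.
- exact: integrable_norm (integrable_tfun P).
- by move=> w _; rewrite normrM ler_piMl.
Qed.

Let dscale (F dF : R -> R) t x : (forall x, is_derive x 1 F (dF x)) ->
  is_derive x 1 (fun w => F (w * t)) (dF (x * t) * t).
Proof.
move=> hF.
have d1 : is_derive x 1 (fun w : R => w * t) t.
  under eq_fun do rewrite mulrC.
  rewrite -[X in is_derive _ _ _ X]mulr1.
  exact: is_deriveZ.
exact: (@is_derive1_comp R F (fun w => w * t) x _ _ (hF _) d1).
Qed.

(** Two integrations by parts at once: in the derivative of [G] the terms containing [S] cancel. The
    pair [(S, U)] is [(sin, cos)] or [(- cos, sin)], so both transforms are covered. *)
Let parts P t : t != 0 ->
  t ^+ 2 * \int[mu]_w (U (w * t) * tfun P w) =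
  - \int[mu]_w (U (w * t) * tfun (tderiv (tderiv P)) w).
Proof.
move=> t0; set P1 := tderiv P; set P2 := tderiv P1.
pose G w := t * (tfun P w * S (w * t)) + tfun P1 w * U (w * t).
pose g w := t ^+ 2 * (U (w * t) * tfun P w) + U (w * t) * tfun P2 w.
have dG w : is_derive w 1 G (g w).
  have h1 := is_deriveZ t (is_deriveM (is_derive_tfun P w) (dscale t w dS)).
  have h2 := is_deriveM (is_derive_tfun P1 w) (dscale t w dU).
  apply: is_derive_eq (is_deriveD h1 h2) _.
  by rewrite /GRing.scale/= /g -/P1 -/P2; ring.
have cU w : {for w, continuous (fun w => U (w * t))} := is_derive_cont (dscale t w dU).
have cg w : {for w, continuous g}.
  apply: cvgD; last by apply: cvgM; [exact: cU|exact: continuous_tfun].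
  apply: cvgM; first exact: cvg_cst.
  by apply: cvgM; [exact: cU|exact: continuous_tfun].
have bnd (u : nat -> R) (f h : R -> R) : (forall x, `|h x| <= 1) ->
    f (u n) @[n --> \oo] --> (0 : R) -> f (u n) * h (u n * t) @[n --> \oo] --> (0 : R).
  move=> h1 fu; apply: norm_cvg0.
  apply: (@squeeze_cvgr _ _ _ _ (fun=> 0) (fun n => `|f (u n)|)); last 2 first.
  - exact: cvg_cst.
  - by rewrite -(@normr0 _ R); exact: cvg_norm.
  by apply: nearW => n; rewrite normr_ge0/= normrM ler_piMr.
have Gl1 : G (natn n) @[n --> \oo] --> (0 : R).
  rewrite -(addr0 0); apply: cvgD; last exact: bnd (cvg_tfun_natn P1).
  rewrite -(mulr0 t); apply: cvgM; first exact: cvg_cst.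
  exact: bnd (cvg_tfun_natn P).
have Gl0 : G (- natn n) @[n --> \oo] --> (0 : R).
  rewrite -(addr0 0); apply: cvgD.
    rewrite -(mulr0 t); apply: cvgM; first exact: cvg_cst.
    exact: (bnd (fun n => - natn n) _ _ S1 (cvg_tfun_Nnatn P)).
  exact: (bnd (fun n => - natn n) _ _ U1 (cvg_tfun_Nnatn P1)).
have i1 : mu.-integrable setT (EFin \o (fun w => t ^+ 2 * (U (w * t) * tfun P w))).
  under [X in integrable _ _ X]eq_fun do rewrite /= EFinM.
  by apply: integrableZl => //; exact: iU.
have ig : mu.-integrable setT (EFin \o g).
  rewrite (_ : EFin \o g = ((EFin \o (fun w => (t ^+ 2 * (U (w * t) * tfun P w))%R)) \+
    (EFin \o (fun w => (U (w * t) * tfun P2 w)%R)))%E)//.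
  by apply: integrableD => //; exact: iU.
have := exhausts_FTC (@exhausts_setT R) (fun x _ => dG x) (fun x _ => cg x) Gl0 Gl1 ig.
rewrite /g (RintegralD measurableT i1 (iU P2 t)) (RintegralZl _ measurableT (iU P t)).
by rewrite subrr => /eqP; rewrite addr_eq0 => /eqP.
Qed.

(** The transform is bounded by [A], and by [B / t^2] according to [parts]; together these give the
    majorant [(A + B) / (1 + t^2)]. *)
Lemma fourier_tfun_integrable P :
  mu.-integrable setT (fun t => (\int[mu]_w (U (w * t) * tfun P w))%:E).
Proof.
set P2 := tderiv (tderiv P).
have [A hA] : exists A, forall t, `|\int[mu]_w (U (w * t) * tfun P w)| <= A.
  exists (\int[mu]_w `|tfun P w|) => t.
  apply: (le_trans (le_normr_Rintegral _ (iU P t))) => //.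
  apply: le_Rintegral => //.
  - exact: integrable_norm (iU P t).
  - exact: integrable_norm (integrable_tfun P).
  - by move=> w _; rewrite normrM ler_piMl.
have [B hB] : exists B, forall t, `|\int[mu]_w (U (w * t) * tfun P2 w)| <= B.
  exists (\int[mu]_w `|tfun P2 w|) => t.
  apply: (le_trans (le_normr_Rintegral _ (iU P2 t))) => //.
  apply: le_Rintegral => //.
  - exact: integrable_norm (iU P2 t).
  - exact: integrable_norm (integrable_tfun P2).
  - by move=> w _; rewrite normrM ler_piMl.
apply: (@integrable_dom _ _ _ mu setT _ (fun t => (A + B) * (1 + t ^+ 2)^-1)) => //.
(* Measurability in [t] comes out of Fubini's theorem, which requires integrability in [t] as well;
   the weight [(1 + t^2)^-1] provides it and is multiplied away afterwards. *)
- have mf : measurable_fun setT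
      (fun p : R * R => (1 + p.1 ^+ 2)^-1 * (U (p.2 * p.1) * tfun P p.2)).
    apply: measurable_funM.
      apply: (measurableT_comp measurable_invr); apply: measurable_funD => //.
      by apply: measurable_funX; exact: measurable_fst.
    apply: measurable_funM.
      apply: (measurableT_comp mU).
      by apply: measurable_funM; [exact: measurable_snd|exact: measurable_fst].
    apply: (measurableT_comp (integrable_mf (integrable_tfun P))).
    exact: measurable_snd.
  have dom t w : `|(1 + t ^+ 2)^-1 * (U (w * t) * tfun P w)| <= (1 + t ^+ 2)^-1 * `|tfun P w|.
    rewrite normrM ger0_norm ?invr_ge0 ?addr_ge0 ?sqr_ge0//.
    by rewrite ler_wpM2l ?invr_ge0 ?addr_ge0 ?sqr_ge0// normrM ler_piMl.
  have [_ /integrable_mf H _] := @Rfubini_prod _ _ _ _ _ mu mu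
    (fun t w => (1 + t ^+ 2)^-1 * (U (w * t) * tfun P w)) _ _ mf
    inv_oneDsqr_integrable (integrable_norm (integrable_tfun P)) dom.
  rewrite (_ : (fun _ => _) = (fun t => (1 + t ^+ 2) *
     \int[mu]_w ((1 + t ^+ 2)^-1 * (U (w * t) * tfun P w)))).
    by apply: measurable_funM => //; apply: measurable_funD => //; exact: measurable_funX.
  apply/funext => t; rewrite (RintegralZl _ measurableT (iU P t)).
  by rewrite mulrA divff ?mul1r// gt_eqF// ltr_pwDl// sqr_ge0.
- under [X in integrable _ _ X]eq_fun do rewrite /= EFinM.
  by apply: integrableZl => //; exact: inv_oneDsqr_integrable.
- move=> t _; rewrite ler_pdivlMr ?ltr_pwDl ?sqr_ge0// mulrDr mulr1 lerD//.
  have [->|t0] := eqVneq t 0.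
    by rewrite expr0n/= mulr0 (le_trans _ (hB 0)).
  by rewrite mulrC -[X in X * _]ger0_norm ?sqr_ge0// -normrM parts// normrN hB.
Qed.

End fourier_decay.
End test_function.

(** * Gamma and sine integrals *)

Section gamma.
Context {R : realType}.
Implicit Types c r s t u w x z : R.
Local Notation mu := (@lebesgue_measure R).
Local Notation pos := (`]0, +oo[%classic : set R).

Lemma posE x : pos x = (0 < x) :> Prop.
Proof. by rewrite /= in_itv/= andbT. Qed.

Lemma measurable_pos : measurable pos. Proof. by []. Qed.

Lemma cvg_eq_powR_natn r : 0 < r -> natn n `^ r @[n --> \oo] --> (+oo : set_system R).
Proof.
move=> r0; apply/cvgryPge => A; near=> n.
have [A0|A0] := leP A 0; first by rewrite (le_trans A0) ?powR_ge0.
have -> : A = (A `^ (r^-1)) `^ r by rewrite -powRrM mulVf ?gt_eqF// powRr1// ltW.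
apply: ge0_ler_powR; rewrite ?nnegrE ?powR_ge0 ?(ltW r0) ?ler0n//.
by near: n; have /cvgryPge := @cvg_natn R; exact.
Unshelve. all: by end_near. Qed.

Lemma exhausts_powR k r : 0 < k -> 0 < r ->
  exhausts pos (fun n => k * invn n `^ r) (fun n => k * natn n `^ r).
Proof.
move=> k0 r0; apply: exhausts_posreal.
- by move=> n; rewrite mulr_gt0// powR_gt0// invn_gt0.
- move=> n; rewrite ltr_pM2l//; apply: gt0_ltr_powR; rewrite ?nnegrE ?ler0n//.
    by rewrite ltW// invn_gt0.
  exact: invn_lt_natn.
- move=> m n mn; rewrite ler_pM2l//; apply: ge0_ler_powR; rewrite ?nnegrE ?(ltW r0) ?(ltW (invn_gt0 _))//.
  exact: nonincreasing_invn.
- move=> m n mn; rewrite ler_pM2l//; apply: ge0_ler_powR; rewrite ?nnegrE ?(ltW r0) ?ler0n//.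
  exact: nondecreasing_natn.
- rewrite -(mulr0 k); apply: cvgM; first exact: cvg_cst.
  exact: (cvg_invn_comp (powR_cvg0 r0)).
- apply/cvgryPge => A; near=> n; rewrite -ler_pdivrMl//.
  by near: n; have /cvgryPge := cvg_eq_powR_natn r0; exact.
Unshelve. all: by end_near. Qed.

Section subst_powR.
Variables (k r : R) (G : R -> R).
Hypotheses (k0 : 0 < k) (r0 : 0 < r).
Hypothesis cG : forall x, 0 < x -> {for x, continuous G}.

Let F x : R := k * x `^ r.
Let dF x : R := k * (r * x `^ (r - 1)).

Let dFE x : pos x -> is_derive x 1 F (dF x).
Proof.
rewrite posE => x0; exact: (is_deriveZ k (is_derive1_powR r x0)).
Qed.

Let cdF x : pos x -> {for x, continuous dF}.
Proof.
rewrite posE => x0; apply: cvgM; first exact: cvg_cst.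
apply: cvgM; first exact: cvg_cst.
exact: (is_derive_cont (is_derive1_powR (r - 1) x0)).
Qed.

Let dF0 x : pos x -> 0 <= dF x.
Proof. by move=> _; rewrite !mulr_ge0 ?powR_ge0 ?ltW. Qed.

Let incrF : {in pos &, {homo F : x y / x < y}}.
Proof.
move=> x y; rewrite !inE !posE => x0 y0 xy; rewrite ltr_pM2l//.
by apply: gt0_ltr_powR; rewrite ?nnegrE ?ltW.
Qed.

Let FDE x : pos x -> pos (F x).
Proof. by rewrite !posE => x0; rewrite mulr_gt0// powR_gt0. Qed.

Let cG' x : pos x -> {for x, continuous G}. Proof. by rewrite posE; exact: cG. Qed.

Lemma subst_powR_ge0 : (forall x, 0 < x -> 0 <= G x) ->
  (\int[mu]_(x in pos) (G x)%:E =
   \int[mu]_(x in pos) (G (k * x `^ r) * (k * (r * x `^ (r - 1))))%:E)%E.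
Proof.
move=> G0; apply: (exhausts_subst_ge0 (@exhausts_pos R) (exhausts_powR k0 r0) dFE cdF dF0 incrF FDE cG').
by move=> x; rewrite posE; exact: G0.
Qed.

Lemma subst_powR : \int[mu]_(x in pos) G x =
   \int[mu]_(x in pos) (G (k * x `^ r) * (k * (r * x `^ (r - 1)))).
Proof.
exact: (exhausts_subst (@exhausts_pos R) (exhausts_powR k0 r0) dFE cdF dF0 incrF FDE cG').
Qed.

End subst_powR.

Definition gker z c t : R := t `^ (z - 1) * expR (- (c * t)).

Lemma gker_ge0 z c t : 0 <= gker z c t.
Proof. by rewrite mulr_ge0 ?powR_ge0 ?expR_ge0. Qed.

(** One term of order above [|r|] in the exponential series, taken at [c (1 + t)] rather than at
    [c t]; the shift costs the factor [expR c]. *)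
Lemma expRN_le_powR c r : 0 < c ->
  exists2 C, 0 <= C & forall t, 0 < t -> expR (- (c * t)) <= C * (1 + t) `^ (- r).
Proof.
move=> c0; pose n := Num.bound `|r|.
have f0 : 0 < (n.+1)`!%:R :> R by rewrite ltr0n fact_gt0.
exists ((n.+1)`!%:R * c ^- n.+1 * expR c).
  by rewrite !mulr_ge0 ?expR_ge0 ?invr_ge0 ?exprn_ge0 ?ltW.
move=> t t0; have t1 : 1 <= 1 + t by rewrite lerDl ltW.
have t2 : 0 < 1 + t by exact: lt_le_trans t1.
rewrite powRN expRN ler_pdivlMr ?powR_gt0// mulrC ler_pdivrMr ?expR_gt0//.
apply: (@le_trans _ _ ((1 + t) `^ n.+1%:R)).
  apply: ler_powR => //; apply: ltW.
  apply: (le_lt_trans (ler_norm r)); apply: (lt_le_trans (archi_boundP (normr_ge0 _))).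
  by rewrite /n ler_nat.
rewrite powR_mulrn; last exact: ltW.
have := @expR_ge1Dxn R (c * (1 + t)) n (mulr_ge0 (ltW c0) (ltW t2)) => H.
have {}H : (c * (1 + t)) ^+ n.+1 <= (n.+1)`!%:R * expR (c * (1 + t)).
  by rewrite -ler_pdivrMl// mulrC (le_trans _ H)// lerDr.
rewrite exprMn mulrDr mulr1 expRD in H.
rewrite [leRHS](_ : _ = c ^- n.+1 * ((n.+1)`!%:R * (expR c * expR (c * t)))); last by ring.
by rewrite ler_pdivlMl ?exprn_gt0.
Qed.

Lemma gker_le_betaker z c : 0 < c ->
  exists2 C, 0 <= C & forall t, 0 < t -> gker z c t <= C * betaker z t.
Proof.
move=> c0; have [C C0 HC] := expRN_le_powR (z + 1) c0; exists C => // t t0.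
rewrite /gker /betaker mulrCA ler_wpM2l ?powR_ge0//.
by rewrite -opprD HC.
Qed.

Lemma continuous_gker z c t : 0 < t -> {for t, continuous (gker z c)}.
Proof.
move=> t0; apply: cvgM; first exact: (is_derive_cont (is_derive1_powR (z - 1) t0)).
apply: continuous_comp; last exact: continuous_expR.
by apply: cvgN; apply: cvgM; [exact: cvg_cst|exact: cvg_id].
Qed.

Lemma measurable_gker z c : measurable_fun setT (gker z c).
Proof.
apply: measurable_funM; first exact: measurable_powRT.
apply: (measurableT_comp (@measurable_expR R)).
by apply: measurableT_comp => //; exact: measurable_funM.
Qed.

Lemma integrable_gker z c : 0 < z -> 0 < c -> mu.-integrable pos (EFin \o gker z c).
Proof.
move=> z0 c0; have [C C0 HC] := gker_le_betaker z c0.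
apply: (@integrable_dom _ _ _ mu pos _ (fun t => C * betaker z t)) => //.
- exact: measurable_funS measurableT (@subsetT _ _) (measurable_gker z c).
- under [X in integrable _ _ X]eq_fun do rewrite /= EFinM.
  by apply: integrableZl => //; exact: integrable_betaker.
- by move=> t; rewrite posE => t0; rewrite ger0_norm ?gker_ge0// HC.
Qed.

Lemma GammaE z : Gamma z = \int[mu]_(t in pos) gker z 1 t.
Proof. by apply: eq_Rintegral => t _; rewrite /gker mul1r. Qed.

Lemma integral_gker z c : 0 < z -> 0 < c ->
  \int[mu]_(t in pos) gker z c t = c `^ (- z) * Gamma z.
Proof.
move=> z0 c0; rewrite GammaE [in RHS](subst_powR c0 ltr01); last first.
  by move=> x x0; exact: continuous_gker.
have c1 : c `^ z * c `^ (- z) = 1 by rewrite -powRD ?subrr ?powRr0// (@gt_eqF _ _ c)// implybT.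
have E t : pos t -> gker z 1 (c * t `^ 1) * (c * (1 * t `^ (1 - 1))) = c `^ z * gker z c t.
  rewrite posE => t0; rewrite subrr powRr0 !mulr1 /gker powRr1 ?ltW// !mul1r.
  rewrite powRM ?ltW//.
  transitivity ((c * c `^ (z - 1)) * (t `^ (z - 1) * expR (- (c * t)))); first by ring.
  by rewrite mulr_powRB1// ltW.
rewrite [X in _ = _ * X](@eq_Rintegral _ _ _ mu pos (fun t => c `^ z * gker z c t)); last first.
  by move=> t; rewrite inE => /E.
rewrite RintegralZl//; last exact: integrable_gker.
by rewrite mulrA (mulrC _ (c `^ z)) c1 mul1r.
Qed.

Lemma integrable_itv12 : mu.-integrable pos (EFin \o \1_(`[1, 2]%classic)).
Proof.
apply: (@integrableS _ _ _ mu setT) => //.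
exact: integrable_indic_itv.
Qed.

Lemma Gamma_gt0 z : 0 < z -> 0 < Gamma z.
Proof.
(* On [[1, 2]] the integrand is at least [m], because [t^(z-1) = t^z / t >= 1/2] and
   [exp (-t) >= exp (-2)]. *)
move=> z0; rewrite GammaE; pose m : R := expR (- 2) / 2.
have m0 : 0 < m by rewrite divr_gt0// expR_gt0.
apply: (lt_le_trans m0).
have -> : m = \int[mu]_(t in pos) (m * \1_(`[1, 2]%classic) t).
  rewrite RintegralZl//; last exact: integrable_itv12.
  rewrite /Rintegral integral_indic// setIidl.
    rewrite [X in fine X](_ : _ = 1%:E) ?mulr1//.
    apply: etrans (lebesgue_measure_itv _) _.
    by rewrite /= lte_fin ltr1n -EFinB; congr EFin; ring.
  by move=> t /=; rewrite !in_itv/= andbT => /andP[t1 _]; exact: lt_le_trans t1.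
apply: le_Rintegral => //.
- under [X in integrable _ _ X]eq_fun do rewrite /= EFinM.
  by apply: integrableZl => //; exact: integrable_itv12.
- exact: integrable_gker.
- move=> t; rewrite posE => t0; rewrite indicE mem_setE in_itv/=.
  case: (boolP (1 <= t <= 2)) => [/andP[t1 t2]|_]; last by rewrite mulr0 gker_ge0.
  rewrite mulr1 /m /gker mul1r mulrC; apply: ler_pM; rewrite ?invr_ge0 ?expR_ge0//.
    rewrite powRB; last by rewrite (@gt_eqF _ _ t)// implybT.
    rewrite [t `^ 1]powRr1; last exact: ltW.
    rewrite ler_pdivlMr// mulrC (@le_trans _ _ 1)//.
      by rewrite ler_pdivrMr// mul1r.
    by rewrite -(powRr0 t); apply: ler_powR => //; exact: ltW.
  by rewrite ler_expR lerN2.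
Qed.

Lemma cvg_powR_invn z : 0 < z -> invn n `^ z @[n --> \oo] --> (0 : R).
Proof. by move=> z0; exact: (cvg_invn_comp (powR_cvg0 z0)). Qed.

Lemma cvg_natn_powRN z : 0 < z -> natn n `^ (- z) @[n --> \oo] --> (0 : R).
Proof. by move=> z0; exact: (cvg_natn_comp (cvg_powRN z0)). Qed.

Lemma is_derive_expRM c t : is_derive t 1 (fun u => expR (- (c * u))) (- c * expR (- (c * t))).
Proof.
have d1 : is_derive t 1 (fun u : R => - (c * u)) (- c).
  by rewrite -[X in is_derive _ _ _ (- X)]mulr1; apply: is_deriveN; exact: is_deriveZ.
rewrite mulrC.
exact: (@is_derive1_comp R expR (fun u => - (c * u)) t _ _ (is_derive_expR _) d1).
Qed.

Lemma GammaD1 z : 0 < z -> Gamma (z + 1) = z * Gamma z.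
Proof.
move=> z0; have z1 : 0 < z + 1 by rewrite addr_gt0.
pose G t : R := t `^ z * expR (- (1 * t)).
pose g t : R := z * gker z 1 t - gker (z + 1) 1 t.
have dG t : pos t -> is_derive t 1 G (g t).
  rewrite posE => t0.
  apply: is_derive_eq (is_deriveM (is_derive1_powR z t0) (is_derive_expRM 1 t)) _.
  by rewrite /GRing.scale/= /g /gker addrK; ring.
have cg t : pos t -> {for t, continuous g}.
  rewrite posE => t0; apply: cvgB; last exact: continuous_gker.
  by apply: cvgM; [exact: cvg_cst|exact: continuous_gker].
have Gl0 : G (invn n) @[n --> \oo] --> (0 : R).
  apply: (@squeeze_cvgr _ _ _ _ (fun=> 0) (fun n => invn n `^ z)); last 2 first.
  - exact: cvg_cst.
  - exact: cvg_powR_invn.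
  apply: nearW => n; rewrite mulr_ge0 ?powR_ge0 ?expR_ge0//= ler_piMr ?powR_ge0//.
  by rewrite -[leRHS]expR0 ler_expR mul1r oppr_le0 ltW// invn_gt0.
have Gl1 : G (natn n) @[n --> \oo] --> (0 : R).
  have [C C0 HC] := @expRN_le_powR 1 (z + 1) ltr01.
  apply: (@squeeze_cvgr _ _ _ _ (fun=> 0) (fun n => C * natn n `^ (- 1))); last 2 first.
  - exact: cvg_cst.
  - by rewrite -(mulr0 C); apply: cvgM; [exact: cvg_cst|exact: cvg_natn_powRN].
  apply: nearW => n; rewrite mulr_ge0 ?powR_ge0 ?expR_ge0//=.
  have n0 : 0 < @natn R n by rewrite ltr0n.
  have n1 : 0 < 1 + @natn R n by rewrite addr_gt0.
  apply: (@le_trans _ _ (natn n `^ z * (C * natn n `^ (- (z + 1))))).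
    rewrite ler_wpM2l ?powR_ge0// (le_trans (HC _ n0))// ler_wpM2l//.
    rewrite !powRN lef_pV2 ?posrE ?powR_gt0//; apply: ge0_ler_powR; rewrite ?nnegrE ?ltW//.
    by rewrite ltrDr.
  rewrite mulrCA -powRD; last by rewrite (@gt_eqF _ _ (natn n))// implybT.
  by rewrite opprD addrA subrr add0r.
have i1 : mu.-integrable pos (EFin \o (fun t => z * gker z 1 t)).
  under [X in integrable _ _ X]eq_fun do rewrite /= EFinM.
  by apply: integrableZl => //; exact: integrable_gker.
have i2 : mu.-integrable pos (EFin \o gker (z + 1) 1) by exact: integrable_gker.
have ig : mu.-integrable pos (EFin \o g).
  rewrite (_ : EFin \o g = ((EFin \o (fun t => (z * gker z 1 t)%R)) \- (EFin \o gker (z + 1) 1))%E)//.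
  by apply: integrableB.
have := exhausts_FTC (@exhausts_pos R) dG cg Gl0 Gl1 ig.
rewrite /g (RintegralB _ i1 i2)// RintegralZl//; last exact: integrable_gker.
by rewrite -!GammaE subrr => /eqP; rewrite subr_eq0 => /eqP.
Qed.


End gamma.

(** * The integral of a power times sine *)

Section sine_integral.
Context {R : realType}.
Implicit Types c g r t u w x z : R.
Local Notation mu := (@lebesgue_measure R).
Local Notation pos := (`]0, +oo[%classic : set R).

Lemma powR_shift z t : 0 < t -> t `^ (z - 1) * t = t `^ z.
Proof.
move=> t0; rewrite powRB; last by rewrite (@gt_eqF _ _ t)// implybT.
by rewrite [t `^ 1]powRr1 ?(ltW t0)// divfK// gt_eqF.
Qed.

(** The majorant is the pullback of [betaker] with parameter [1/s - 1] under [t -> t^s], a multiple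
    of [t^(-s) (1 + t^s)^(-1/s)]; substitution makes it integrable. The comparison is
    [(1 + t^s)^(1/s) <= 2^(1/s) max (1, t)], whence the constant [2^(1/s) / s]. *)
Lemma integrable_powRN_min s : 0 < s < 1 ->
  exists2 D : R -> R, mu.-integrable pos (EFin \o D) &
  forall t, 0 < t -> t `^ (- s - 1) * Num.min 1 t <= D t.
Proof.
move=> /andP[s0 s1]; pose r := s^-1 - 1.
have r0 : 0 < r by rewrite subr_gt0 invf_gt1.
pose D t := betaker r (1 * t `^ s) * (1 * (s * t `^ (s - 1))).
have iD : mu.-integrable pos (EFin \o D).
  have H := @subst_powR_ge0 R 1 s (betaker r) ltr01 s0
    (@continuous_betaker R r) (fun x _ => betaker_ge0 r x).
  have D0 t : 0 <= D t by rewrite mulr_ge0 ?betaker_ge0// mul1r mulr_ge0 ?powR_ge0 ?ltW.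
  apply/integrableP; split.
    apply/measurable_EFinP; apply: open_cts_measurable => // t; rewrite posE => t0.
    have ct : {for t, continuous (fun t => 1 * t `^ s)}.
      apply: cvgM; first exact: cvg_cst.
      exact: (is_derive_cont (is_derive1_powR s t0)).
    apply: cvgM.
      apply: (@continuous_comp _ _ _ (fun t => 1 * t `^ s) (betaker r)) => //.
      by apply: continuous_betaker; rewrite mul1r powR_gt0.
    apply: cvgM; first exact: cvg_cst.
    apply: cvgM; first exact: cvg_cst.
    exact: (is_derive_cont (is_derive1_powR (s - 1) t0)).
  under eq_integral do rewrite /= ger0_norm//.
  rewrite -H.
  have /integrableP[_] := @integrable_betaker R r r0.
  by under eq_integral do rewrite /= ger0_norm ?betaker_ge0//.
exists (fun t => (2 `^ s^-1 / s) * D t).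
  under [X in integrable _ _ X]eq_fun do rewrite /= EFinM.
  exact: integrableZl.
move=> t t0.
have t1 : 0 < 1 + t `^ s by rewrite ltr_pwDl ?powR_ge0.
have DE : D t = s * (t `^ (- s) * (1 + t `^ s) `^ (- s^-1)).
  rewrite /D /betaker !mul1r -!powRrM.
  transitivity (s * ((t `^ (s * (r - 1)) * t `^ (s - 1)) * (1 + t `^ s) `^ (- r - 1))); first by ring.
  rewrite -powRD; last by rewrite (@gt_eqF _ _ t)// implybT.
  congr (_ * (_ `^ _ * _ `^ _)).
    by rewrite /r; field; rewrite gt_eqF.
  by rewrite /r; ring.
rewrite DE [leRHS](_ : _ = t `^ (- s) * (2 `^ s^-1 * (1 + t `^ s) `^ (- s^-1))); last first.
  by field; rewrite gt_eqF.
rewrite -(powR_shift (- s) t0) -[leRHS]mulrA ler_wpM2l ?powR_ge0//.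
rewrite powRN mulrA ler_pdivlMr ?powR_gt0//.
have tE : t = (t `^ s) `^ s^-1 by rewrite -powRrM mulfV ?gt_eqF// powRr1// ltW.
have [t1'|t1'] := leP t 1.
  rewrite ler_wpM2l ?(ltW t0)//; apply: ge0_ler_powR; rewrite ?nnegrE ?invr_ge0 ?(ltW s0) ?(ltW t1)//.
  rewrite -[leRHS]/(1 + 1) lerD2l -(powRr0 t).
  by apply: ger_powR; rewrite ?t0// ltW.
rewrite mul1r [in leRHS]tE -powRM ?powR_ge0//.
apply: ge0_ler_powR; rewrite ?nnegrE ?invr_ge0 ?(ltW s0) ?(ltW t1) ?mulr_ge0 ?powR_ge0//.
rewrite mulr_natr mulr2n lerD2r -(powRr0 t); apply: ler_powR; exact: ltW.
Qed.

Section rotation.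
Variable s : R.
Hypothesis s01 : 0 < s < 1.
Let s0 : 0 < s. Proof. by case/andP: s01. Qed.
Let s1 : s < 1. Proof. by case/andP: s01. Qed.
Let s1' : 0 < 1 - s. Proof. by rewrite subr_gt0. Qed.

(* Imaginary and real parts of t^(-s-1) (e^(-z t) - 1) for z = c - i g. With
   z = e^(-i x) and x running from 0 to pi/2, their integrals solve a linear
   differential system; this replaces the rotation of the contour which takes
   Gamma (1 - s) to the integral of t^(-s-1) sin t. *)
Definition rotI c g t : R := t `^ (- s - 1) * (expR (- (c * t)) * sin (g * t)).
Definition rotJ c g t : R := t `^ (- s - 1) * (expR (- (c * t)) * cos (g * t) - 1).

Let expN_le1 c t : 0 <= c -> 0 < t -> expR (- (c * t)) <= 1.
Proof. by move=> c0 t0; rewrite -[leRHS]expR0 ler_expR oppr_le0 mulr_ge0// ltW. Qed.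

Lemma rotI_le c g t : 0 <= c -> `|g| <= 1 -> 0 < t ->
  `|rotI c g t| <= t `^ (- s - 1) * Num.min 1 t.
Proof.
move=> c0 g1 t0; rewrite /rotI normrM (ger0_norm (powR_ge0 _ _)) ler_wpM2l ?powR_ge0//.
rewrite normrM (ger0_norm (expR_ge0 _)) le_min; apply/andP; split.
  by rewrite -[leRHS]mulr1 ler_pM ?expR_ge0 ?expN_le1 ?sin_max.
rewrite -[leRHS]mul1r ler_pM ?expR_ge0 ?expN_le1// (le_trans (abs_sin_le _))//.
by rewrite normrM (gtr0_norm t0) ler_piMl// ltW.
Qed.

Lemma rotJ_num_le c g t : 0 <= c <= 1 -> `|g| <= 1 -> 0 < t ->
  `|expR (- (c * t)) * cos (g * t) - 1| <= 2 * Num.min 1 t.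
Proof.
move=> /andP[c0 c1] g1 t0.
(* With this splitting each of the two differences is at most [t], uniformly in [c] and [g]. *)
rewrite [X in `|X|](_ : _ = expR (- (c * t)) * (cos (g * t) - 1) + (expR (- (c * t)) - 1)); last by ring.
have e1 := expN_le1 c0 t0.
have ee := expR_ge0 (- (c * t)).
have B1 : `|cos (g * t) - 1| <= t.
  rewrite -(@cos0 R) (le_trans (cos_diff_le _ _))// subr0 normrM (gtr0_norm t0).
  by rewrite ler_piMl// ltW.
have B2 : `|expR (- (c * t)) - 1| <= t.
  rewrite ler0_norm ?subr_le0// opprB lerBlDr -lerBlDl.
  by rewrite (le_trans _ (expR_ge1Dx _))// lerD2l lerN2 ler_piMl// ltW.
rewrite minr_pMr// le_min; apply/andP; split.
  rewrite [X in `|X|](_ : _ = expR (- (c * t)) * cos (g * t) - 1); last by ring.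
  rewrite (le_trans (ler_normB _ _))// normr1 [leRHS](_ : _ = 1 + 1) ?mulr1//.
  rewrite lerD2r normrM (ger0_norm ee).
  by rewrite -[leRHS]mulr1 ler_pM ?cos_max.
rewrite (le_trans (ler_normD _ _))// mulr_natl mulr2n lerD//.
by rewrite normrM (ger0_norm ee) -[leRHS]mul1r ler_pM.
Qed.

Lemma rotJ_le c g t : 0 <= c <= 1 -> `|g| <= 1 -> 0 < t ->
  `|rotJ c g t| <= 2 * (t `^ (- s - 1) * Num.min 1 t).
Proof.
move=> c01 g1 t0; rewrite /rotJ normrM (ger0_norm (powR_ge0 _ _)) mulrCA.
by rewrite ler_wpM2l ?powR_ge0// rotJ_num_le.
Qed.

Let measurable_scale (f : R -> R) g : measurable_fun setT f ->
  measurable_fun setT (fun t => f (g * t)).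
Proof. by move=> mf; apply: (measurableT_comp mf); exact: measurable_funM. Qed.

Let measurable_expN c : measurable_fun setT (fun t : R => expR (- (c * t))).
Proof.
apply: (measurableT_comp (@measurable_expR R)).
by apply: measurableT_comp => //; exact: measurable_funM.
Qed.

Lemma measurable_rotI c g : measurable_fun setT (rotI c g).
Proof.
apply: measurable_funM; first exact: measurable_powRT.
by apply: measurable_funM => //; exact: measurable_scale measurable_sin.
Qed.

Lemma measurable_rotJ c g : measurable_fun setT (rotJ c g).
Proof.
apply: measurable_funM; first exact: measurable_powRT.
apply: measurable_funB => //.
by apply: measurable_funM => //; exact: measurable_scale measurable_cos.
Qed.

Lemma integrable_rotI c g : 0 <= c -> `|g| <= 1 -> mu.-integrable pos (EFin \o rotI c g).
Proof.
move=> c0 g1; have [D iD HD] := integrable_powRN_min s01.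
apply: (@integrable_dom _ _ _ mu pos _ D) => //.
- exact: measurable_funS measurableT (@subsetT _ _) (measurable_rotI c g).
- by move=> t; rewrite posE => t0; exact: le_trans (rotI_le c0 g1 t0) (HD t t0).
Qed.

Lemma integrable_rotJ c g : 0 <= c <= 1 -> `|g| <= 1 -> mu.-integrable pos (EFin \o rotJ c g).
Proof.
move=> c0 g1; have [D iD HD] := integrable_powRN_min s01.
apply: (@integrable_dom _ _ _ mu pos _ (fun t => 2 * D t)) => //.
- exact: measurable_funS measurableT (@subsetT _ _) (measurable_rotJ c g).
- under [X in integrable _ _ X]eq_fun do rewrite /= EFinM.
  exact: integrableZl.
- move=> t; rewrite posE => t0; apply: le_trans (rotJ_le c0 g1 t0) _.
  by rewrite ler_wpM2l ?HD.
Qed.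

(** [drotI] and [drotJ] are the derivatives in [x] of [rotI] and [rotJ] along [c = cos x],
    [g = sin x]; the factor [gker (1 - s) c t] is [t^(-s) exp (-c t)]. *)
Definition drotI c g t : R := gker (1 - s) c t * (g * sin (g * t) + c * cos (g * t)).
Definition drotJ c g t : R := gker (1 - s) c t * (g * cos (g * t) - c * sin (g * t)).

Let sE : 1 - s - 1 = - s. Proof. by ring. Qed.

Let drot_le (A B c g t : R) : `|c| <= 1 -> `|g| <= 1 -> `|A| <= 1 -> `|B| <= 1 ->
  `|gker (1 - s) c t * (g * A + c * B)| <= 2 * gker (1 - s) c t.
Proof.
move=> c1 g1 A1 B1; rewrite normrM (ger0_norm (gker_ge0 _ _ _)) mulrC ler_wpM2r ?gker_ge0//.
rewrite (le_trans (ler_normD _ _))// -[leRHS]/(1 + 1) !normrM.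
by apply: lerD; rewrite -[leRHS]mulr1 ler_pM.
Qed.

Lemma drotI_le c g t : `|c| <= 1 -> `|g| <= 1 -> `|drotI c g t| <= 2 * gker (1 - s) c t.
Proof. by move=> c1 g1; apply: drot_le => //; [exact: sin_max|exact: cos_max]. Qed.

Lemma drotJ_le c g t : `|c| <= 1 -> `|g| <= 1 -> `|drotJ c g t| <= 2 * gker (1 - s) c t.
Proof.
move=> c1 g1; rewrite /drotJ -mulrN; apply: drot_le => //; first exact: cos_max.
by rewrite normrN; exact: sin_max.
Qed.

Let is_derive_scale (f df : R -> R) g t : (forall x, is_derive x 1 f (df x)) ->
  is_derive t 1 (fun u => f (g * u)) (df (g * t) * g).
Proof.
move=> hf.
have d1 : is_derive t 1 (fun u : R => g * u) g.
  rewrite -[X in is_derive _ _ _ X]mulr1.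
  exact: is_deriveZ.
exact: (@is_derive1_comp R f (fun u => g * u) t _ _ (hf _) d1).
Qed.

Let cs (f : R -> R) g t : continuous f -> {for t, continuous (fun u => f (g * u))}.
Proof.
move=> cf; apply: continuous_comp; last exact: cf.
by apply: cvgM; [exact: cvg_cst|exact: cvg_id].
Qed.

Let cpow z t : 0 < t -> {for t, continuous (fun t => t `^ z)}.
Proof. by move=> t0; exact: (is_derive_cont (is_derive1_powR z t0)). Qed.

Let cexp c t : {for t, continuous (fun t : R => expR (- (c * t)))}.
Proof. exact: (is_derive_cont (is_derive_expRM c t)). Qed.

Let cdrotI c g t : 0 < t -> {for t, continuous (drotI c g)}.
Proof.
move=> t0; apply: cvgM; first exact: continuous_gker.
by apply: cvgD; (apply: cvgM; first exact: cvg_cst); apply: cs; [exact: continuous_sin|exact: continuous_cos].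
Qed.

Let cdrotJ c g t : 0 < t -> {for t, continuous (drotJ c g)}.
Proof.
move=> t0; apply: cvgM; first exact: continuous_gker.
by apply: cvgB; (apply: cvgM; first exact: cvg_cst); apply: cs; [exact: continuous_cos|exact: continuous_sin].
Qed.

Let integrable_drot (f : R -> R) c g : 0 < c -> (forall t, 0 < t -> {for t, continuous f}) ->
  (forall t, `|f t| <= 2 * gker (1 - s) c t) -> mu.-integrable pos (EFin \o f).
Proof.
move=> c0 cf fg; apply: (@integrable_dom _ _ _ mu pos _ (fun t => 2 * gker (1 - s) c t)) => //.
- by apply: open_cts_measurable => // t; rewrite posE; exact: cf.
- under [X in integrable _ _ X]eq_fun do rewrite /= EFinM.
  by apply: integrableZl => //; exact: integrable_gker.
Qed.

Lemma integrable_drotI c g : 0 < c <= 1 -> `|g| <= 1 -> mu.-integrable pos (EFin \o drotI c g).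
Proof.
move=> /andP[c0 c1] g1; apply: (integrable_drot g c0); first by move=> t; exact: cdrotI.
by move=> t; apply: drotI_le => //; rewrite gtr0_norm.
Qed.

Lemma integrable_drotJ c g : 0 < c <= 1 -> `|g| <= 1 -> mu.-integrable pos (EFin \o drotJ c g).
Proof.
move=> /andP[c0 c1] g1; apply: (integrable_drot g c0); first by move=> t; exact: cdrotJ.
by move=> t; apply: drotJ_le => //; rewrite gtr0_norm.
Qed.

(** Boundary terms of the integrations by parts: the bound by [t] gives [t^(1-s)] at 0, the bound by
    1 gives [t^(-s)] at infinity, so both restrictions on [s] enter. *)
Let vanish (h : R -> R) : (forall t, 0 < t -> `|h t| <= 2 * Num.min 1 t) ->
  invn n `^ (- s) * h (invn n) @[n --> \oo] --> (0 : R) /\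
  natn n `^ (- s) * h (natn n) @[n --> \oo] --> (0 : R).
Proof.
move=> hb; split; apply: norm_cvg0.
  apply: (@squeeze_cvgr _ _ _ _ (fun=> 0) (fun n => 2 * invn n `^ (1 - s))); last 2 first.
  - exact: cvg_cst.
  - by rewrite -(mulr0 2); apply: cvgM; [exact: cvg_cst|exact: cvg_powR_invn].
  apply: nearW => n; rewrite normr_ge0/= normrM (ger0_norm (powR_ge0 _ _)).
  have n0 := @invn_gt0 R n.
  rewrite -(powR_shift (1 - s) n0) sE mulrCA ler_wpM2l ?powR_ge0// (le_trans (hb _ n0))//.
  by rewrite ler_wpM2l// ge_min lexx orbT.
apply: (@squeeze_cvgr _ _ _ _ (fun=> 0) (fun n => 2 * natn n `^ (- s))); last 2 first.
- exact: cvg_cst.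
- by rewrite -(mulr0 2); apply: cvgM; [exact: cvg_cst|exact: cvg_natn_powRN].
apply: nearW => n; rewrite normr_ge0/= normrM (ger0_norm (powR_ge0 _ _)) mulrC.
rewrite ler_wpM2r ?powR_ge0// (le_trans (hb _ _)) ?ltr0n//.
by rewrite -[leRHS]mulr1 ler_wpM2l// ge_min lexx.
Qed.

(** The integrand is also [- t^(-s)] times the derivative in [t] of [exp (-c t) cos (g t) - 1], so
    integrating by parts in [t] turns it into [rotJ]. Integrability of [drotI] at infinity comes
    from [c > 0]. *)
Lemma integral_drotI c g : 0 < c <= 1 -> `|g| <= 1 ->
  \int[mu]_(t in pos) drotI c g t = - s * \int[mu]_(t in pos) rotJ c g t.
Proof.
move=> c01 g1; have /andP[c0 c1] := c01.
have c01' : 0 <= c <= 1 by rewrite ltW.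
pose h t := expR (- (c * t)) * cos (g * t) - 1.
pose G t := t `^ (- s) * h t.
pose f t := - s * rotJ c g t - drotI c g t.
have dG t : pos t -> is_derive t 1 G (f t).
  rewrite posE => t0.
  have dh : is_derive t 1 h (- c * expR (- (c * t)) * cos (g * t) - expR (- (c * t)) * (g * sin (g * t))).
    apply: is_derive_eq (is_deriveB (is_deriveM (is_derive_expRM c t)
      (is_derive_scale g t (@is_derive_cos R))) (is_derive_cst (1:R) t (1:R))) _.
    by rewrite /GRing.scale/=; ring.
  apply: is_derive_eq (is_deriveM (is_derive1_powR (- s) t0) dh) _.
  by rewrite /GRing.scale/= /f /rotJ /drotI /gker sE /h; ring.
have cf t : pos t -> {for t, continuous f}.
  rewrite posE => t0; apply: cvgB; last exact: cdrotI.
  apply: cvgM; first exact: cvg_cst.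
  apply: cvgM; first exact: cpow.
  apply: cvgB; last exact: cvg_cst.
  by apply: cvgM; [exact: cexp|apply: cs; exact: continuous_cos].
have [Gl0 Gl1] := vanish (h := h) (fun t ht => rotJ_num_le c01' g1 ht).
have i1 : mu.-integrable pos (EFin \o (fun t => - s * rotJ c g t)).
  under [X in integrable _ _ X]eq_fun do rewrite /= EFinM.
  by apply: integrableZl => //; exact: integrable_rotJ.
have i2 := integrable_drotI c01 g1.
have iff : mu.-integrable pos (EFin \o f).
  rewrite (_ : EFin \o f = ((EFin \o (fun t => (- s * rotJ c g t)%R)) \- (EFin \o drotI c g))%E)//.
  by apply: integrableB.
have := exhausts_FTC (@exhausts_pos R) dG cf Gl0 Gl1 iff.
rewrite /f (RintegralB _ i1 i2)// (RintegralZl _ _ (integrable_rotJ c01' g1))//.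
by rewrite subrr => /eqP; rewrite subr_eq0 => /eqP.
Qed.

Lemma integral_drotJ c g : 0 < c <= 1 -> `|g| <= 1 ->
  \int[mu]_(t in pos) drotJ c g t = s * \int[mu]_(t in pos) rotI c g t.
Proof.
move=> c01 g1; have /andP[c0 c1] := c01.
pose h t := expR (- (c * t)) * sin (g * t).
pose G t := t `^ (- s) * h t.
pose f t := drotJ c g t - s * rotI c g t.
have dG t : pos t -> is_derive t 1 G (f t).
  rewrite posE => t0.
  have dh : is_derive t 1 h (- c * expR (- (c * t)) * sin (g * t) + expR (- (c * t)) * (g * cos (g * t))).
    apply: is_derive_eq (is_deriveM (is_derive_expRM c t)
      (is_derive_scale g t (@is_derive_sin R))) _.
    by rewrite /GRing.scale/=; ring.
  apply: is_derive_eq (is_deriveM (is_derive1_powR (- s) t0) dh) _.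
  by rewrite /GRing.scale/= /f /rotI /drotJ /gker sE /h; ring.
have cf t : pos t -> {for t, continuous f}.
  rewrite posE => t0; apply: cvgB; first exact: cdrotJ.
  apply: cvgM; first exact: cvg_cst.
  apply: cvgM; first exact: cpow.
  by apply: cvgM; [exact: cexp|apply: cs; exact: continuous_sin].
have hb t : 0 < t -> `|h t| <= 2 * Num.min 1 t.
  move=> t0; rewrite normrM (ger0_norm (expR_ge0 _)).
  have m0 : 0 <= Num.min 1 t by rewrite le_min ler01 ltW.
  apply: (@le_trans _ _ (Num.min 1 t)); last by rewrite ler_peMl// ler1n.
  rewrite le_min; apply/andP; split.
    by rewrite -[leRHS]mulr1 ler_pM ?expR_ge0 ?(expN_le1 (ltW c0) t0) ?sin_max.
  rewrite -[leRHS]mul1r ler_pM ?expR_ge0 ?(expN_le1 (ltW c0) t0)// (le_trans (abs_sin_le _))//.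
  by rewrite normrM (gtr0_norm t0) ler_piMl// ltW.
have [Gl0 Gl1] := vanish hb.
have i1 : mu.-integrable pos (EFin \o (fun t => s * rotI c g t)).
  under [X in integrable _ _ X]eq_fun do rewrite /= EFinM.
  by apply: integrableZl => //; apply: integrable_rotI => //; exact: ltW.
have i2 := integrable_drotJ c01 g1.
have iff : mu.-integrable pos (EFin \o f).
  rewrite (_ : EFin \o f = ((EFin \o drotJ c g) \- (EFin \o (fun t => (s * rotI c g t)%R)))%E)//.
  by apply: integrableB.
have := exhausts_FTC (@exhausts_pos R) dG cf Gl0 Gl1 iff.
rewrite /f (RintegralB _ i2 i1)// (RintegralZl _ _ (integrable_rotI (ltW c0) g1))//.
by rewrite subrr => /eqP; rewrite subr_eq0 => /eqP.
Qed.

End rotation.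
End sine_integral.

Section sine_integral_value.
Context {R : realType}.
Implicit Types r t u x y z w : R.
Local Notation mu := (@lebesgue_measure R).
Local Notation pos := (`]0, +oo[%classic : set R).
Variable s : R.
Hypothesis s01 : 0 < s < 1.
Let s0 : 0 < s. Proof. by case/andP: s01. Qed.
Let s1 : s < 1. Proof. by case/andP: s01. Qed.

Let I x : R := \int[mu]_(t in pos) rotI s (cos x) (sin x) t.
Let J x : R := \int[mu]_(t in pos) rotJ s (cos x) (sin x) t.

Let cosb x : 0 < x < pi / 2 -> 0 < cos x <= 1.
Proof.
move=> /andP[px xp]; rewrite cos_le1 andbT cos_gt0_pihalf// xp andbT.
by rewrite (lt_trans _ px)// oppr_lt0 divr_gt0// pi_gt0.
Qed.

(** Near a point of the open interval the cosine stays above some [cos v > 0], so a single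
    integrable kernel with exponential decay at rate [cos v] dominates the derivatives. At [pi / 2]
    this decay is lost, and only continuity is used there. *)
Let near_interval x : 0 < x < pi / 2 -> exists u v : R, [/\ `]u, v[%classic x, 0 < cos v &
  forall y, `]u, v[%classic y -> 0 < y < pi / 2 /\ cos v <= cos y].
Proof.
move=> /andP[px xp]; exists (x / 2), ((x + pi / 2) / 2).
have xv := midf_lt xp.
split.
- by rewrite /= in_itv/= xv andbT ltr_pdivrMr// ltr_pMr// ltr1n.
- have : 0 < (x + pi / 2) / 2 < pi / 2 by rewrite xv andbT (lt_trans px)// xv.
  by move=> /cosb/andP[].
move=> y /=; rewrite in_itv/= => /andP[uy yv].
have yp : y < pi / 2 by rewrite (lt_trans yv)// xv.
have y0 : 0 < y by rewrite (lt_trans _ uy)// divr_gt0.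
have pp : (pi : R) / 2 <= pi by rewrite ler_pdivrMr ?ler_peMr ?pi_ge0// ler1n.
split; first by rewrite y0.
rewrite ltW// ltr_cos// in_itv/= ltW//=.
- by rewrite (le_trans _ pp)// ltW.
- by rewrite (le_trans _ pp)// ltW// xv.
- exact: lt_trans y0 yv.
Qed.

Let dcomp (f df : R -> R) (h : R -> R) (dh : R) x :
  (forall y : R, is_derive y 1 f (df y)) -> is_derive x 1 h dh ->
  is_derive x 1 (fun y => f (h y)) (df (h x) * dh).
Proof. by move=> hf dhx; exact: (@is_derive1_comp R f h x _ _ (hf _) dhx). Qed.

Let dexp x t : is_derive x 1 (fun y => expR (- (cos y * t))) (expR (- (cos x * t)) * (t * sin x)).
Proof.
have d1 : is_derive x 1 (fun y : R => - (cos y * t)) (t * sin x).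
  under eq_fun do rewrite mulrC -mulNr.
  apply: is_derive_eq (is_deriveZ (- t) (is_derive_cos x)) _.
  by rewrite /GRing.scale/= mulrNN.
exact: (@is_derive1_comp R expR (fun y => - (cos y * t)) x _ _ (is_derive_expR _) d1).
Qed.

Let dsc x t : is_derive x 1 (fun y : R => sin y * t) (t * cos x).
Proof.
under eq_fun do rewrite mulrC.
exact: (is_deriveZ t (is_derive_sin x)).
Qed.

Let d_rotI x t : 0 < t ->
  is_derive x 1 (fun y => rotI s (cos y) (sin y) t) (drotI s (cos x) (sin x) t).
Proof.
move=> pt.
have d2 := dcomp (@is_derive_sin R) (dsc x t).
apply: is_derive_eq (is_deriveZ (t `^ (- s - 1)) (is_deriveM (dexp x t) d2)) _.
rewrite /GRing.scale/= /drotI /gker (_ : 1 - s - 1 = - s); last by ring.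
by rewrite -(powR_shift (- s) pt); ring.
Qed.

Let d_rotJ x t : 0 < t ->
  is_derive x 1 (fun y => rotJ s (cos y) (sin y) t) (drotJ s (cos x) (sin x) t).
Proof.
move=> pt.
have d2 := dcomp (@is_derive_cos R) (dsc x t).
apply: is_derive_eq (is_deriveZ (t `^ (- s - 1)) (is_deriveB (is_deriveM (dexp x t) d2)
  (is_derive_cst (1:R) x (1:R)))) _.
rewrite /GRing.scale/= /drotJ /gker (_ : 1 - s - 1 = - s); last by ring.
by rewrite -(powR_shift (- s) pt); ring.
Qed.

Let gker_le z c c' t : 0 < t -> c <= c' -> gker z c' t <= gker z c t.
Proof.
move=> pt cc; rewrite ler_wpM2l ?powR_ge0// ler_expR lerN2.
by rewrite ler_wpM2r// ltW.
Qed.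

Let under_int (f df : R -> R -> R) x : 0 < x < pi / 2 ->
  (forall y, 0 < y < pi / 2 -> mu.-integrable pos (EFin \o f y)) ->
  (forall y t, 0 < t -> is_derive y 1 (f^~ t) (df y t)) ->
  (forall y t, `|df y t| <= 2 * gker (1 - s) (cos y) t) ->
  is_derive x 1 (fun y => \int[mu]_(t in pos) f y t) (\int[mu]_(t in pos) df x t).
Proof.
move=> hx hi hd hb; have [u [v [uvx cv huv]]] := near_interval hx.
have iG : mu.-integrable pos (EFin \o (fun t => 2 * gker (1 - s) (cos v) t)).
  under [X in integrable _ _ X]eq_fun do rewrite /= EFinM.
  by apply: integrableZl => //; apply: integrable_gker => //; rewrite subr_gt0.
have pE y t : pos t -> partial1of2 f y t = df y t.
  rewrite posE => pt; rewrite partial1of2E.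
  exact: (@derive_val _ _ _ _ _ _ _ (hd y t pt)).
have Hint y : `]u, v[%classic y -> mu.-integrable pos (EFin \o f y).
  by move=> /huv[hy _]; exact: hi.
have Hder y t : `]u, v[%classic y -> pos t -> derivable (f^~ t) y 1.
  by move=> _; rewrite posE => pt; case: (hd y t pt).
have G0 t : 0 <= 2 * gker (1 - s) (cos v) t by rewrite mulr_ge0 ?gker_ge0.
have Hub y t : `]u, v[%classic y -> pos t -> `|partial1of2 f y t| <= 2 * gker (1 - s) (cos v) t.
  move=> /huv[_ cy] pt; rewrite pE// (le_trans (hb _ _))// ler_wpM2l//.
  by apply: gker_le => //; rewrite -posE.
apply: DeriveDef.
  exact: (@derivable_under_integral R _ _ mu f pos measurable_pos x u v uvx Hint Hder _ G0 iG Hub).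
rewrite -derive1E (@differentiation_under_integral R _ _ mu f pos measurable_pos x u v uvx Hint Hder _ G0 iG Hub).
by apply: eq_Rintegral => t; rewrite inE => pt; rewrite pE.
Qed.

Let cos1 x : `|cos x| <= 1. Proof. exact: cos_max. Qed.
Let sin1 x : `|sin x| <= 1. Proof. exact: sin_max. Qed.

Let dI x : 0 < x < pi / 2 -> is_derive x 1 I (- s * J x).
Proof.
move=> hx; have hc := cosb hx; rewrite /J -integral_drotI//.
apply: (@under_int (fun y => rotI s (cos y) (sin y)) (fun y => drotI s (cos y) (sin y))) => //.
- by move=> y /cosb/andP[cy _]; apply: integrable_rotI => //; exact: ltW.
- by move=> y t; exact: drotI_le.
Qed.

Let dJ x : 0 < x < pi / 2 -> is_derive x 1 J (s * I x).
Proof.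
move=> hx; have hc := cosb hx; rewrite /I -integral_drotJ//.
apply: (@under_int (fun y => rotJ s (cos y) (sin y)) (fun y => drotJ s (cos y) (sin y))) => //.
- by move=> y /cosb/andP[cy cy1]; apply: integrable_rotJ => //; rewrite ltW.
- by move=> y t; exact: drotJ_le.
Qed.

(** Continuity under the integral sign is applied on the open interval []-1, 2[], which contains
    [[0, pi/2]] but also points where the cosine is negative. Replacing [cos] by its absolute value
    keeps the bounds there and changes nothing on [[0, pi/2]]. *)
Let cont_abs (f : R -> R -> R -> R) :
  (forall c g, 0 <= c <= 1 -> `|g| <= 1 -> mu.-integrable pos (EFin \o f c g)) ->
  (forall t, 0 < t -> continuous (fun x => f `|cos x| (sin x) t)) ->
  (forall c g t, 0 <= c <= 1 -> `|g| <= 1 -> 0 < t -> `|f c g t| <= 2 * (t `^ (- s - 1) * Num.min 1 t)) ->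
  {within `[0, pi / 2], continuous (fun x => \int[mu]_(t in pos) f (cos x) (sin x) t)}.
Proof.
move=> hi hc hb.
have ac x : 0 <= `|cos x| <= 1 by rewrite normr_ge0/= cos1.
have H : {in `]-1, 2[%classic, continuous (fun x => \int[mu]_(t in pos) f `|cos x| (sin x) t)}.
  have [D iD HD] := integrable_powRN_min s01.
  apply: (@continuity_under_integral R _ _ mu (fun x t => f `|cos x| (sin x) t) pos
    measurable_pos (-1) 2 _ _ (fun t => 2 * D t)).
  - by move=> x _; exact: hi.
  - by apply: aeW => t; rewrite posE => pt x _; exact: hc.
  - under [X in integrable _ _ X]eq_fun do rewrite /= EFinM.
    exact: integrableZl.
  - move=> x _; apply: aeW => t; rewrite posE => pt.
    by rewrite (le_trans (hb _ _ _ _ _ _))// ler_wpM2l// HD.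
have sub : `[0, pi / 2]%classic `<=` (`]-1, 2[%classic : set R).
  move=> x /=; rewrite !in_itv/= => /andP[x0 xp].
  by rewrite (lt_le_trans _ x0)//= (le_lt_trans xp)// pihalf_lt2.
apply: (@subspace_eq_continuous _ _ _ (fun x => \int[mu]_(t in pos) f `|cos x| (sin x) t)).
  move=> x; rewrite inE/= in_itv/= => /andP[x0 xp].
  rewrite ger0_norm// cos_ge0_pihalf// xp andbT.
  by rewrite (le_trans _ x0)// oppr_le0 divr_ge0 ?pi_ge0.
by apply: continuous_in_subspaceT => x; rewrite inE => /sub hx; apply: H; rewrite inE.
Qed.

Let cabs_exp t : continuous (fun x => expR (- (`|cos x| * t)) : R).
Proof.
move=> x; apply: continuous_comp; last exact: continuous_expR.
apply: cvgN; apply: cvgM; last exact: cvg_cst.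
by apply: cvg_norm; exact: continuous_cos.
Qed.

Let cI : {within `[0, pi / 2], continuous I}.
Proof.
apply: (cont_abs (f := rotI s)).
- by move=> c g /andP[c0 _]; exact: integrable_rotI.
- move=> t pt x; apply: cvgM; first exact: cvg_cst.
  apply: cvgM; first exact: cabs_exp.
  apply: continuous_comp; last exact: continuous_sin.
  by apply: cvgM; [exact: continuous_sin|exact: cvg_cst].
- move=> c g t /andP[c0 _] g1 pt; rewrite (le_trans (rotI_le s c0 g1 pt))//.
  by rewrite ler_peMl ?ler1n// mulr_ge0 ?powR_ge0// le_min ler01 ltW.
Qed.

Let cJ : {within `[0, pi / 2], continuous J}.
Proof.
apply: (cont_abs (f := rotJ s)).
- by move=> c g; exact: integrable_rotJ.
- move=> t pt x; apply: cvgM; first exact: cvg_cst.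
  apply: cvgB; last exact: cvg_cst.
  apply: cvgM; first exact: cabs_exp.
  apply: continuous_comp; last exact: continuous_cos.
  by apply: cvgM; [exact: continuous_sin|exact: cvg_cst].
- by move=> c g t; exact: rotJ_le.
Qed.

Let const (f : R -> R) : {within `[0, pi / 2], continuous f} ->
  (forall x, 0 < x < pi / 2 -> is_derive x 1 f 0) -> f (pi / 2) = f 0.
Proof.
move=> cf df.
have p0 : (0 : R) < pi / 2 by rewrite divr_gt0 ?pi_gt0.
have [c _] := @MVT R f (fun=> 0) 0 (pi / 2) p0 (fun x hx => df x hx) cf.
by rewrite mul0r => /eqP; rewrite subr_eq0 => /eqP.
Qed.

Let dsin x : is_derive x 1 (fun x => sin (s * x)) (s * cos (s * x)).
Proof.
have d1 : is_derive x 1 (fun y : R => s * y) s.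
  rewrite -[X in is_derive _ _ _ X]mulr1.
  exact: is_deriveZ.
by rewrite mulrC; exact: dcomp (@is_derive_sin R) d1.
Qed.

Let dcos x : is_derive x 1 (fun x => cos (s * x)) (- s * sin (s * x)).
Proof.
have d1 : is_derive x 1 (fun y : R => s * y) s.
  rewrite -[X in is_derive _ _ _ X]mulr1.
  exact: is_deriveZ.
by rewrite mulrC mulrN -mulNr; exact: dcomp (@is_derive_cos R) d1.
Qed.

Let csin : {within `[0, pi / 2], continuous (fun x => sin (s * x))}.
Proof. by apply: continuous_subspaceT => x; exact: (is_derive_cont (dsin x)). Qed.

Let ccos : {within `[0, pi / 2], continuous (fun x => cos (s * x))}.
Proof. by apply: continuous_subspaceT => x; exact: (is_derive_cont (dcos x)). Qed.

(** From [I' = -s J] and [J' = s I], the combinations [A] and [B] are constant. At 0 the values are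
    [I 0 = 0] and [s J 0 = - Gamma (1 - s)]; at [pi / 2] the exponential factor is 1 and [I] is the
    sine integral, recovered from [A] and [B] by [cos^2 + sin^2 = 1]. *)
Lemma integral_powRN_sin :
  s * \int[mu]_(t in pos) (t `^ (- s - 1) * sin t) = Gamma (1 - s) * sin (pi * s / 2).
Proof.
pose A x := I x * cos (s * x) + J x * sin (s * x).
pose B x := I x * sin (s * x) - J x * cos (s * x).
have A0 : A (pi / 2) = A 0.
  apply: const.
    by move=> x; apply: cvgD; apply: cvgM; [exact: cI|exact: ccos|exact: cJ|exact: csin].
  move=> x hx.
  apply: is_derive_eq (is_deriveD (is_deriveM (dI hx) (dcos x)) (is_deriveM (dJ hx) (dsin x))) _.
  by rewrite /GRing.scale/=; ring.
have B0 : B (pi / 2) = B 0.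
  apply: const.
    by move=> x; apply: cvgB; apply: cvgM; [exact: cI|exact: csin|exact: cJ|exact: ccos].
  move=> x hx.
  apply: is_derive_eq (is_deriveB (is_deriveM (dI hx) (dsin x)) (is_deriveM (dJ hx) (dcos x))) _.
  by rewrite /GRing.scale/=; ring.
have I0 : I 0 = 0.
  rewrite /I (@eq_Rintegral _ _ _ mu pos (fun=> 0)) ?Rintegral_cst ?mul0r//.
  by move=> t _; rewrite /rotI sin0 mul0r sin0 !mulr0.
have J0 : s * J 0 = - Gamma (1 - s).
  have := @integral_drotI R s s01 1 0; rewrite ltr01 lexx normr0 ler01 => /(_ isT isT).
  rewrite /J cos0 sin0 mulNr => /eqP; rewrite eq_sym eqr_oppLR => /eqP ->.
  congr (- _); rewrite GammaE; apply: eq_Rintegral => t _.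
  by rewrite /drotI mul0r add0r !mul0r cos0 !mulr1.
have Ipi : I (pi / 2) = \int[mu]_(t in pos) (t `^ (- s - 1) * sin t).
  apply: eq_Rintegral => t _.
  by rewrite /rotI cos_pihalf sin_pihalf mul0r oppr0 expR0 !mul1r.
rewrite -Ipi.
have E : I (pi / 2) = A (pi / 2) * cos (s * (pi / 2)) + B (pi / 2) * sin (s * (pi / 2)).
  rewrite /A /B.
  transitivity (I (pi / 2) * (cos (s * (pi / 2)) ^+ 2 + sin (s * (pi / 2)) ^+ 2)); last by ring.
  by rewrite cos2Dsin2 mulr1.
have A00 : A 0 = 0 by rewrite /A I0 mulr0 sin0 mulr0 mul0r addr0.
have B00 : B 0 = - J 0 by rewrite /B I0 mulr0 mul0r cos0 mulr1 sub0r.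
rewrite E A0 B0 A00 B00 mul0r add0r mulrA mulrN J0 opprK; congr (_ * sin _); ring.
Qed.

End sine_integral_value.

(** * Asymptotics at the origin *)

Section asymptotics.
Context {R : realType}.
Implicit Types a b q r t u w x y z : R.
Local Notation mu := (@lebesgue_measure R).
Local Notation pos := (`]0, +oo[%classic : set R).

Lemma Rintegral_indicM (A : set R) (f : R -> R) :
  \int[mu]_t (\1_A t * f t) = \int[mu]_(t in A) f t.
Proof.
rewrite [RHS]Rintegral_mkcond; apply: eq_Rintegral => t _.
by rewrite patchE indicE; case: (t \in _); rewrite ?mul1r ?mul0r.
Qed.

Lemma integrable_indicM (A : set R) (f : R -> R) : measurable A ->
  mu.-integrable A (EFin \o f) ->
  mu.-integrable setT (EFin \o (fun t => \1_A t * f t)).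
Proof.
move=> mA H; have : mu.-integrable setT ((EFin \o f) \_ A).
  by apply/(integrable_mkcond _ _).1.
rewrite (_ : (EFin \o f) \_ _ = EFin \o (fun t => \1_A t * f t))//.
by apply/funext => t; rewrite /= patchE indicE; case: (t \in _); rewrite ?mul1r ?mul0r.
Qed.

(** The double integral of [u^q x^b exp (-(1 + u) x)] over positive [u] and [x] is evaluated in both
    orders: integrating over [x] first produces the density, integrating over [u] first produces the
    two Gamma factors in the numerator. *)
Lemma pdens_moment b q : 0 < q < b ->
  \int[mu]_u (pdens b u * u `^ q) = b * Gamma (q + 1) * Gamma (b - q) / Gamma (b + 1).
Proof.
move=> /andP[q0 qb]; have b0 : 0 < b := lt_trans q0 qb.
have q1 : 0 < q + 1 by rewrite addr_gt0.
have b1 : 0 < b + 1 by rewrite addr_gt0.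
have bq : 0 < b - q by rewrite subr_gt0.
have Gb0 : 0 < Gamma (b + 1) by exact: Gamma_gt0.
pose f u x : R := (\1_pos u * u `^ q) * (\1_pos x * (x `^ b * expR (- ((1 + u) * x)))).
have f0 u x : 0 <= f u x by rewrite !mulr_ge0 ?powR_ge0 ?expR_ge0.
have i1 u : 0 < u -> mu.-integrable pos (EFin \o gker (b + 1) (1 + u)).
  by move=> pu; apply: integrable_gker => //; rewrite addr_gt0.
have E1 u x : 0 < u -> f u x = u `^ q * (\1_pos x * gker (b + 1) (1 + u) x).
  by move=> pu; rewrite /f /gker addrK indicE mem_set ?mul1r// posE.
have E0 u x : u <= 0 -> f u x = 0.
  by move=> pu; rewrite /f indicE memNset ?mul0r// posE; apply/negP; rewrite -leNgt.
have if1 u : mu.-integrable setT (EFin \o f u).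
  have [u0|u0] := leP u 0.
    by rewrite (_ : f u = cst 0) ?integrable0//; apply/funext => x; rewrite E0.
  rewrite (_ : EFin \o f u = (fun x => (u `^ q)%:E * (\1_pos x * gker (b + 1) (1 + u) x)%:E)%E).
    by apply: integrableZl => //; apply: integrable_indicM => //; exact: i1.
  by apply/funext => x; rewrite /= E1.
have I1 u : \int[mu]_x f u x = Gamma (b + 1) / b * (pdens b u * u `^ q).
  have [u0|u0] := leP u 0.
    rewrite pdens0// mul0r mulr0 (_ : (fun x => _) = cst 0) ?Rintegral_cst ?mul0r//.
    by apply/funext => x; rewrite E0.
  under eq_Rintegral do rewrite E1//.
  rewrite RintegralZl//; last by apply: integrable_indicM => //; exact: i1.
  rewrite Rintegral_indicM integral_gker ?addr_gt0// pdensE// opprD.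
  by field; rewrite gt_eqF.
have E2 u x : 0 < x -> f u x = (x `^ b * expR (- x)) * (\1_pos u * gker (q + 1) x u).
  move=> px; rewrite /f /gker addrK [\1_pos x]indicE mem_set ?posE//= mul1r.
  by rewrite mulrDl mul1r opprD expRD (mulrC u); ring.
have E3 u x : x <= 0 -> f u x = 0.
  by move=> px; rewrite /f [\1_pos x]indicE memNset ?mul0r ?mulr0// posE; apply/negP; rewrite -leNgt.
have I2 x : \int[mu]_u f u x = Gamma (q + 1) * (\1_pos x * gker (b - q) 1 x).
  have [x0|x0] := leP x 0.
    rewrite indicE memNset ?mul0r ?mulr0; last by rewrite posE; apply/negP; rewrite -leNgt.
    by under eq_Rintegral do rewrite E3//; rewrite Rintegral_cst// mul0r.
  under eq_Rintegral do rewrite E2//.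
  rewrite RintegralZl//; last by apply: integrable_indicM => //; exact: integrable_gker.
  rewrite Rintegral_indicM integral_gker// indicE mem_set ?posE//= mul1r /gker mul1r.
  rewrite (_ : b - q - 1 = b + - (q + 1)); last by ring.
  by rewrite powRD ?(@gt_eqF _ _ x) ?implybT//; ring.
have mf : measurable_fun setT (fun p : R * R => f p.1 p.2).
  apply: measurable_funM; apply: measurable_funM.
  - by apply: (measurableT_comp (@measurable_indic _ _ _ setT pos measurable_pos)); exact: measurable_fst.
  - by apply: measurable_fun_powRl; exact: measurable_fst.
  - by apply: (measurableT_comp (@measurable_indic _ _ _ setT pos measurable_pos)); exact: measurable_snd.
  - apply: measurable_funM; first by apply: measurable_fun_powRl; exact: measurable_snd.
    apply: (measurableT_comp (@measurable_expR R)); apply: measurableT_comp => //.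
    apply: measurable_funM; last exact: measurable_snd.
    by apply: measurable_funD => //; exact: measurable_fst.
have iG : mu.-integrable setT (EFin \o (fun u => Gamma (b + 1) / b * (pdens b u * u `^ q))).
  under [X in integrable _ _ X]eq_fun do rewrite /= EFinM.
  by apply: integrableZl => //; apply: integrable_pdens_moment; rewrite ltW.
have fG u : (\int[mu]_x `|(f u x)%:E| <= (Gamma (b + 1) / b * (pdens b u * u `^ q))%:E)%E.
  under eq_integral do rewrite /= ger0_norm//.
  by rewrite -I1 /Rintegral fineK//; apply: integrable_fin_num => //; exact: if1.
have := @Rfubini _ _ _ _ _ mu mu f _ mf iG fG.
under eq_Rintegral do rewrite I1.
rewrite RintegralZl//; last by apply: integrable_pdens_moment; rewrite ltW.
under [in X in _ = X -> _]eq_Rintegral do rewrite I2.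
rewrite RintegralZl//; last by apply: integrable_indicM => //; apply: integrable_gker.
rewrite Rintegral_indicM -GammaE => H.
rewrite -[LHS](mulKf (_ : Gamma (b + 1) / b != 0)); last by rewrite gt_eqF// divr_gt0.
by rewrite H; field; rewrite !gt_eqF.
Qed.

Lemma cvg_pos_right (w_ : nat -> R) : (forall n, 0 < w_ n) ->
  w_ n @[n --> \oo] --> (0 : R) -> w_ @ \oo --> (0 : R)^'+.
Proof.
move=> w0 wcvg A [e /= e0 eA]; move/cvgrPdist_lt: wcvg => /(_ _ e0) H.
by apply: filterS H => n H; exact: eA.
Qed.

Variables a b : R.
Hypotheses (a0 : 0 < a) (b0 : 0 < b).

(* The integrand of spec1 after the substitution u = (y / w)^a. *)
Definition resc w y : R := y `^ (a - 1) * (w `^ a + y `^ a) `^ (- b - 1) * sin y.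

(** The powers of [w] collect to [a (b + 1) - a - 1 = a b - 1]. This isolates the growth at the
    origin when [a b < 1], and leaves no power of [w] when [a b = 1]. *)
Lemma spec1_rescaled w : 0 < w -> mu.-integrable pos (EFin \o resc w) ->
  spec1 a b w = pi^-1 * w `^ (a * b - 1) * (a * b * \int[mu]_(y in pos) resc w y).
Proof.
move=> pw ir; rewrite /spec1 -mulrA; congr (_ * _).
pose G u := b * (1 + u) `^ (- b - 1) * sker (u `^ a^-1) w.
transitivity (\int[mu]_(u in pos) G u).
  rewrite -(Rintegral_indicM pos); apply: eq_Rintegral => u _.
  by rewrite /pdens /G; ring.
have wa0 : 0 < w `^ (- a) by rewrite powR_gt0.
have cG u : 0 < u -> {for u, continuous G}.
  move=> pu; have u1 : 0 < 1 + u by rewrite addr_gt0.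
  apply: cvgM.
    apply: cvgM; first exact: cvg_cst.
    exact: (is_derive_cont (is_derive_powRD (- b - 1) u1)).
  apply: cvgM; last exact: cvg_cst.
  apply: continuous_comp; last exact: continuous_sin.
  apply: cvgM; first exact: cvg_cst.
  exact: (is_derive_cont (is_derive1_powR a^-1 pu)).
rewrite (subst_powR wa0 a0 cG).
have [s hs] := sub_exponentP a0 b0.
have E y : 0 < y -> G (w `^ (- a) * y `^ a) * (w `^ (- a) * (a * y `^ (a - 1))) =
    w `^ (a * b - 1) * (a * b) * resc w y.
  move=> py; rewrite /G /sker.
  have -> : (w `^ (- a) * y `^ a) `^ a^-1 = w^-1 * y.
    rewrite powRM ?powR_ge0// -!powRrM mulNr mulfV ?gt_eqF// powRr1 ?(ltW py)//.
    by rewrite powR_inv1 ?(ltW pw).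
  rewrite mulVKf ?gt_eqF//.
  have wy : 0 < w `^ a + y `^ a by rewrite addr_gt0 ?powR_gt0.
  have -> : 1 + w `^ (- a) * y `^ a = w `^ (- a) * (w `^ a + y `^ a).
    by rewrite mulrDr powRN mulVf// gt_eqF// powR_gt0.
  rewrite powRM ?(ltW wa0) ?(ltW wy)//.
  rewrite /resc.
  transitivity (((w `^ (- a)) `^ (- b - 1) * w `^ (- a) * w^-1) * (a * b) *
    (y `^ (a - 1) * (w `^ a + y `^ a) `^ (- b - 1) * sin y)); first by ring.
  congr (_ * _ * _).
  rewrite -powRrM -(powR_inv1 (ltW pw)) -!powRD ?(@gt_eqF _ _ w) ?implybT//.
  by congr (_ `^ _); ring.
rewrite (@eq_Rintegral _ _ _ mu pos (fun y => w `^ (a * b - 1) * (a * b) * resc w y)); last first.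
  by move=> y; rewrite inE posE; exact: E.
rewrite RintegralZl//; by rewrite -[LHS]mulrA.
Qed.

Section sequence.
Variable w_ : nat -> R.
Hypothesis w0 : forall n, 0 < w_ n.
Hypothesis wcvg : w_ n @[n --> \oo] --> (0 : R).

Lemma sker_le_id z w : 0 <= z -> `|sker z w| <= z.
Proof.
move=> z0; have [->|hw] := eqVneq w 0; first by rewrite /sker invr0 mulr0 normr0.
rewrite /sker normrM normfV ler_pdivrMr ?normr_gt0//.
by rewrite (le_trans (abs_sin_le _))// normrM (ger0_norm z0) mulrC.
Qed.

Lemma cvg_sker z : sker z (w_ n) @[n --> \oo] --> z.
Proof.
apply/subr_cvg0; apply: norm_cvg0.
apply: (@squeeze_cvgr _ _ _ _ (fun=> 0) (fun n => w_ n * z ^+ 2)); last 2 first.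
- exact: cvg_cst.
- by rewrite -(mul0r (z ^+ 2)); apply: cvgM; [exact: wcvg|exact: cvg_cst].
apply: nearW => n; rewrite normr_ge0/= /sker.
have hw := w0 n; rewrite (_ : _ - _ = (sin (w_ n * z) - w_ n * z) / w_ n); last first.
  by field; rewrite gt_eqF.
rewrite normrM normfV (gtr0_norm hw) ler_pdivrMr// (le_trans (abs_sin_sub_le _))//.
by rewrite exprMn expr2 mulrAC.
Qed.

(** The kernel tends to [u^(1/a)] and stays below it, so the limit is a moment of [pdens b] of order
    [1/a], finite exactly because [1/a < b]. *)
Lemma cvg_spec1_gt1 : 1 < a * b ->
  spec1 a b (w_ n) @[n --> \oo] --> pi^-1 * (Gamma a^-1 * Gamma (b - a^-1) / (a * Gamma b)).
Proof.
move=> ab1; have qb : a^-1 < b by rewrite -(@ltr_pM2l _ a)// divff// gt_eqF.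
have q0 : 0 < a^-1 by rewrite invr_gt0.
apply: cvgM; first exact: cvg_cst.
have -> : Gamma a^-1 * Gamma (b - a^-1) / (a * Gamma b) = \int[mu]_u (pdens b u * u `^ a^-1).
  rewrite pdens_moment ?q0// !GammaD1//.
  by field; rewrite !gt_eqF ?Gamma_gt0.
apply: (@Rdominated_cvg _ _ _ mu setT (fun n u => pdens b u * sker (u `^ a^-1) (w_ n)) _
  (fun u => pdens b u * u `^ a^-1)) => //.
- by move=> n; exact: measurable_spec1_ker.
- by apply: measurable_funM; [exact: measurable_pdens|exact: measurable_powRT].
- by apply: integrable_pdens_moment; rewrite ltW.
- by move=> u _; apply: cvgM; [exact: cvg_cst|exact: cvg_sker].
- move=> n u _; rewrite normrM ger0_norm ?pdens_ge0 ?(ltW b0)//.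
  by rewrite ler_wpM2l ?pdens_ge0 ?(ltW b0)// sker_le_id ?powR_ge0.
Qed.

Hypothesis ab1 : a * b < 1.

Let ab01 : 0 < a * b < 1. Proof. by rewrite mulr_gt0. Qed.

Lemma measurable_resc w : measurable_fun setT (resc w).
Proof.
apply: measurable_funM; last exact: measurable_sin.
apply: measurable_funM; first exact: measurable_powRT.
by apply: measurable_fun_powRl; apply: measurable_funD.
Qed.

(** Dropping [w^a] from the sum only enlarges its negative power, which removes the dependence on
    [w]; the bound [|sin y| <= min (1, y)] supplies the rest. *)
Lemma resc_le w y : 0 < w -> 0 < y -> `|resc w y| <= y `^ (- (a * b) - 1) * Num.min 1 y.
Proof.
move=> pw py; have wa : 0 < w `^ a by rewrite powR_gt0.
have ya : 0 < y `^ a by rewrite powR_gt0.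
rewrite /resc normrM ger0_norm ?mulr_ge0 ?powR_ge0//.
rewrite ler_pM ?mulr_ge0 ?powR_ge0//; last first.
  by rewrite le_min ler_norml sin_geN1 sin_le1/= -{2}(gtr0_norm py) abs_sin_le.
rewrite (_ : y `^ (- (a * b) - 1) = y `^ (a - 1) * (y `^ a) `^ (- b - 1)); last first.
  rewrite -powRrM -powRD ?(@gt_eqF _ _ y) ?implybT//.
  by congr (_ `^ _); ring.
rewrite ler_wpM2l ?powR_ge0// -!opprD !powRN lef_pV2 ?posrE ?powR_gt0 ?addr_gt0//.
by rewrite ge0_ler_powR ?nnegrE ?addr_ge0 ?(ltW b0) ?(ltW ya) ?(ltW wa)// lerDr (ltW wa).
Qed.

Lemma integrable_resc w : 0 < w -> mu.-integrable pos (EFin \o resc w).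
Proof.
move=> pw; have [D iD hD] := integrable_powRN_min ab01.
apply: (@integrable_dom _ _ _ mu pos _ D) => //.
  by apply: measurable_funS measurableT _ _ => //; exact: measurable_resc.
by move=> y; rewrite posE => py; exact: le_trans (resc_le pw py) (hD _ py).
Qed.

Lemma cvg_spec1_lt1 : 
  spec1 a b (w_ n) / w_ n `^ (a * b - 1) @[n --> \oo] -->
  Gamma (1 - a * b) * sin (pi * (a * b) / 2) / pi.
Proof.
have -> : Gamma (1 - a * b) * sin (pi * (a * b) / 2) / pi =
    pi^-1 * (a * b * \int[mu]_(y in pos) (y `^ (- (a * b) - 1) * sin y)).
  by rewrite integral_powRN_sin ?mulr_gt0//; ring.
rewrite (_ : (fun n => _) = (fun n => pi^-1 * (a * b * \int[mu]_(y in pos) resc (w_ n) y))); last first.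
  apply/funext => n; rewrite spec1_rescaled//; last exact: integrable_resc.
  by rewrite mulrAC mulfK// gt_eqF// powR_gt0.
apply: cvgM; first exact: cvg_cst.
apply: cvgM; first exact: cvg_cst.
have wacvg : w_ n `^ a @[n --> \oo] --> (0 : R).
  exact: cvg_comp (cvg_pos_right w0 wcvg) (powR_cvg0 a0).
have [D iD hD] := integrable_powRN_min ab01.
apply: (@Rdominated_cvg _ _ _ mu pos (fun n y => resc (w_ n) y) _ D) => //.
- by move=> n; apply: measurable_funS measurableT _ _ => //; exact: measurable_resc.
- apply: measurable_funS measurableT _ _ => //.
  by apply: measurable_funM; [exact: measurable_powRT|exact: measurable_sin].
- move=> y; rewrite posE => py.
  apply: cvgM; last exact: cvg_cst.
  rewrite (_ : y `^ (- (a * b) - 1) = y `^ (a - 1) * (0 + y `^ a) `^ (- b - 1)); last first.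
    rewrite add0r -powRrM -powRD ?(@gt_eqF _ _ y) ?implybT//.
    by congr (_ `^ _); ring.
  apply: cvgM; first exact: cvg_cst.
  have ya : 0 < 0 + y `^ a by rewrite add0r powR_gt0.
  have := is_derive_cont (is_derive1_powR (- b - 1) ya) => cp.
  have H : w_ n `^ a + y `^ a @[n --> \oo] --> 0 + y `^ a by apply: cvgD; [exact: wacvg|exact: cvg_cst].
  exact: cvg_comp H cp.
- move=> n y; rewrite posE => py; exact: le_trans (resc_le _ _) (hD _ py).
Qed.

End sequence.
End asymptotics.

(** * The logarithmic case *)

Section log_case.
Context {R : realType}.
Implicit Types a b q r t u w x y z : R.
Local Notation mu := (@lebesgue_measure R).
Local Notation pos := (`]0, +oo[%classic : set R).

Lemma integral_powR_gt c p : 0 < c -> 0 < p ->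
  mu.-integrable `]c, +oo[%classic (EFin \o (fun y => y `^ (- p - 1))) /\
  \int[mu]_(y in `]c, +oo[) (y `^ (- p - 1)) = c `^ (- p) / p.
Proof.
move=> c0 p0; have eD := exhausts_gt c.
pose G y := - p^-1 * y `^ (- p).
have dG y : `]c, +oo[%classic y -> is_derive y 1 G (y `^ (- p - 1)).
  rewrite /= in_itv/= andbT => cy; have y0 := lt_trans c0 cy.
  apply: is_derive_eq (is_deriveZ (- p^-1) (is_derive1_powR (- p) y0)) _.
  by rewrite /GRing.scale/=; field; rewrite gt_eqF.
have cg y : `]c, +oo[%classic y -> {for y, continuous (fun y => y `^ (- p - 1))}.
  rewrite /= in_itv/= andbT => cy; have y0 := lt_trans c0 cy.
  exact: (is_derive_cont (is_derive1_powR _ y0)).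
have g0 y : `]c, +oo[%classic y -> 0 <= y `^ (- p - 1) by move=> _; exact: powR_ge0.
have G0 : G (c + invn n) @[n --> \oo] --> - p^-1 * c `^ (- p).
  have cG := is_derive_cont (is_deriveZ (- p^-1) (is_derive1_powR (- p) c0)).
  have H : c + invn n @[n --> \oo] --> c + 0 by apply: cvgD; [exact: cvg_cst|exact: cvg_invn].
  by rewrite addr0 in H; exact: cvg_comp H cG.
have G1 : G (c + natn n) @[n --> \oo] --> 0.
  rewrite -(mulr0 (- p^-1)); apply: cvgM; first exact: cvg_cst.
  have H : (c + x) `^ (- p) @[x --> +oo] --> 0.
    apply: cvg_comp (cvg_powRN p0).
    exact: cvg_addrl.
  exact: (cvg_natn_comp H).
have ig := exhausts_FTC_integrable eD dG cg G0 G1 g0.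
split => //; rewrite (exhausts_FTC eD dG cg G0 G1 ig).
by field; rewrite gt_eqF.
Qed.

Lemma integral_indic_itv u v : u <= v ->
  mu.-integrable setT (EFin \o (\1_(`[u, v]%classic : set R) : R -> R)) /\
  \int[mu]_y \1_(`[u, v]%classic : set R) y = v - u.
Proof.
move=> uv; have E : (\int[mu]_y (\1_(`[u, v]%classic : set R) y)%:E = (v - u)%:E)%E.
  rewrite integral_indic// setIT; apply: etrans (lebesgue_measure_itv _) _ => /=.
  by rewrite lte_fin; have [//|vu] := ltP u v; rewrite (@le_anti _ _ u v) ?uv// subrr.
split; last by rewrite /Rintegral E.
apply/integrableP; split; first exact/measurable_EFinP.
by under eq_integral do rewrite /= ger0_norm//; rewrite E ltry.
Qed.

Lemma integral_inv_itv w : 0 < w -> w < 1 ->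
  mu.-integrable `[w, 1]%classic (EFin \o (@GRing.inv R)) /\
  \int[mu]_(y in `[w, 1]) y^-1 = - ln w.
Proof.
move=> w0 w1.
have pos_itv x : x \in `[w, 1] -> 0 < x by rewrite in_itv/= => /andP[wx _]; exact: lt_le_trans w0 wx.
have cV x : 0 < x -> {for x, continuous (@GRing.inv R)}.
  by move=> px; apply: inv_continuous; rewrite gt_eqF.
have cL x : 0 < x -> {for x, continuous (@ln R)} by exact: continuous_ln.
have E : (\int[mu]_(x in `[w, 1%R]) (x^-1)%:E = (ln 1%R)%:E - (ln w)%:E)%E.
  rewrite (@continuous_FTC2 _ _ (@ln R))//.
  - apply: continuous_in_subspaceT => x; rewrite inE => /pos_itv; exact: cV.
  - split => [x xab||].
    + apply: ex_derive; apply: is_derive1_ln; exact: pos_itv (subset_itv_oo_cc xab).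
    + by apply: cvg_at_right_filter; exact: cL.
    + by apply: cvg_at_left_filter; exact: cL.
  - move=> x xab; rewrite derive1E.
    have := is_derive1_ln (pos_itv _ (subset_itv_oo_cc xab)) => ?.
    exact: derive_val.
split; last by rewrite /Rintegral E ln1 -EFinB sub0r.
apply/integrableP; split.
  apply/measurable_EFinP; apply: measurable_funS measurableT _ _ => //; exact: measurable_invr.
under eq_integral => x.
  rewrite inE => /pos_itv px; rewrite /= ger0_norm ?invr_ge0 ?(ltW px)//.
  over.
by rewrite E -EFinB ltry.
Qed.

(** Written as [exp (-c ln (1 + x))], the power is at least [1 - c ln (1 + x)], and
    [ln (1 + x) <= x]. *)
Lemma powR_sub1_le c x : 0 <= c -> 0 <= x -> 1 - (1 + x) `^ (- c) <= c * x.
Proof.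
move=> c0 px; have x1 : 0 < 1 + x by rewrite ltr_wpDr.
rewrite /powR gt_eqF// lerBlDl -lerBlDr.
apply: le_trans (expR_ge1Dx _); rewrite mulNr lerD2l lerN2.
by rewrite ler_wpM2l// le_ln1Dx// (lt_le_trans _ px)// ltrN10.
Qed.

Variables a b : R.
Hypotheses (a0 : 0 < a) (b0 : 0 < b) (ab1 : a * b = 1).

(* For a b = 1 the rescaled integrand is compared with 1/y on [w, 1], whose
   integral is ln (1/w); D bounds the error, and the integral of D does not
   depend on w. *)
Let D w y : R := \1_(`]1, +oo[%classic : set R) y * y `^ (- 1 - 1)
  + \1_(`[0, 1]%classic : set R) y
  + (b + 1) * w `^ a * (\1_(`]w / 2, +oo[%classic : set R) y * y `^ (- a - 1))
  + w^-1 * \1_(`[0, w]%classic : set R) y.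

Let M w y : R := \1_(`[w, 1]%classic : set R) y * y^-1.

(** The terms of [D] bound, in this order: the tail [y > 1]; on [[w, 1]], the error of replacing
    [sin y] by [y], and then that of dropping [w^a]; the range [y < w]. The third term starts at
    [w / 2] so that an open half-line contains the endpoint [y = w]. *)
Lemma resc_sub_le w y : 0 < w < 1 -> 0 < y -> `|resc a b w y - M w y| <= D w y.
Proof.
move=> /andP[w0 w1] py; have b1 : 0 <= b + 1 by rewrite addr_ge0 ?(ltW b0).
have wa0 : 0 < w `^ a by rewrite powR_gt0.
have ya0 : 0 < y `^ a by rewrite powR_gt0.
pose e := y `^ (a - 1) * (w `^ a + y `^ a) `^ (- b - 1).
have e0 : 0 <= e by rewrite mulr_ge0 ?powR_ge0.
have anti u v : 0 < u -> u <= v -> v `^ (- b - 1) <= u `^ (- b - 1).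
  move=> u0 uv; rewrite -opprD !powRN lef_pV2 ?posrE ?powR_gt0 ?(lt_le_trans u0 uv)//.
  by rewrite ge0_ler_powR ?nnegrE ?(ltW u0) ?(ltW (lt_le_trans u0 uv)).
have ey : y `^ (a - 1) * (y `^ a) `^ (- b - 1) = y `^ (- 1 - 1).
  rewrite -powRrM -powRD ?(@gt_eqF _ _ y) ?implybT//.
  have -> : a - 1 + a * (- b - 1) = - (a * b) - 1 by ring.
  by rewrite ab1.
have eley : e <= y `^ (- 1 - 1).
  by rewrite -ey ler_wpM2l ?powR_ge0// anti// lerDr ltW.
have n0 : 0 <= \1_(`]1, +oo[%classic : set R) y * y `^ (- 1 - 1) by rewrite mulr_ge0 ?powR_ge0.
have n1 : 0 <= \1_(`[0, 1]%classic : set R) y :> R by [].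
have n2 : 0 <= (b + 1) * w `^ a * (\1_(`]w / 2, +oo[%classic : set R) y * y `^ (- a - 1)).
  by rewrite !mulr_ge0 ?powR_ge0.
have n3 : 0 <= w^-1 * \1_(`[0, w]%classic : set R) y by rewrite mulr_ge0// invr_ge0 ltW.
have sE : resc a b w y = e * sin y by [].
have [y1|y1] := ltP 1 y.
  rewrite /M indicE memNset ?mul0r ?subr0; last first.
    by rewrite /= in_itv/= => /andP[_]; rewrite leNgt y1.
  rewrite sE normrM (ger0_norm e0); apply: (@le_trans _ _ (y `^ (- 1 - 1))).
    rewrite -[leRHS]mulr1 ler_pM//.
    by rewrite ler_norml sin_geN1 sin_le1.
  rewrite /D -!addrA; apply: ler_wpDr; first by rewrite !addr_ge0.
  by rewrite indicE mem_set ?mul1r// /= in_itv/= y1.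
have [yw|wy] := ltP y w.
  rewrite /M indicE memNset ?mul0r ?subr0; last first.
    by rewrite /= in_itv/= => /andP[+ _]; rewrite leNgt yw.
  rewrite sE normrM (ger0_norm e0); apply: (@le_trans _ _ w^-1); last first.
    rewrite /D; apply: ler_wpDl; first by rewrite !addr_ge0.
    by rewrite indicE mem_set ?mulr1// /= in_itv/= (ltW yw) (ltW py).
  have sy : `|sin y| <= y by rewrite (le_trans (abs_sin_le _))// gtr0_norm.
  apply: (@le_trans _ _ (e * y)); first by rewrite ler_wpM2l.
  apply: (@le_trans _ _ ((w `^ a) `^ (- b - 1) * y `^ a)).
    rewrite /e mulrAC (powR_shift _ py) mulrC ler_wpM2r ?powR_ge0//.
    by rewrite anti// lerDl ltW.
  apply: (@le_trans _ _ ((w `^ a) `^ (- b - 1) * w `^ a)).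
    by rewrite ler_wpM2l ?powR_ge0// ge0_ler_powR ?nnegrE ?(ltW a0) ?(ltW py) ?(ltW w0) ?(ltW yw).
  rewrite -powRrM -powRD ?(@gt_eqF _ _ w) ?implybT// -(powR_inv1 (ltW w0)).
  have -> : a * (- b - 1) + a = - (a * b) by ring.
  by rewrite ab1.
rewrite /M indicE mem_set ?mul1r; last by rewrite /= in_itv/= wy y1.
(* This is [(w / y)^a]; factoring [y^a] out of the sum leaves [e * y = y^-1 (1 + px)^(-b-1)], a
   perturbation of [y^-1] controlled by [powR_sub1_le]. *)
pose px := w `^ a * y `^ (- a).
have px0 : 0 <= px by rewrite mulr_ge0 ?powR_ge0.
have eyE : e * y = y^-1 * (1 + px) `^ (- b - 1).
  rewrite /e (_ : w `^ a + y `^ a = y `^ a * (1 + px)); last first.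
    by rewrite mulrDr mulr1 mulrCA -powRD ?(@gt_eqF _ _ y) ?implybT// subrr powRr0 mulr1 addrC.
  rewrite powRM ?powR_ge0 ?addr_ge0// mulrA ey mulrAC -(powR_inv1 (ltW py)).
  by rewrite -{2}(powRr1 (ltW py)) -powRD ?(@gt_eqF _ _ y) ?implybT// addrNK.
rewrite sE (_ : _ - _ = e * (sin y - y) + (e * y - y^-1)); last by ring.
have h1 : `|e * (sin y - y)| <= 1.
  rewrite normrM (ger0_norm e0); apply: (@le_trans _ _ (y `^ (- 1 - 1) * y ^+ 2)).
    by rewrite ler_pM// abs_sin_sub_le.
  rewrite -(powR_mulrn _ (ltW py)) -powRD ?(@gt_eqF _ _ y) ?implybT//.
  by rewrite (_ : -1 - 1 + 2%:R = 0) ?powRr0//; ring.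
have h2 : `|e * y - y^-1| <= (b + 1) * w `^ a * y `^ (- a - 1).
  have x1 : (1 + px) `^ (- b - 1) <= 1.
    have := @anti 1 (1 + px) ltr01; rewrite powR1 lerDl; exact.
  rewrite eyE distrC -{1}[y^-1]mulr1 -mulrBr ger0_norm; last first.
    by rewrite mulr_ge0 ?subr_ge0// invr_ge0 ltW.
  rewrite -opprD (le_trans (ler_wpM2l _ (powR_sub1_le _ _)))// ?invr_ge0 ?(ltW py)//.
  rewrite powRB ?(@gt_eqF _ _ y) ?implybT// powRr1 ?(ltW py)// /px.
  by rewrite le_eqVlt; apply/orP; left; apply/eqP; ring.
rewrite (le_trans (ler_normD _ _))//.
apply: (@le_trans _ _ (1 + (b + 1) * w `^ a * y `^ (- a - 1))); first exact: lerD.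
have e1 : \1_(`[0, 1]%classic : set R) y = 1 :> R.
  by rewrite indicE mem_set//= in_itv/= y1 (ltW py).
have e2 : \1_(`]w / 2, +oo[%classic : set R) y = 1 :> R.
  by rewrite indicE mem_set//= in_itv/= andbT (lt_le_trans _ wy)// ltr_pdivrMr// ltr_pMr// ltr1n.
by move: n0 n3; rewrite /D e1 e2 mul1r; lra.
Qed.

Lemma D_ge0 w y : 0 < w -> 0 <= D w y.
Proof.
by move=> w0; rewrite /D !(addr_ge0, mulr_ge0)// ?invr_ge0 ?powR_ge0 ?(ltW w0) ?(ltW b0).
Qed.

(** The first, second and fourth terms contribute 1 each; in the third, [w^a] cancels against
    [(w / 2)^(-a)] and leaves [2^a]. *)
Lemma integral_D w : 0 < w < 1 -> mu.-integrable setT (EFin \o D w) /\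
  \int[mu]_y D w y = 3 + (b + 1) * 2 `^ a / a.
Proof.
move=> /andP[w0 w1].
have [i0 I0] := @integral_powR_gt 1 1 ltr01 ltr01.
have w20 : 0 < w / 2 by rewrite divr_gt0.
have [i2 I2] := integral_powR_gt w20 a0.
have [i1 I1] := @integral_indic_itv 0 1 ler01.
have [i3 I3] := @integral_indic_itv 0 w (ltW w0).
have {}i0 := integrable_indicM _ i0.
have {}i2 := integrable_indicM _ i2.
have i2' : mu.-integrable setT (EFin \o (fun y => (b + 1) * w `^ a * (\1_(`]w / 2, +oo[%classic : set R) y * y `^ (- a - 1)))).
  under [X in integrable _ _ X]eq_fun do rewrite /= EFinM.
  by apply: integrableZl => //; exact: (i2 (measurable_itv _)).
have i3' : mu.-integrable setT (EFin \o (fun y => w^-1 * \1_(`[0, w]%classic : set R) y)).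
  under [X in integrable _ _ X]eq_fun do rewrite /= EFinM.
  by apply: integrableZl => //; exact: i3.
have i01 := integrableD measurableT (i0 (measurable_itv _)) i1.
have i012 := integrableD measurableT i01 i2'.
split; first exact: integrableD i012 i3'.
rewrite /D (RintegralD measurableT i012 i3') (RintegralD measurableT i01 i2').
rewrite (RintegralD measurableT (i0 (measurable_itv _)) i1).
rewrite (RintegralZl _ measurableT i3) (RintegralZl _ measurableT (i2 (measurable_itv _))).
rewrite !Rintegral_indicM I0 I1 I2 I3 !subr0 powR1 invr1 mulr1 mulVf ?gt_eqF//.
have -> : (w / 2) `^ (- a) = (w `^ a)^-1 * 2 `^ a.
  rewrite powRM ?(ltW w0) ?invr_ge0// -[X in _ * X `^ _]powR_inv1// -powRrM.
  by rewrite mulN1r opprK powRN.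
set W := w `^ a; set V := 2 `^ a; have W0 : W != 0 by rewrite gt_eqF// powR_gt0.
by field; rewrite W0 gt_eqF.
Qed.

Lemma spec1_log w : 0 < w < 1 -> `|pi * spec1 a b w - ln w^-1| <= 3 + (b + 1) * 2 `^ a / a.
Proof.
move=> hw; have /andP[w0 w1] := hw.
have [iM IM] := integral_inv_itv w0 w1.
have iM1 : mu.-integrable setT (EFin \o M w) by exact: integrable_indicM.
have IM1 : \int[mu]_y M w y = ln w^-1 by rewrite Rintegral_indicM IM lnV.
pose rr y := \1_pos y * resc a b w y.
have dr y : `|rr y - M w y| <= D w y.
  rewrite /rr; have [y0|y0] := ltP 0 y.
    by rewrite indicE mem_set ?posE// mul1r; exact: resc_sub_le.
  rewrite indicE memNset ?mul0r; last by rewrite posE ltNge y0.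
  rewrite /M indicE memNset ?mul0r ?subr0 ?normr0; last first.
    by rewrite /= in_itv/= => /andP[wy _]; move: y0; rewrite leNgt (lt_le_trans w0).
  exact: D_ge0.
have mrr : measurable_fun setT rr.
  by apply: measurable_funM => //; exact: measurable_resc.
have mM : measurable_fun setT (M w).
  by apply: measurable_funM => //; exact: measurable_invr.
have irM : mu.-integrable setT (EFin \o (fun y => rr y - M w y)).
  apply: (integrable_dom _ _ (integral_D hw).1) => //; exact: measurable_funB.
have irr : mu.-integrable setT (EFin \o rr).
  have := integrableD measurableT irM iM1.
  by apply: eq_integrable => // y _; rewrite /= -EFinD subrK.
have ir : mu.-integrable pos (EFin \o resc a b w).
  apply/(integrable_mkcond _ _).2 => //.
  rewrite (_ : _ \_ _ = EFin \o rr)//; apply/funext => y.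
  by rewrite /= /rr patchE indicE; case: (y \in _); rewrite ?mul1r ?mul0r.
rewrite spec1_rescaled// mulrA mulVKf ?gt_eqF ?pi_gt0// ab1 subrr powRr0 !mul1r.
rewrite -Rintegral_indicM -IM1 -(RintegralB measurableT irr iM1) -(integral_D hw).2.
apply: le_trans (le_normr_Rintegral measurableT irM) _.
apply: le_Rintegral => //; first exact: (integrable_norm irM).
exact: (integral_D hw).1.
Qed.

End log_case.

(** * The one-dimensional equivalence at the origin *)

Section spec1_equiv.
Context {R : realType}.
Implicit Types x y w : R.
Variables a b : R.
Hypotheses (a0 : 0 < a) (b0 : 0 < b).

Lemma cvg_divr1 (u : nat -> R) (c : R) : c != 0 ->
  u n @[n --> \oo] --> c -> u n / c @[n --> \oo] --> (1 : R).
Proof. by move=> c0 uc; rewrite -(divff c0); apply: cvgM; [exact: uc|exact: cvg_cst]. Qed.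

(** The difference [f - (g + K)] is eventually at most [C + |K|], while the denominator diverges. *)
Lemma cvg_ratio_log (f g : nat -> R) (K C : R) : (\forall n \near \oo, `|f n - g n| <= C) ->
  g n @[n --> \oo] --> +oo -> f n / (g n + K) @[n --> \oo] --> (1 : R).
Proof.
move=> fg goo; have hoo : g n + K @[n --> \oo] --> +oo.
  exact: cvg_comp goo (cvg_addrr K).
have h0 : (g n + K)^-1 @[n --> \oo] --> 0.
  by apply/gtr0_cvgV0 => //; move/cvgryPgt : hoo => /(_ 0).
apply/subr_cvg0; apply: norm_cvg0.
have hC : (C + `|K|) * (g n + K)^-1 @[n --> \oo] --> 0.
  by rewrite -(mulr0 (C + `|K|)); apply: cvgM => //; exact: cvg_cst.
apply: squeeze_cvgr (cvg_cst _) hC.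
move/cvgryPgt : hoo => /(_ 0) hoo; near=> n.
have gn : 0 < g n + K by near: n.
rewrite normr_ge0/= (_ : _ - _ = (f n - g n - K) / (g n + K)); last first.
  by field; rewrite gt_eqF.
rewrite normrM normfV (gtr0_norm gn) ler_wpM2r ?invr_ge0 ?(ltW gn)//.
by rewrite (le_trans (ler_normB _ _))// lerD2r; near: n.
Unshelve. all: by end_near. Qed.

Lemma cvg_spec1_ratio_seq (w_ : nat -> R) : (forall n, 0 < w_ n) ->
  w_ n @[n --> \oo] --> (0 : R) ->
  spec1 a b (w_ n) / Lfactor a b (w_ n) @[n --> \oo] --> (1 : R).
Proof.
move=> w0 wcvg; have ab0 : 0 < a * b by rewrite mulr_gt0.
have [ab1|ab1] := ltP (a * b) 1.
  pose c := Gamma (1 - a * b) * sin (pi * (a * b) / 2) / pi.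
  have c0 : 0 < c.
    rewrite !mulr_gt0 ?invr_gt0 ?pi_gt0 ?Gamma_gt0 ?subr_gt0//.
    have pi0 := @pi_gt0 R.
    rewrite sin_gt0_pi// ?divr_gt0 ?mulr_gt0//= ltr_pdivrMr// ltr_pM2l//.
    by rewrite (lt_trans ab1)// ltr1n.
  rewrite (_ : (fun n => _) = (fun n => spec1 a b (w_ n) / w_ n `^ (a * b - 1) / c)).
    exact: cvg_divr1 (lt0r_neq0 c0) (cvg_spec1_lt1 a0 b0 w0 wcvg ab1).
  apply/funext => n; rewrite /Lfactor ab1 (gtr0_norm (w0 n)).
  have -> : Gamma (1 - a * b) / pi * sin (pi * a * b / 2) = c by rewrite /c mulrAC (mulrA pi).
  by rewrite invfM mulrA mulrAC.
have [ab1'|ab1'] := eqVneq (a * b) 1.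
  pose K := - (b * (digamma b + euler_gamma)) - @euler_gamma R.
  rewrite (_ : (fun n => _) = (fun n => pi * spec1 a b (w_ n) / (ln (w_ n)^-1 + K))); last first.
    apply/funext => n; rewrite /Lfactor ltNge ab1/= ab1' eqxx (gtr0_norm (w0 n)).
    by rewrite invfM invrK mulrA (mulrC (spec1 _ _ _)) /K !addrA.
  have hR := cvg_pos_right w0 wcvg.
  apply: (@cvg_ratio_log _ _ K (3 + (b + 1) * 2 `^ a / a)).
    near=> n; apply: spec1_log => //; rewrite w0/=; near: n.
    by move/cvgr_lt : wcvg => /(_ 1 ltr01).
  rewrite (_ : (fun n => _) = (fun n => - ln (w_ n))); last first.
    by apply/funext => n; rewrite lnV// posrE.
  exact: (cvgNry (fun n => ln (w_ n))).2 (cvg_comp _ _ hR (@lnNy R)).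
have {ab1 ab1'} ab1 : 1 < a * b by rewrite lt_neqAle eq_sym ab1'.
have q0 : 0 < b - a^-1 by rewrite subr_gt0 -(@ltr_pM2l _ a)// divff// gt_eqF.
pose c := pi^-1 * (Gamma a^-1 * Gamma (b - a^-1) / (a * Gamma b)).
have c0 : 0 < c.
  by rewrite !(mulr_gt0, Gamma_gt0, invr_gt0, pi_gt0)// ?Gamma_gt0// invr_gt0.
rewrite (_ : (fun n => _) = (fun n => spec1 a b (w_ n) / c)).
  exact: cvg_divr1 (lt0r_neq0 c0) (cvg_spec1_gt1 a0 b0 w0 wcvg ab1).
by apply/funext => n; rewrite /Lfactor ltNge (ltW ab1)/= gt_eqF.
Unshelve. all: by end_near. Qed.

Lemma cvg_spec1_ratio :
  spec1 a b w / Lfactor a b w @[w --> (0 : R)^'] --> (1 : R).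
Proof.
apply/cvgr_dnbhsP => u [u0 ucvg].
(* Both functions are even, so a sequence of nonzero points may be replaced by its absolute
   values. *)
rewrite (_ : (fun n => _) = (fun n => spec1 a b `|u n| / Lfactor a b `|u n|)); last first.
  apply/funext => n; rewrite /Lfactor normr_id; congr (_ / _).
  by have [//|_] := ger0P (u n); rewrite spec1N.
apply: cvg_spec1_ratio_seq => [n|]; first by rewrite normr_gt0.
by rewrite -(@normr0 _ R); exact: cvg_norm.
Qed.

End spec1_equiv.

(** * Products over the coordinates *)

Section rV_integral.
Context {R : realType}.
Local Notation leb := (@lebesgue_measure R).

Lemma rV_cons_ord0 n (p : R * 'rV[R]_n) : rV_cons p ord0 ord0 = p.1.
Proof. by have := rV_cons_head p ord0; rewrite /rV_coord lshift0. Qed.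

Lemma rV_cons_lift n (p : R * 'rV[R]_n) i :
  rV_cons p ord0 (lift ord0 i) = p.2 ord0 i.
Proof. by have := rV_cons_tail p i; rewrite /rV_coord rshift1. Qed.

Lemma big_rV_cons n A (op : A -> A -> A) (idx : A) (g : 'I_n.+1 -> R -> A) p :
  \big[op/idx]_i g i (rV_cons p ord0 i) =
  op (g ord0 p.1) (\big[op/idx]_i g (lift ord0 i) (p.2 ord0 i)).
Proof.
by rewrite big_ord_recl rV_cons_ord0; congr op; apply: eq_bigr => i _; rewrite rV_cons_lift.
Qed.

Lemma measurable_rV_prod n (g : 'I_n -> R -> R) :
  (forall i, measurable_fun setT (g i)) ->
  measurable_fun setT (fun x : 'rV[R]_n => \prod_i g i (x ord0 i)).
Proof.
move=> mg; apply: measurable_prod => i _.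
exact: (measurableT_comp (mg i) (measurable_rV_coord i)).
Qed.

(** Tonelli's theorem in the extended reals: since infinite values are allowed, finiteness of the
    whole can be traced back to the factors. *)
Lemma integral_rV_prod_ge0 n (g : 'I_n -> R -> R) :
  (forall i, measurable_fun setT (g i)) -> (forall i x, 0 <= g i x) ->
  (\int[lebesgue_rV n]_x (\prod_i g i (x ord0 i))%:E =
   \big[mule/1]_i \int[leb]_t (g i t)%:E)%E.
Proof.
elim: n g => [g mg g0|n IH g mg g0].
  rewrite big_ord0; under eq_integral do rewrite big_ord0.
  by rewrite integral_cst//= diracT mule1.
rewrite big_ord_recl.
have mF := measurable_rV_prod mg.
rewrite [LHS](_ : _ = (\int[pushforward (leb \x lebesgue_rV n) (@rV_cons R n)]_x
  (\prod_i g i (x ord0 i))%:E)%E)//.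
rewrite ge0_integral_pushforward//; last 3 first.
- exact: measurable_rV_cons.
- exact/measurable_EFinP.
- by move=> x _; rewrite lee_fin prodr_ge0.
rewrite preimage_setT fubini_tonelli1//=; last 2 first.
- by apply/measurable_EFinP; apply: measurableT_comp mF _; exact: measurable_rV_cons.
- by move=> x; rewrite lee_fin prodr_ge0.
have g'0 (x : 'rV[R]_n) : 0 <= \prod_(i < n) g (lift ord0 i) (x ord0 i) by exact: prodr_ge0.
have mg' : measurable_fun setT (fun x : 'rV[R]_n => \prod_i g (lift ord0 i) (x ord0 i)).
  exact: (measurable_rV_prod (g := fun i => g (lift ord0 i))).
under eq_integral => x _.
  rewrite /fubini_F/=; under eq_integral do rewrite big_rV_cons/= EFinM.
  rewrite ge0_integralZl//; last 3 first.
  - exact/measurable_EFinP.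
  - by move=> y _; rewrite lee_fin.
  - by rewrite lee_fin.
  rewrite (IH (fun i => g (lift ord0 i)))//.
  over.
rewrite ge0_integralZr//.
- by apply/measurable_EFinP; exact: mg.
- by move=> x _; rewrite lee_fin.
- by rewrite -(IH (fun i => g (lift ord0 i)))//; apply: integral_ge0 => x _; rewrite lee_fin.
Qed.

Local Notation leb_prod n := (leb \x lebesgue_rV n)%E.
Local Notation RrV n := (g_sigma_algebraType R.-ocitv.-measurable * 'rV[R]_n)%type.

Lemma integral_rV_cons n (F : 'rV[R]_n.+1 -> R) : measurable_fun setT F ->
  (leb_prod n).-integrable setT (fun p => (F (rV_cons p))%:E) ->
  (lebesgue_rV n.+1).-integrable setT (EFin \o F) /\
  \int[lebesgue_rV n.+1]_x F x = \int[leb_prod n]_p F (rV_cons p).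
Proof.
move=> mF ip; have mF' : measurable_fun setT (EFin \o F) by exact/measurable_EFinP.
have mc : measurable_fun (setT : set (RrV n)) (@rV_cons R n) by exact: measurable_rV_cons.
split.
  by have /integrableP[_ H] := integrable_pushforward mc mF' ip measurableT; apply/integrableP.
rewrite /Rintegral (_ : (\int[lebesgue_rV n.+1]_x (F x)%:E)%E =
  (\int[pushforward (leb_prod n) (@rV_cons R n)]_x (F x)%:E)%E)//.
by rewrite (integral_pushforward mc mF' ip)// preimage_setT.
Qed.

Lemma integral_prodM n (f : R -> R) (G : 'rV[R]_n -> R) :
  leb.-integrable setT (EFin \o f) -> (lebesgue_rV n).-integrable setT (EFin \o G) ->
  (leb_prod n).-integrable setT (fun p => (f p.1 * G p.2)%:E) /\
  \int[leb_prod n]_p (f p.1 * G p.2) = (\int[leb]_t f t) * \int[lebesgue_rV n]_y G y.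
Proof.
move=> fi Gi.
have mp : measurable_fun setT (fun z : R * 'rV[R]_n => f z.1 * G z.2).
  apply: measurable_funM.
    by apply: (measurableT_comp (integrable_mf fi)); exact: measurable_fst.
  by apply: (measurableT_comp (integrable_mf Gi)); exact: measurable_snd.
have dom x y : `|f x * G y| <= `|f x| * `|G y| by rewrite normrM.
have ip := @integrable_prod_dom _ _ _ _ _ leb (lebesgue_rV n) _ _ _ mp
  (integrable_norm fi) (integrable_norm Gi) dom.
split; first exact: ip.
rewrite {1}/Rintegral -(integral12_prod_meas1 ip).
rewrite (_ : (\int[leb]_t f t) * _ = \int[leb]_t (f t * \int[lebesgue_rV n]_y G y)); last first.
  by rewrite mulrC -RintegralZl//; apply: eq_Rintegral => x _; rewrite mulrC.
congr fine; apply: eq_integral => x _; rewrite /fubini_F/=.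
rewrite -RintegralZl// /Rintegral fineK//.
apply: integrable_fin_num => //.
under eq_fun do rewrite /= EFinM; exact: integrableZl.
Qed.

Lemma ReM (x y : R[i]) :
  complex.Re (x * y) = complex.Re x * complex.Re y - complex.Im x * complex.Im y.
Proof. by case: x y => ? ? []. Qed.

Lemma ImM (x y : R[i]) :
  complex.Im (x * y) = complex.Re x * complex.Im y + complex.Im x * complex.Re y.
Proof. by case: x y => ? ? []. Qed.

Lemma measurable_complex_prod d (T : measurableType d) n (u v : 'I_n -> T -> R) :
  (forall i, measurable_fun setT (u i)) -> (forall i, measurable_fun setT (v i)) ->
  measurable_fun setT (fun x => complex.Re (\prod_i (u i x +i* v i x)%C)) /\
  measurable_fun setT (fun x => complex.Im (\prod_i (u i x +i* v i x)%C)).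
Proof.
elim: n u v => [|n IH] u v mu mv.
  by split; under eq_fun do rewrite big_ord0; exact: measurable_cst.
have [m1 m2] := IH (fun i => u (lift ord0 i)) (fun i => v (lift ord0 i))
  (fun i => mu _) (fun i => mv _).
split; under eq_fun do rewrite big_ord_recl ?ReM ?ImM/=.
  by apply: measurable_funB; apply: measurable_funM.
by apply: measurable_funD; apply: measurable_funM.
Qed.

(** Each complex factor mixes real and imaginary parts, so the induction has to carry the
    integrability of both together with the value. *)
Lemma cintegral_rV_prod n (u v : 'I_n -> R -> R) :
  (forall i, leb.-integrable setT (EFin \o u i)) ->
  (forall i, leb.-integrable setT (EFin \o v i)) ->
  let F (x : 'rV[R]_n) := \prod_i (u i (x ord0 i) +i* v i (x ord0 i))%C in
  [/\ (lebesgue_rV n).-integrable setT (EFin \o (fun x => complex.Re (F x))),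
      (lebesgue_rV n).-integrable setT (EFin \o (fun x => complex.Im (F x))) &
      cintegral F = \prod_i ((\int[leb]_t u i t) +i* (\int[leb]_t v i t))%C].
Proof.
elim: n u v => [|n IH] u v iu iv F.
  have E (c : R) : (lebesgue_rV 0).-integrable setT (EFin \o cst c) /\
      \int[lebesgue_rV 0]_x (cst c x) = c.
    have I : (\int[lebesgue_rV 0]_x (c%:E) = c%:E)%E by rewrite integral_cst//= diracT mule1.
  split; last by rewrite /Rintegral /= I.
    apply/integrableP; split; first by apply/measurable_EFinP; exact: measurable_cst.
    rewrite [X in (X < _)%E](_ : _ = `|c|%:E)%E ?ltry//.
    by rewrite (eq_integral (cst `|c|%:E))// integral_cst//= diracT mule1.
  have F1 : F = cst 1 by apply/funext => x; rewrite /F big_ord0.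
  rewrite F1 big_ord0 /cintegral/= (E 1).2 (E 0).2.
  by split => //; [exact: (E 1).1|exact: (E 0).1].
have [i1 i2 I] := IH (fun i => u (lift ord0 i)) (fun i => v (lift ord0 i))
  (fun i => iu _) (fun i => iv _).
pose G (x : 'rV[R]_n) :=
  \prod_i (u (lift ord0 i) (x ord0 i) +i* v (lift ord0 i) (x ord0 i))%C.
have FE p : F (rV_cons p) = (u ord0 p.1 +i* v ord0 p.1)%C * G p.2.
  exact: (big_rV_cons _ _ (fun i t => (u i t +i* v i t)%C)).
have mF := @measurable_complex_prod _ 'rV[R]_n.+1 n.+1 (fun i x => u i (x ord0 i))
  (fun i x => v i (x ord0 i))
  (fun i => measurableT_comp (integrable_mf (iu i)) (measurable_rV_coord i))
  (fun i => measurableT_comp (integrable_mf (iv i)) (measurable_rV_coord i)).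
have [p11 P11] := integral_prodM (iu ord0) i1.
have [p12 P12] := integral_prodM (iu ord0) i2.
have [p21 P21] := integral_prodM (iv ord0) i1.
have [p22 P22] := integral_prodM (iv ord0) i2.
have ReF p : complex.Re (F (rV_cons p)) =
    u ord0 p.1 * complex.Re (G p.2) - v ord0 p.1 * complex.Im (G p.2).
  by rewrite FE ?ReM ?ImM.
have ImF p : complex.Im (F (rV_cons p)) =
    u ord0 p.1 * complex.Im (G p.2) + v ord0 p.1 * complex.Re (G p.2).
  by rewrite FE ?ReM ?ImM.
have [iR IR] : (lebesgue_rV n.+1).-integrable setT (EFin \o (fun x => complex.Re (F x))) /\
    \int[lebesgue_rV n.+1]_x complex.Re (F x) = \int[leb_prod n]_p complex.Re (F (rV_cons p)).
  apply: integral_rV_cons; first exact: mF.1.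
  under eq_fun do rewrite ReF EFinB; exact: integrableB.
have [iI II] : (lebesgue_rV n.+1).-integrable setT (EFin \o (fun x => complex.Im (F x))) /\
    \int[lebesgue_rV n.+1]_x complex.Im (F x) = \int[leb_prod n]_p complex.Im (F (rV_cons p)).
  apply: integral_rV_cons; first exact: mF.2.
  under eq_fun do rewrite ImF EFinD; exact: integrableD.
split => //; rewrite big_ord_recl -I /cintegral IR II.
under eq_Rintegral do rewrite ReF.
under [X in (_ +i* X)%C]eq_Rintegral do rewrite ImF.
rewrite RintegralB// RintegralD// P11 P12 P21 P22.
by [].
Qed.

Lemma integral_rV_prod n (g : 'I_n -> R -> R) :
  (forall i, leb.-integrable setT (EFin \o g i)) ->
  (lebesgue_rV n).-integrable setT (EFin \o (fun x => \prod_i g i (x ord0 i))) /\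
  \int[lebesgue_rV n]_x (\prod_i g i (x ord0 i)) = \prod_i \int[leb]_t g i t.
Proof.
move=> ig; have i0 : leb.-integrable setT (EFin \o cst (0 : R)) by exact: integrable0.
have [i1 _ I] := cintegral_rV_prod ig (fun=> i0).
have E (x : 'rV[R]_n) : \prod_i (g i (x ord0 i) +i* (cst 0 : R -> R) (x ord0 i))%C =
    ((\prod_i g i (x ord0 i))%:C)%C by rewrite rmorph_prod.
split; first by move: i1; under eq_fun do rewrite E.
move: I; rewrite /cintegral; under eq_Rintegral do rewrite E.
move=> /(congr1 (@complex.Re R))/= ->.
have I0 : \int[leb]_t (cst 0 : R -> R) t = 0 by rewrite Rintegral_cst// mul0r.
by rewrite I0 -(rmorph_prod (real_complex R)).
Qed.

End rV_integral.

(** * The Fourier transform of an integrable product covariance *)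

Section fourier_rV.
Context {R : realType}.
Local Notation leb := (@lebesgue_measure R).

Lemma cexpiD (x y : R) : cexpi (x + y) = cexpi x * cexpi y.
Proof.
apply/eqP; rewrite eq_complex ReM ImM /= sinD cosD eqxx/=.
by apply/eqP; ring.
Qed.

Lemma cexpi_sum n (f : 'I_n -> R) : cexpi (\sum_i f i) = \prod_i cexpi (f i).
Proof. by apply: (big_morph _ cexpiD); rewrite /cexpi sin0 cos0. Qed.

Lemma integrable_bounded_mul (h g : R -> R) : measurable_fun setT h ->
  (forall t, `|h t| <= 1) -> leb.-integrable setT (EFin \o g) ->
  leb.-integrable setT (EFin \o (fun t => h t * g t)).
Proof.
move=> mh h1 ig; apply: (@integrable_dom _ _ _ leb setT _ (fun t => `|g t|)) => //.
- by apply: measurable_funM => //; exact: integrable_mf ig.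
- exact: integrable_norm.
- by move=> t _; rewrite normrM ler_piMl.
Qed.

Lemma integrable_trig_mul (w : R) (g : R -> R) : leb.-integrable setT (EFin \o g) ->
  leb.-integrable setT (EFin \o (fun t => cos (w * t) * g t)) /\
  leb.-integrable setT (EFin \o (fun t => - sin (w * t) * g t)).
Proof.
move=> ig; split; apply: integrable_bounded_mul => //.
- by apply: (measurableT_comp measurable_cos); exact: measurable_funM.
- by move=> t; exact: cos_max.
- apply: measurableT_comp => //.
  by apply: (measurableT_comp measurable_sin); exact: measurable_funM.
- by move=> t; rewrite normrN; exact: sin_max.
Qed.

Lemma fourier_prod n (g : 'I_n -> R -> R) (w : 'rV[R]_n) :
  (forall i, leb.-integrable setT (EFin \o g i)) ->
  fourier (fun x => ((\prod_i g i (x ord0 i))%:C)%C) w =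
  (((2 * pi) ^- n)%:C)%C * \prod_i ((\int[leb]_t (cos (w ord0 i * t) * g i t)) +i*
    (\int[leb]_t (- sin (w ord0 i * t) * g i t)))%C.
Proof.
move=> ig; rewrite /fourier; congr (_ * _).
have [_ _ <-] := cintegral_rV_prod (fun i => (integrable_trig_mul (w ord0 i) (ig i)).1)
  (fun i => (integrable_trig_mul (w ord0 i) (ig i)).2).
congr cintegral; apply/funext => t; rewrite /dotp -sumrN cexpi_sum rmorph_prod -big_split/=.
apply: eq_bigr => i _; rewrite /cexpi cosN sinN.
by rewrite /GRing.mul/= !mulr0 subr0 add0r.
Qed.

(** Strict positivity excludes the convention [0 * +oo = 0] when an infinite factor is to force an
    infinite product. *)
Lemma integral_cauchy_cov_gt0 (a b : R) : 0 < a -> 0 < b ->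
  (0 < \int[leb]_t (cauchy_cov a b t)%:E)%E.
Proof.
move=> a0 b0; pose c := (2 : R) `^ (- b).
have c0 : 0 < c by rewrite powR_gt0.
apply: (@lt_le_trans _ _ (\int[leb]_t (c * \1_(`[0, 1]%classic : set R) t)%:E)%E).
  under eq_integral do rewrite EFinM.
  rewrite ge0_integralZl//.
  - have -> : (\int[leb]_x (\1_(`[0, 1]%classic : set R) x)%:E = 1)%E.
      rewrite integral_indic// setIT; apply: etrans (lebesgue_measure_itv _) _ => /=.
      by rewrite lte_fin ltr01 -EFinB subr0.
    by rewrite mule1 lte_fin.
  - exact/measurable_EFinP.
  - by rewrite lee_fin ltW.
apply: ge0_le_integral => //.
- by move=> t _; rewrite lee_fin mulr_ge0 ?(ltW c0).
- by apply/measurable_EFinP; exact: measurable_funM.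
- by apply/measurable_EFinP; exact: measurable_cauchy_cov.
move=> t _; rewrite lee_fin indicE; case: (boolP (t \in _)) => [|_]; last first.
  by rewrite mulr0 cauchy_cov_ge0.
rewrite inE /= in_itv/= mulr1 => /andP[t0 t1].
rewrite /c /cauchy_cov !powRN lef_pV2 ?posrE ?powR_gt0//.
rewrite ge0_ler_powR ?nnegrE ?(ltW b0)//.
have ta : `|t| `^ a <= 1 `^ a by rewrite ge0_ler_powR ?nnegrE ?(ltW a0)// ger0_norm.
by rewrite (_ : 2 = 1 + 1)// lerD2l (le_trans ta)// powR1.
Qed.

Variables (n : nat) (alpha beta : 'I_n -> R).
Hypotheses (alpha0 : forall i, 0 < alpha i) (beta0 : forall i, 0 < beta i).

Definition sheet_spec (w : 'rV[R]_n) := \prod_i spec1 (alpha i) (beta i) (w ord0 i).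

(** By Tonelli's theorem the product of the one-dimensional integrals is finite; all factors being
    positive, an infinite one would make it infinite. *)
Lemma integrable_sheet_factor i :
  (lebesgue_rV n).-integrable setT (EFin \o cauchy_sheet_cov alpha beta) ->
  leb.-integrable setT (EFin \o cauchy_cov (alpha i) (beta i)).
Proof.
move=> /integrableP[_]; under eq_integral => t _.
  rewrite /= ger0_norm; last by rewrite prodr_ge0// => j _; rewrite powR_ge0.
  over.
rewrite /= (integral_rV_prod_ge0 (g := fun i => cauchy_cov (alpha i) (beta i))); last 2 first.
- by move=> j; exact: measurable_cauchy_cov.
- by move=> j x; exact: cauchy_cov_ge0.
move=> H; apply/integrableP; split.
  by apply/measurable_EFinP; exact: measurable_cauchy_cov.
under eq_integral do rewrite /= ger0_norm ?cauchy_cov_ge0//.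
rewrite ltey; apply/eqP => Ioo; move: H; rewrite (bigD1 i)//= Ioo.
rewrite gt0_mulye ?ltxx//.
elim/big_ind: _ => [|x y|j _]; [exact: lte01|exact: mule_gt0|exact: integral_cauchy_cov_gt0].
Qed.

Lemma fourier_sheet (w : 'rV[R]_n) :
  (lebesgue_rV n).-integrable setT (EFin \o cauchy_sheet_cov alpha beta) ->
  (forall i, w ord0 i != 0) ->
  fourier (fun t => ((cauchy_sheet_cov alpha beta t)%:C)%C) w = ((sheet_spec w)%:C)%C.
Proof.
move=> iC w0; have ig i := integrable_sheet_factor i iC.
rewrite (fourier_prod _ ig).
have E i : ((\int[leb]_t (cos (w ord0 i * t) * cauchy_cov (alpha i) (beta i) t)) +i*
    (\int[leb]_t (- sin (w ord0 i * t) * cauchy_cov (alpha i) (beta i) t)))%C =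
    ((2 * pi * spec1 (alpha i) (beta i) (w ord0 i))%:C)%C.
  congr (_ +i* _)%C.
    by rewrite -cauchy_cov_cos//; apply: eq_Rintegral => t _; rewrite mulrC.
  transitivity (\int[leb]_t (- 1 * (cauchy_cov (alpha i) (beta i) t * sin (w ord0 i * t)))).
    by apply: eq_Rintegral => t _; ring.
  rewrite RintegralZl// ?cauchy_cov_sin ?mulr0//.
  have [_] := integrable_trig_mul (w ord0 i) (ig i).
  move=> /(integrableZl measurableT (-1)).
  by apply: eq_integrable => // t _; rewrite /= -EFinM; congr (_%:E); ring.
under eq_bigr do rewrite E.
rewrite -(rmorph_prod (real_complex R)) -(rmorphM (real_complex R))/=.
congr (_%:C)%C; rewrite big_split/= prodr_const card_ord mulKf// expf_neq0//.
by rewrite mulf_neq0// gt_eqF// pi_gt0.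
Qed.

End fourier_rV.

(** * Schwartz functions of product form and their pairings *)

Section schwartz_products.
Context {R : realType}.
Local Notation leb := (@lebesgue_measure R).

(** Along the [j]-th basis vector the other factors are constant, so the difference quotient is
    literally a constant times the one-dimensional quotient of [g j]. *)
Lemma is_derive_rV_prod n (g : 'I_n -> R -> R) (dg : 'I_n -> R) (x : 'rV[R]_n) j :
  is_derive (x ord0 j) 1 (g j) (dg j) ->
  is_derive x (delta_mx ord0 j) (fun y : 'rV[R]_n => \prod_i g i (y ord0 i))
    (\prod_i (if i == j then dg i else g i (x ord0 i))).
Proof.
move=> dj; set c := \prod_(i | i != j) g i (x ord0 i).
have -> : \prod_i (if i == j then dg i else g i (x ord0 i)) = c * dg j.
  rewrite (bigD1 j)//= eqxx mulrC; congr (_ * _).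
  by apply: eq_bigr => i /negPf ->.
have E h : \prod_i g i ((h *: delta_mx ord0 j + x) ord0 i) = c * g j (h *: 1 + x ord0 j).
  rewrite (bigD1 j)//= mulrC !mxE !eqxx; congr (_ * _).
  by apply: eq_bigr => i /negPf ij; rewrite !mxE ij andbF mulr0 add0r.
have E0 : \prod_i g i (x ord0 i) = c * g j (x ord0 j) by rewrite (bigD1 j)//= mulrC.
have QE : (fun h : R => h^-1 *: (\prod_i g i ((h *: delta_mx ord0 j + x) ord0 i) -
    \prod_i g i (x ord0 i))) =
    (fun h => h^-1 *: ((c \*: g j) (h *: 1 + x ord0 j) - (c \*: g j) (x ord0 j))).
  by apply/funext => h; rewrite E E0.
case: (is_deriveZ c dj) => d1 d2; split.
- by rewrite /derivable QE; exact: d1.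
- by rewrite /derive QE; exact: d2.
Qed.

Variables (n : nat) (E : 'I_n -> {poly R}).
Hypothesis hE : forall i x, (E i).[x] <= - x ^+ 2.

Definition gprod (P : 'I_n -> {poly R}) (x : 'rV[R]_n) := \prod_i tfun (E i) (P i) (x ord0 i).

Definition pderiv j (P : 'I_n -> {poly R}) i := if i == j then tderiv (E i) (P i) else P i.

Lemma is_derive_gprod P x j :
  is_derive x (delta_mx ord0 j) (gprod P) (gprod (pderiv j P) x).
Proof.
have := is_derive_rV_prod (g := fun i => tfun (E i) (P i))
  (dg := fun i => tfun (E i) (tderiv (E i) (P i)) (x ord0 i)) (x := x) (j := j)
  (is_derive_tfun _ _ _).
move=> H; apply: is_derive_eq H _.
by apply: eq_bigr => i _; rewrite /pderiv; case: ifP.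
Qed.

Lemma iter_partial_gprod s P :
  iter_partial s (gprod P) = gprod (foldr pderiv P s).
Proof.
elim: s => //= j s ->; apply/funext => x.
exact: (@derive_val _ _ _ _ _ _ _ (is_derive_gprod _ _ _)).
Qed.

Lemma gprod_bounded P : exists M, forall x, `|gprod P x| <= M.
Proof.
have [M HM] := @choice _ _ (fun i M => forall x, `|tfun (E i) (P i) x| <= M)
  (fun i => tfun_bounded (hE i) (P i)).
exists (\prod_i M i) => x; rewrite normr_prod; apply: ler_prod => i _.
by rewrite normr_ge0 HM.
Qed.

Lemma gprod_monomial r P : exists Q, forall x : 'rV[R]_n,
  (\prod_(j <- r) x ord0 j) * gprod P x = gprod Q x.
Proof.
elim: r => [|j r [Q HQ]]; first by exists P => x; rewrite big_nil mul1r.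
exists (fun i => if i == j then 'X * Q i else Q i) => x.
rewrite big_cons -mulrA HQ /gprod (bigD1 j)//= [RHS](bigD1 j)//= eqxx tfunM hornerX mulrA.
by congr (_ * _); apply: eq_bigr => i /negPf ->.
Qed.

Lemma schwartz_gprod P : schwartz_real (gprod P).
Proof.
split=> [s i x|s r]; rewrite iter_partial_gprod.
  by case: (is_derive_gprod (foldr pderiv P s) x i).
have [Q HQ] := gprod_monomial r (foldr pderiv P s).
by have [M HM] := gprod_bounded Q; exists M => x; rewrite HQ.
Qed.

Lemma schwartz_real0 : schwartz_real ((fun=> 0) : 'rV[R]_n -> R).
Proof.
have E0 s : iter_partial s ((fun=> 0) : 'rV[R]_n -> R) = cst 0.
  by elim: s => //= j s ->; apply/funext => x; rewrite derive_cst.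
split=> [s i x|s r]; rewrite E0; first exact: derivable_cst.
by exists 0 => x; rewrite mulr0 normr0.
Qed.

Lemma schwartz_gprodC P : schwartz (fun x => ((gprod P x)%:C)%C).
Proof. by split; [exact: schwartz_gprod|exact: schwartz_real0]. Qed.

Variables alpha beta : 'I_n -> R.
Hypotheses (alpha0 : forall i, 0 < alpha i) (beta0 : forall i, 0 < beta i).

Let phi := gprod (fun=> 1).

(** One coordinate of the pairing, in the form required by [cintegral_rV_prod]: the constant
    [(2 pi)^-n] is shared out as one [(2 pi)^-1] per coordinate, and the sine part vanishes because
    the covariance is even. *)
Lemma pair_spec1_tfun i :
  leb.-integrable setT (EFin \o (fun w => spec1 (alpha i) (beta i) w * tfun (E i) 1 w)) /\
  [/\ leb.-integrable setT (EFin \o (fun t => (2 * pi)^-1 * (cauchy_cov (alpha i) (beta i) t *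
        \int[leb]_w (cos (t * w) * tfun (E i) 1 w)))),
      leb.-integrable setT (EFin \o (fun t => (2 * pi)^-1 * (cauchy_cov (alpha i) (beta i) t *
        \int[leb]_w (- sin (t * w) * tfun (E i) 1 w)))),
      \int[leb]_t ((2 * pi)^-1 * (cauchy_cov (alpha i) (beta i) t *
        \int[leb]_w (cos (t * w) * tfun (E i) 1 w))) =
      \int[leb]_w (spec1 (alpha i) (beta i) w * tfun (E i) 1 w) &
      \int[leb]_t ((2 * pi)^-1 * (cauchy_cov (alpha i) (beta i) t *
        \int[leb]_w (- sin (t * w) * tfun (E i) 1 w))) = 0].
Proof.
have [s hs] := sub_exponentP (alpha0 i) (beta0 i); have /and3P[s0 s1 _] := hs.
have ip := integrable_tfun (hE i) 1.
have isp : leb.-integrable setT (EFin \o (fun w => `|tfun (E i) 1 w| * `|w| `^ (s - 1))).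
  by apply: integrable_tfun_powR; rewrite ?s0.
have icos : leb.-integrable setT (fun t => (\int[leb]_w (cos (w * t) * tfun (E i) 1 w))%:E).
  apply: (fourier_tfun_integrable (hE i) (S := sin)).
  - by move=> x; exact: sin_max.
  - by move=> x; exact: cos_max.
have isin : leb.-integrable setT (fun t => (\int[leb]_w (sin (w * t) * tfun (E i) 1 w))%:E).
  apply: (fourier_tfun_integrable (hE i) (S := fun x => - cos x)).
  - by move=> x; apply: is_derive_eq (is_deriveN (is_derive_cos x)) _; rewrite opprK.
  - by move=> x; rewrite opprK; exact: is_derive_sin.
  - by move=> x; rewrite normrN; exact: cos_max.
  - by move=> x; exact: sin_max.
have [isp1 Ic] := parseval_cos (alpha0 i) (beta0 i) ip hs isp icos.
have Is := parseval_sin (alpha0 i) (beta0 i) ip isin.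
have cosE t : \int[leb]_w (cos (t * w) * tfun (E i) 1 w) =
    \int[leb]_w (cos (w * t) * tfun (E i) 1 w).
  by apply: eq_Rintegral => w _; rewrite (mulrC t).
have sinE t : \int[leb]_w (- sin (t * w) * tfun (E i) 1 w) =
    - 1 * \int[leb]_w (sin (w * t) * tfun (E i) 1 w).
  rewrite -RintegralZl//.
    by apply: eq_Rintegral => w _; rewrite (mulrC t) mulrA mulN1r.
  apply: integrable_bounded_mul => //.
    by apply: (measurableT_comp measurable_sin); exact: measurable_funM.
  by move=> w; exact: sin_max.
have icov (f : R -> R) c : leb.-integrable setT (EFin \o f) ->
    leb.-integrable setT (EFin \o (fun t => c * (cauchy_cov (alpha i) (beta i) t * f t))).
  move=> jf; under [X in integrable _ _ X]eq_fun do rewrite /= EFinM.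
  apply: integrableZl => //; apply: integrable_bounded_mul => //.
    exact: measurable_cauchy_cov.
  by move=> t; rewrite ger0_norm ?cauchy_cov_ge0// cauchy_cov_le1.
have icov1 (f : R -> R) : leb.-integrable setT (EFin \o f) ->
    leb.-integrable setT (EFin \o (fun t => cauchy_cov (alpha i) (beta i) t * f t)).
  by move=> jf; have := icov _ 1 jf; apply: eq_integrable => // t _; rewrite /= mul1r.
split => //; split.
- by under eq_fun do rewrite cosE; exact: icov.
- rewrite (_ : (fun t => _) = (fun t => - (2 * pi)^-1 * (cauchy_cov (alpha i) (beta i) t *
    \int[leb]_w (sin (w * t) * tfun (E i) 1 w)))); first exact: icov.
  by apply/funext => t; rewrite sinE; ring.
- under eq_Rintegral do rewrite cosE.
  rewrite RintegralZl//; last exact: icov1.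
  by rewrite Ic mulKf// mulf_neq0// gt_eqF// pi_gt0.
- transitivity (\int[leb]_t (- (2 * pi)^-1 * (cauchy_cov (alpha i) (beta i) t *
    \int[leb]_w (sin (w * t) * tfun (E i) 1 w)))).
    by apply: eq_Rintegral => t _; rewrite sinE; ring.
  by rewrite RintegralZl ?Is ?mulr0//; exact: icov1.
Qed.

Lemma sheet_pairing (S : 'rV[R]_n -> R) :
  generalized_fourier (cauchy_sheet_cov alpha beta) S ->
  (lebesgue_rV n).-integrable setT (EFin \o (fun w => sheet_spec alpha beta w * phi w)) /\
  \int[lebesgue_rV n]_w (S w * phi w) = \int[lebesgue_rV n]_w (sheet_spec alpha beta w * phi w).
Proof.
move=> [_ _ /(_ _ (schwartz_gprodC (fun=> 1)))].
have [iF IF] := integral_rV_prod (fun i => (pair_spec1_tfun i).1).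
have FE w : sheet_spec alpha beta w * phi w =
    \prod_i (spec1 (alpha i) (beta i) (w ord0 i) * tfun (E i) 1 (w ord0 i)).
  by rewrite -big_split.
have -> : (\int[lebesgue_rV n]_w (sheet_spec alpha beta w * phi w)) =
    \prod_i \int[leb]_w (spec1 (alpha i) (beta i) w * tfun (E i) 1 w).
  by rewrite -IF; apply: eq_Rintegral => w _; exact: FE.
move=> H; split; first by move: iF; apply: eq_integrable => // w _; rewrite /= FE.
pose u i t := (2 * pi)^-1 * (cauchy_cov (alpha i) (beta i) t *
  \int[leb]_w (cos (t * w) * tfun (E i) 1 w)).
pose v i t := (2 * pi)^-1 * (cauchy_cov (alpha i) (beta i) t *
  \int[leb]_w (- sin (t * w) * tfun (E i) 1 w)).
have iu i : leb.-integrable setT (EFin \o u i) by have [_ []] := pair_spec1_tfun i.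
have iv i : leb.-integrable setT (EFin \o v i) by have [_ []] := pair_spec1_tfun i.
have HL : complex.Re (cintegral (fun w => ((S w)%:C)%C * ((gprod (fun=> 1) w)%:C)%C)) =
    \int[lebesgue_rV n]_w (S w * phi w).
  by apply: eq_Rintegral => w _; rewrite ReM/= mulr0 subr0.
rewrite -HL H.
have HR : cintegral (fun t => ((cauchy_sheet_cov alpha beta t)%:C)%C *
    fourier (fun x => ((gprod (fun=> 1) x)%:C)%C) t) =
    cintegral (fun x : 'rV[R]_n => \prod_i (u i (x ord0 i) +i* v i (x ord0 i))%C).
  congr cintegral; apply/funext => t.
  rewrite (fourier_prod (g := fun i => tfun (E i) 1)); last by move=> i; exact: integrable_tfun.
  rewrite mulrA -(rmorphM (real_complex R))/= mulrC.
  have -> : cauchy_sheet_cov alpha beta t * (2 * pi) ^- n =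
      \prod_i ((2 * pi)^-1 * cauchy_cov (alpha i) (beta i) (t ord0 i)).
    by rewrite big_split/= prodr_const card_ord exprVn mulrC.
  rewrite (rmorph_prod (real_complex R)) -big_split/=; apply: eq_bigr => i _.
  by rewrite /u /v; apply/eqP; rewrite eq_complex ReM ImM/= !mulr0 subr0 add0r; apply/andP; split; apply/eqP; ring.
rewrite HR; have [_ _ ->] := cintegral_rV_prod iu iv.
rewrite (eq_bigr (fun i => ((\int[leb]_w (spec1 (alpha i) (beta i) w * tfun (E i) 1 w))%:C)%C)).
  by rewrite -(rmorph_prod (real_complex R)).
by move=> i _; have [_ [_ _ -> ->]] := pair_spec1_tfun i.
Qed.

End schwartz_products.

(** * Uniqueness of the density *)

Section boxes.
Context {R : realType} (n : nat).
Local Notation mu := (lebesgue_rV n : {measure set 'rV[R]_n -> \bar R}).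

Definition rV_box (a b : 'I_n -> R) : set 'rV[R]_n := [set x | forall i, a i < x ord0 i < b i].

Definition rV_boxes : set (set 'rV[R]_n) := [set A | exists a b, A = rV_box a b].

Lemma measurable_rV_box a b : measurable (rV_box a b).
Proof.
rewrite (_ : rV_box a b = \bigcap_(i in [set: 'I_n]) (rV_coord i @^-1` `]a i, b i[%classic)).
  apply: fin_bigcap_measurable => // i _.
  by rewrite -[X in measurable X]setTI; exact: measurable_rV_coord.
apply/seteqP; split => [x abx i _|x abx i]; first by rewrite /= in_itv/=; exact: abx.
by have := abx i I; rewrite /= in_itv.
Qed.

Lemma setI_closed_rV_boxes : setI_closed rV_boxes.
Proof.
move=> _ _ [a [b ->]] [c [d ->]].
exists (fun i => Num.max (a i) (c i)), (fun i => Num.min (b i) (d i)).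
apply/seteqP; split => [x [/= ab cd] i|x /= H].
  by have /andP[? ?] := ab i; have /andP[? ?] := cd i; rewrite gt_max lt_min; apply/andP; split; apply/andP.
by split => i; have := H i; rewrite gt_max lt_min => /andP[/andP[? ?] /andP[? ?]]; apply/andP.
Qed.

Lemma measurable_rV_boxes : @measurable _ 'rV[R]_n = <<s rV_boxes >>.
Proof.
apply/seteqP; split; last first.
  apply: smallest_sub; first exact: sigma_algebra_measurable.
  by move=> _ [a [b ->]]; exact: measurable_rV_box.
move=> A mA; pose T := g_sigma_algebraType rV_boxes.
have mid : measurable_fun [set: T] (idfun : T -> 'rV[R]_n).
  apply: measurable_fun_rV => i.
  have mE : @measurable _ R = <<s @RGenOInfty.G R >> by exact: RGenOInfty.measurableE.
  apply: (@measurability _ _ T R setT (rV_coord i \o idfun : T -> R) _ mE).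
  move=> _ [_ [c ->] <-].
  (* The half-space [c < x_i] is the union over [k] of boxes with sides []-k, k[], replaced by []c,
     k[] in direction [i]. *)
  rewrite setTI (_ : _ @^-1` _ = \bigcup_k
    rV_box (fun j => if j == i then c else - k%:R) (fun=> k%:R)).
    by apply: bigcup_measurable => k _; apply: sub_sigma_algebra; eexists; eexists; reflexivity.
  apply/seteqP; split => [x|x [k _] /(_ i)]; last first.
    by rewrite eqxx /= in_itv/= andbT => /andP[].
  rewrite /= in_itv/= andbT => cx.
  pose M := \sum_j `|x ord0 j|.
  have [k Mk] : exists k, M < k%:R by exists (Num.truncn M).+1; rewrite truncnS_gt.
  exists k => // j.
  have : `|x ord0 j| < k%:R.
    by rewrite (le_lt_trans _ Mk)// /M (bigD1 j)//= lerDl sumr_ge0.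
  rewrite ltr_norml => /andP[h1 h2]; rewrite h2 andbT.
  by have [->|_] := eqVneq j i.
by have := mid measurableT A mA; rewrite setTI.
Qed.

(** Boxes form a generating family stable under intersection, and the sets over which [H] integrates
    to 0 form a Dynkin system. The whole space is not a bounded box when [n > 0], so its integral is
    assumed separately; complements rely on it. *)
Lemma ae0_rV_boxes (H : 'rV[R]_n -> R) : mu.-integrable setT (EFin \o H) ->
  (\int[mu]_x (H x)%:E = 0)%E ->
  (forall a b, \int[mu]_(x in rV_box a b) (H x)%:E = 0)%E ->
  {ae mu, forall x, H x = 0}.
Proof.
move=> iH H0 Hbox.
have iHA A : measurable A -> mu.-integrable A (EFin \o H).
  by move=> mA; apply: integrableS iH.
have mH : measurable_fun setT (EFin \o H) by exact: measurable_int iH.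
have H0A A : measurable A -> (\int[mu]_(x in A) (H x)%:E = 0)%E.
  rewrite {1}measurable_rV_boxes => sA.
  apply: (@dynkin_induction _ _ rV_boxes (fun A => \int[mu]_(x in A) (H x)%:E = 0)%E) sA => //.
  - exact: measurable_rV_boxes.
  - exact: setI_closed_rV_boxes.
  - by move=> _ [a [b ->]]; exact: Hbox.
  - move=> B mB B0; have := H0.
    rewrite -(setUv B) integral_setU//=; last 3 first.
    + exact: measurableC.
    + by rewrite setUv.
    + by rewrite disj_set2E setICr.
    by rewrite B0 add0e.
  - move=> F mF tF F0; rewrite integral_bigcup//; last first.
      by apply: iHA; exact: bigcup_measurable.
    by rewrite eseries0.
have := integral_ae_eq measurableT iH (measurable_cst (0%E : \bar R))
  (fun A _ mA => etrans (H0A A mA) (esym (integral0 mu A))).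
by apply: filterS => x /(_ I) [].
Qed.

End boxes.

Section bump.
Context {R : realType}.
Implicit Types m r x : R.

(* As k grows, exp of this polynomial tends pointwise to exp(-x^2) times the
   indicator of ]m - r, m + r[; the factor k settles the endpoints. *)
Definition bump_exponent m r k : {poly R} :=
  - 'X^2 - k%:R *: (r^-1 *: ('X - m%:P)) ^+ (2 * k).

Lemma bump_exponentE m r k x :
  (bump_exponent m r k).[x] = - x ^+ 2 - k%:R * ((x - m) / r) ^+ (2 * k).
Proof.
by rewrite /bump_exponent !(hornerD, hornerN, hornerZ, horner_exp, hornerXn, hornerX, hornerC) (mulrC r^-1).
Qed.

Lemma bump_exponent_le m r k x : (bump_exponent m r k).[x] <= - x ^+ 2.
Proof. by rewrite bump_exponentE lerBlDr lerDl mulr_ge0// exprM exprn_ge0// sqr_ge0. Qed.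

Lemma bump_exponent0 m r x : (bump_exponent m r 0).[x] = - x ^+ 2.
Proof. by rewrite bump_exponentE mul0r subr0. Qed.

(** [1 - s^k] is [1 - s] times the sum of [s^j] for [j < k], and each of these [k] terms is at least
    [s^k]. *)
Lemma natr_mul_expr_le (s : R) k : 0 <= s <= 1 -> k%:R * s ^+ k * (1 - s) <= 1 - s ^+ k.
Proof.
move=> /andP[s0 s1]; elim: k => [|k IH]; first by rewrite !mul0r subrr.
have sk : s ^+ k.+1 * (1 - s) <= 1 - s by rewrite ler_piMl ?subr_ge0// exprn_ile1.
have := ler_wpM2l s0 IH; move: sk; rewrite exprS -natr1.
by set u := s ^+ k; nra.
Qed.

(** One of the two factors [s^k] absorbs [k], by [natr_mul_expr_le]; the other still tends to 0. *)
Lemma cvg_natr_mul_expr (s : R) : 0 <= s < 1 -> k%:R * s ^+ (2 * k) @[k --> \oo] --> (0 : R).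
Proof.
move=> /andP[s0 s1]; have s1' : 0 < 1 - s by rewrite subr_gt0.
apply: (@squeeze_cvgr _ _ _ _ (fun=> 0) (fun k => (1 - s)^-1 * s ^+ k)); last 2 first.
- exact: cvg_cst.
- rewrite -(mulr0 (1 - s)^-1); apply: cvgM; first exact: cvg_cst.
  by apply: cvg_expr; rewrite ger0_norm.
apply: nearW => k; rewrite mulr_ge0 ?exprn_ge0//= mul2n -addnn exprD mulrA.
rewrite ler_wpM2r ?exprn_ge0// -[leRHS]mul1r ler_pdivlMr//.
rewrite (le_trans (natr_mul_expr_le _ _)) ?s0 ?(ltW s1)//.
by rewrite gerBl exprn_ge0.
Qed.

Lemma cvg_bump m r x : 0 < r ->
  tfun (bump_exponent m r k) 1 x @[k --> \oo] -->
  \1_(`]m - r, m + r[%classic : set R) x * expR (- x ^+ 2).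
Proof.
move=> r0; pose s := `|x - m| / r.
have s0 : 0 <= s by rewrite divr_ge0// ltW.
have tE k : tfun (bump_exponent m r k) 1 x = expR (- (k%:R * s ^+ (2 * k))) * expR (- x ^+ 2).
  rewrite /tfun hornerC mul1r bump_exponentE addrC expRD; congr (expR (- (_ * _)) * _).
  rewrite !exprM; congr (_ ^+ k).
  by rewrite /s !expr_div_n real_normK ?num_real.
under eq_fun do rewrite tE.
apply: cvgM; last exact: cvg_cst.
have sE : (x \in (`]m - r, m + r[%classic : set R)) = (s < 1).
  by rewrite mem_setE in_itv/= -ltr_distl /s ltr_pdivrMr// mul1r.
rewrite indicE sE; have [s1|s1] := ltP s 1.
  rewrite -[X in _ --> X](@expR0 R) -oppr0.
  have C : - (k%:R * s ^+ (2 * k)) @[k --> \oo] --> - (0 : R).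
    by apply: cvgN; apply: cvg_natr_mul_expr; rewrite s0.
  exact: cvg_comp C (@continuous_expR R (- 0)).
(* For [s >= 1], endpoints included, the exponent is at most [-k], and [exp (-k) <= 1 / (k + 1)]. *)
apply: (@squeeze_cvgr _ _ _ _ (fun=> 0) (@harmonic R)); last 2 first.
- exact: cvg_cst.
- exact: cvg_harmonic.
apply: nearW => k; rewrite expR_ge0/= expRN /harmonic/= lef_pV2 ?posrE ?expR_gt0//.
apply: le_trans (expR_ge1Dx _); rewrite -natr1 addrC lerD2l.
by rewrite ler_peMr// exprn_ege1.
Qed.

End bump.

Section uniqueness.
Context {R : realType} (n : nat).
Local Notation mu := (lebesgue_rV n : {measure set 'rV[R]_n -> \bar R}).
Variables alpha beta : 'I_n -> R.
Hypotheses (alpha0 : forall i, 0 < alpha i) (beta0 : forall i, 0 < beta i).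
Variable S : 'rV[R]_n -> R.
Hypothesis hS : generalized_fourier (cauchy_sheet_cov alpha beta) S.

Let h x := S x - sheet_spec alpha beta x.

Let pairing (E : 'I_n -> {poly R}) : (forall i x, (E i).[x] <= - x ^+ 2) ->
  mu.-integrable setT (EFin \o (fun x => h x * gprod E (fun=> 1) x)) /\
  \int[mu]_x (h x * gprod E (fun=> 1) x) = 0.
Proof.
move=> hE; have [iF IF] := sheet_pairing hE alpha0 beta0 hS.
have [_ [_ tS] _] := hS; have iS := tS _ (schwartz_gprod hE (fun=> 1)).
have hE' x : h x * gprod E (fun=> 1) x =
  S x * gprod E (fun=> 1) x - sheet_spec alpha beta x * gprod E (fun=> 1) x by rewrite mulrBl.
split.
  have := integrableB measurableT iS iF.
  by apply: eq_integrable => // x _; rewrite /= hE' EFinB.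
by under eq_Rintegral do rewrite hE'; rewrite RintegralB// IF subrr.
Qed.

Let gauss (x : 'rV[R]_n) := \prod_i expR (- x ord0 i ^+ 2).

Let gauss_gt0 x : 0 < gauss x. Proof. by apply: prodr_gt0 => i _; exact: expR_gt0. Qed.

(** The Gaussian weight is itself a test function, the case [k = 0] of the bumps; it makes the
    difference integrable over the whole space and, being positive, keeps its zero set. *)
Let H x := h x * gauss x.

Let gaussE x : gauss x = gprod (fun=> bump_exponent 0 1 0) (fun=> 1) x.
Proof. by apply: eq_bigr => i _; rewrite /tfun hornerC mul1r bump_exponent0. Qed.

Let integral_H : mu.-integrable setT (EFin \o H) /\ \int[mu]_x H x = 0.
Proof.
have [i1 I1] := @pairing (fun=> bump_exponent 0 1 0) (fun _ => @bump_exponent_le _ _ _ _).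
split; first by move: i1; apply: eq_integrable => // x _; rewrite /= /H gaussE.
by rewrite -I1; apply: eq_Rintegral => x _; rewrite /H gaussE.
Qed.

Let integral_H_box a b : (forall i, a i < b i) -> \int[mu]_(x in rV_box a b) H x = 0.
Proof.
move=> ab; pose m i := (a i + b i) / 2; pose r i := (b i - a i) / 2.
have r0 i : 0 < r i by rewrite divr_gt0// subr_gt0.
have amr i : a i = m i - r i by rewrite /m /r; field.
have bmr i : b i = m i + r i by rewrite /m /r; field.
pose phi k := gprod (fun i => bump_exponent (m i) (r i) k) (fun=> 1).
have [iH _] := integral_H.
have cphi x : phi k x @[k --> \oo] --> \1_(rV_box a b) x * gauss x.
  have -> : \1_(rV_box a b) x * gauss x =
      \prod_i (\1_(`]m i - r i, m i + r i[%classic : set R) (x ord0 i) * expR (- x ord0 i ^+ 2)).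
    rewrite big_split/=; congr (_ * _); have [hx|hx] := pselect (rV_box a b x).
      rewrite indicE mem_set// big1// => i _.
      by rewrite indicE mem_set//= in_itv/= -amr -bmr.
    rewrite indicE memNset//; move/existsNP : hx => [i hi].
    rewrite (bigD1 i)//= indicE memNset ?mul0r//= in_itv/= -amr -bmr.
    exact: hi.
  apply: cvg_big => [|i _]; first exact: mul_continuous.
  exact: cvg_bump.
have phi_le k x : `|phi k x| <= gauss x.
  rewrite /phi /gprod normr_prod; apply: ler_prod => i _; rewrite normr_ge0/=.
  by rewrite /tfun hornerC mul1r ger0_norm ?expR_ge0// ler_expR bump_exponent_le.
have P k := @pairing (fun i => bump_exponent (m i) (r i) k) (fun _ => @bump_exponent_le _ _ _ _).
have mind : measurable_fun setT (fun x => \1_(rV_box a b) x * H x).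
  apply: measurable_funM; first by apply: measurable_indic; exact: measurable_rV_box.
  exact: integrable_mf iH.
have L : \int[mu]_x (h x * phi k x) @[k --> \oo] --> \int[mu]_x (\1_(rV_box a b) x * H x).
  apply: (@Rdominated_cvg _ _ _ mu setT (fun k x => h x * phi k x) _ (fun x => `|H x|)) => //.
  - by move=> k; exact: integrable_mf (P k).1.
  - exact: integrable_norm.
  - move=> x _; rewrite /H mulrCA; apply: cvgM; first exact: cvg_cst.
    exact: cphi.
  - by move=> k x _; rewrite /H !normrM ler_wpM2l// (le_trans (phi_le k x))// ler_norm.
have L0 : \int[mu]_x (h x * phi k x) @[k --> \oo] --> 0.
  by under eq_fun do rewrite (P _).2; exact: cvg_cst.
rewrite Rintegral_mkcond -(cvg_unique _ L L0)//.
by apply: eq_Rintegral => x _; rewrite patchE indicE; case: (x \in _); rewrite ?mul1r ?mul0r.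
Qed.

Lemma sheet_spec_ae : {ae mu, forall x, S x = sheet_spec alpha beta x}.
Proof.
have [iH IH] := integral_H.
have E A : measurable A -> (\int[mu]_(x in A) (H x)%:E)%E = (\int[mu]_(x in A) H x)%:E.
  move=> mA; rewrite /Rintegral fineK//; apply: integrable_fin_num => //.
  exact: integrableS iH.
have : {ae mu, forall x, H x = 0}.
  apply: ae0_rV_boxes iH _ _ => [|a b]; first by rewrite E// IH.
  have [ab|] := pselect (forall i, a i < b i).
    by rewrite E ?integral_H_box//; exact: measurable_rV_box.
  move=> /existsNP[i /negP]; rewrite -leNgt => ba.
  rewrite (_ : rV_box a b = set0) ?integral_set0//.
  apply/seteqP; split => // x /(_ i) /andP[ax xb].
  by have := lt_trans ax xb; rewrite ltNge ba.
apply: filterS => x /eqP; rewrite mulf_eq0 (gt_eqF (gauss_gt0 x)) orbF subr_eq0.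
by move/eqP.
Qed.

Definition off_axes : set 'rV[R]_n := [set w | forall i, w ord0 i != 0].

Lemma open_off_axes : open off_axes.
Proof.
rewrite openE => w w0.
suff : \forall x \near w, off_axes x by [].
apply: (@filter_forall 'rV[R]_n 'I_n (fun i => [set x | x ord0 i != 0]) (nbhs w) _) => i.
have := @coord_continuous R 1 n ord0 i w.
by move/cvgr_neq0; apply; exact: w0.
Qed.

Lemma continuous_sheet_spec w : off_axes w -> {for w, continuous (sheet_spec alpha beta)}.
Proof.
move=> w0.
have C : \prod_i spec1 (alpha i) (beta i) (x ord0 i) @[x --> w] -->
    \prod_i spec1 (alpha i) (beta i) (w ord0 i).
  apply: cvg_big => [|i _]; first exact: mul_continuous.
  exact: cvg_comp (@coord_continuous R 1 n ord0 i w)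
    (continuous_spec1 (alpha0 i) (beta0 i) (w0 i)).
exact: C.
Qed.

End uniqueness.

Theorem proposition4p9 (R : realType) (n : nat) (alpha beta : 'I_n -> R)
    (d : measure_display) (T : measurableType d) (P : probability T R)
    (X : 'rV[R]_n -> {RV P >-> R}) (S : 'rV[R]_n -> R)
    (hn : (0 < n)%N)
    (halpha : forall i, 0 < alpha i /\ alpha i <= 2)
    (hbeta : forall i, 0 < beta i)
    (hX : centered_stationary_gaussian_field X (cauchy_sheet_cov alpha beta))
    (hS : spectral_density (cauchy_sheet_cov alpha beta) S) :
  (fun w : 'rV[R]_n => S w / \prod_i Lfactor (alpha i) (beta i) (w ord0 i))
    @ within [set w : 'rV[R]_n | forall i, w ord0 i != 0] (nbhs (0 : 'rV[R]_n)) --> (1 : R).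
Proof.
have alpha0 i : 0 < alpha i by have [] := halpha i.
have SE w : off_axes w -> S w = sheet_spec alpha beta w.
  move: hS; rewrite /spectral_density; case: asboolP => iC; last first.
    (* [S] agrees almost everywhere with a function continuous off the coordinate hyperplanes; the
       condition on the values of [S] turns this into equality at every such point. *)
    move=> [gS cS]; apply: cS => //.
    - exact: open_off_axes.
    - by move=> v v0; exact: continuous_sheet_spec.
    - by apply: filterS (sheet_spec_ae alpha0 hbeta gS) => v.
  by move=> Sw w0; have := Sw w; rewrite fourier_sheet// => -[].
have C : (fun w : 'rV[R]_n => \prod_i (spec1 (alpha i) (beta i) (w ord0 i) /
    Lfactor (alpha i) (beta i) (w ord0 i))) @ within (@off_axes R n) (nbhs (0 : 'rV[R]_n)) --> \prod_(i < n) (1 : R).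
  apply: cvg_big => [|i _]; first exact: mul_continuous.
  (* Away from the coordinate hyperplanes each coordinate tends to 0 through nonzero values, so the
     punctured one-dimensional limit applies factor by factor. *)
  have Ci : (fun w : 'rV[R]_n => w ord0 i) @ within (@off_axes R n) (nbhs (0 : 'rV[R]_n)) --> (0 : R)^'.
    have c0 : w ord0 i @[w --> (0 : 'rV[R]_n)] --> (0 : R).
      by have := @coord_continuous R 1 n ord0 i 0; rewrite /continuous_at mxE.
    move=> A /c0 cA.
    have {}cA : nbhs (0 : 'rV[R]_n) (fun w => w ord0 i != 0 -> A (w ord0 i)) := cA.
    have : nbhs (0 : 'rV[R]_n) (fun w => off_axes w -> A (w ord0 i)).
      by apply: filterS cA => w Aw w0; apply: Aw; exact: w0.
    exact.
  exact: cvg_comp Ci (cvg_spec1_ratio (alpha0 i) (hbeta i)).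
rewrite prodr_const expr1n in C.
apply: cvg_trans C; apply: fmap_within_eq => w; rewrite inE => w0.
by rewrite SE// -prodf_div.
Qed.
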